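(* Let $B$ be a standard Brownian motion started at $0$, $T_1=\inf\{t\ge 0: B_t=1\}$ its first hitting time of level one, $U$ a uniform random variable on $[0,1]$ independent of $B$, and $$\alpha=\frac{B_{UT_1}}{\sqrt{T_1}}.$$ Let $R$ be a three dimensional Bessel process starting from $0$ and $V$ a uniform random variable on $[0,1]$ independent of $R$. Then $$2\,\mathbb{E}[\alpha]=\sqrt{\frac{2}{\pi}}-\mathbb{E}\Big[\frac{V}{R_VR_1^2}\Big].$$ Hence $\mathbb{E}[\alpha]=0$ if and only if $\mathbb{E}\Big[\frac{V}{R_VR_1^2}\Big]=\sqrt{\frac{2}{\pi}}$.
   Context: The three dimensional Bessel process starting from $0$ is the process with the law of the Euclidean norm of a standard three dimensional Brownian motion started at the origin. *)

(* Defs.v *)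
From HB Require Import structures.
From mathcomp Require Import all_boot all_order all_algebra.
From mathcomp Require Import all_classical all_reals all_analysis.

Set Implicit Arguments.
Unset Strict Implicit.
Unset Printing Implicit Defensive.

Import Order.TTheory GRing.Theory Num.Theory.
Import numFieldNormedType.Exports.

Local Open Scope classical_set_scope.
Local Open Scope ring_scope.

(* A real-valued process is a function [X : R -> T -> R]; only the times
   [0 <= t] are meaningful, and nothing is ever assumed at negative times. *)

(* The sigma-algebra generated by the [X t], [t \in I].  [T] need not carry a
   measurable structure, so that with [T := R -> R] and the coordinate maps
   for [X] this is the product sigma-algebra on the space of paths. *)
Definition sigma_process (R : realType) (T : Type) (I : set R)
    (X : R -> T -> R) : set (set T) :=
  <<s \bigcup_(t in I) preimage_set_system setT (X t) measurable >>.

Definition sigma_rv (R : realType) (T : Type) (X : T -> R) : set (set T) :=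
  preimage_set_system setT X measurable.

Definition independent_sigma (d : measure_display) (T : measurableType d)
    (R : realType) (P : probability T R) (G H : set (set T)) : Prop :=
  forall E F, G E -> H F -> P (E `&` F) = (P E * P F)%E.

Definition continuous_process (d : measure_display) (T : measurableType d)
    (R : realType) (P : probability T R) (X : R -> T -> R) : Prop :=
  (forall t, 0 <= t -> measurable_fun setT (X t)) /\
  {ae P, forall w, {within `[0, +oo[, continuous (X ^~ w)}}.

Definition standard_brownian (d : measure_display) (T : measurableType d)
    (R : realType) (P : probability T R) (B : R -> T -> R) : Prop :=
  [/\ continuous_process P B,
      {ae P, forall w, B 0 w = 0},
      forall s t, 0 <= s -> s < t -> forall A, measurable A ->
        P ((B t \- B s) @^-1` A) = normal_prob 0 (Num.sqrt (t - s)) A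
    & forall s t, 0 <= s -> s < t ->
        independent_sigma P (sigma_rv (B t \- B s))
                            (sigma_process `[0, s] B)].

(* Standard three-dimensional Brownian motion started at the origin:
   [W i] is the [i]-th coordinate. *)
Definition standard_brownian3 (d : measure_display) (T : measurableType d)
    (R : realType) (P : probability T R) (W : 'I_3 -> R -> T -> R) : Prop :=
  (forall i, standard_brownian P (W i)) /\
  (forall E : 'I_3 -> set T,
     (forall i, sigma_process `[0, +oo[ (W i) (E i)) ->
     P (\bigcap_i E i) = (\prod_(i < 3) P (E i))%E).

Definition euclidean_norm3 (R : realType) (T : Type)
    (W : 'I_3 -> R -> T -> R) : R -> T -> R :=
  fun t w => Num.sqrt (\sum_(i < 3) W i t w ^+ 2).

(* Equality of the image measures on the path space, with its product
   sigma-algebra. *)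
Definition same_law (d d' : measure_display) (T : measurableType d)
    (T' : measurableType d') (R : realType) (P : probability T R)
    (P' : probability T' R) (X : R -> T -> R) (Y : R -> T' -> R) : Prop :=
  forall C : set (R -> R),
    sigma_process `[0, +oo[ (fun (t : R) (f : R -> R) => f t) C ->
    P [set w | C (X ^~ w)] = P' [set w | C (Y ^~ w)].

(* The product sigma-algebra does not see path continuity, which is therefore
   required separately. *)
Definition bessel3 (d : measure_display) (T : measurableType d)
    (R : realType) (P : probability T R) (X : R -> T -> R) : Prop :=
  continuous_process P X /\
  exists (d' : measure_display) (T' : measurableType d')
         (P' : probability T' R) (W : 'I_3 -> R -> T' -> R),
    standard_brownian3 P' W /\ same_law P P' X (euclidean_norm3 W).

Definition uniform01 (d : measure_display) (T : measurableType d)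
    (R : realType) (P : probability T R) (U : T -> R) : Prop :=
  measurable_fun setT U /\
  forall A, measurable A -> P (U @^-1` A) = uniform_prob (@ltr01 R) A.

(* Independence of a random variable and a whole process. *)
Definition independent_of_process (d : measure_display) (T : measurableType d)
    (R : realType) (P : probability T R) (U : T -> R) (X : R -> T -> R)
    : Prop :=
  independent_sigma P (sigma_rv U) (sigma_process `[0, +oo[ X).

(* The infimum is that of the reals, equal to 0 on the empty set; level 1 is
   almost surely hit by a Brownian motion. *)
Definition hitting_time1 (R : realType) (T : Type) (B : R -> T -> R) (w : T)
    : R :=
  inf [set t | 0 <= t /\ B t w = 1].

(* Paths are continuous and [U] lies in [0, 1] only almost surely, so this is
   almost everywhere equal to a measurable function without having to be
   measurable; the library's integral, built as a supremum over simple
   functions, is insensitive to such null sets. *)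
Definition alpha (R : realType) (T : Type) (B : R -> T -> R) (U : T -> R)
    (w : T) : R :=
  B (U w * hitting_time1 B w) w / Num.sqrt (hitting_time1 B w).

(* Main.v *)
Require Import Defs.
From HB Require Import structures.
From mathcomp Require Import all_boot all_order all_algebra.
From mathcomp Require Import all_classical all_reals all_analysis.
From mathcomp Require Import measurable_realfun ring lra.

Set Implicit Arguments.
Unset Strict Implicit.
Unset Printing Implicit Defensive.

Import Order.TTheory GRing.Theory Num.Theory.
Import numFieldNormedType.Exports.

Local Open Scope classical_set_scope.
Local Open Scope ring_scope.

(* Both sides are computed. The exponential martingales exp (theta B_t - theta^2 t / 2), stopped at
   T_1, give the Laplace transform of T_1 and, integrated in time against exp (- h (1 - B_t)), that of
   the occupation of [0, T_1]; this occupation is T_1 times the law of 1 - B_(U T_1). Integrating in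
   theta and letting h tend to 0 yields E[T_1^(-1/2)] = E[(1 - B_(U T_1)) T_1^(-1/2)] = sqrt (2 / pi),
   so E[alpha] = 0. On the Bessel side 1 / x and 1 / x^2 are integrals of Gaussian functions of x, and
   the Laplace transform of (R_v^2, R_1^2) is the third power of a one-dimensional Gaussian integral;
   Tonelli reduces E[V / (R_V R_1^2)] to sqrt (2 / pi) E[artanh (sqrt V)], and the last factor is 1. *)

(** * Integration modulo null sets *)

(** The obstacle is that stopping at a random time has to be derived from the bare definition of
    Brownian motion. Time is cut at a horizon [K] and discretised with mesh [K / n.+1]. On the grid
    the stopped identities hold exactly, by induction on the number of steps, and they survive the
    limit in [n] and then in [K]. A grid time may overshoot the hitting time, where [B] is no longer
    bounded by 1, so the first limit rests on a second moment bound; the second is dominated, since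
    [B <= 1] up to T_1. On the grid, a uniform fraction of the stopped time becomes a uniform index
    below the stopped one, which turns the sample at [U] into a Riemann sum. Values at random times
    are measurable only up to null sets, hence an integration theory that tolerates this. On the
    Bessel side the real inverse of 0 is 0, whereas the Gaussian integrals that represent it are
    infinite there; finiteness of the total integral shows that this has probability zero. *)

Section ae_tools.
Local Open Scope ereal_scope.
Context d (T : measurableType d) (R : realType).
Implicit Types (mu : {measure set T -> \bar R}) (P : probability T R).

Import HBNNSimple.

(** A simple function below [f], set to 0 on a measurable null set outside which [f = g], keeps its
    integral and lies below [g]. Only simple functions are measured, so [f] and [g] may be
    arbitrary. *)
Lemma ge0_integral_ae_le mu (f g : T -> \bar R) :
  (forall x, 0 <= f x) -> (forall x, 0 <= g x) ->
  {ae mu, forall x, f x = g x} -> \int[mu]_x f x <= \int[mu]_x g x.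
Proof.
move=> f0 g0 [N [mN N0 fgN]].
rewrite ge0_integralTE//; apply: ge_ereal_sup => _ [h hf <-].
pose h' : {nnsfun T >-> R} :=
  mul_nnsfun h (indic_nnsfun R (measurableC mN)).
have hE x : h' x = (h x * \1_(~` N) x)%R by [].
have -> : sintegral mu h = sintegral mu h'.
  rewrite -!integralT_nnsfun; apply: ge0_ae_eq_integral => //.
  - exact/measurable_EFinP.
  - exact/measurable_EFinP.
  - by move=> x _; rewrite lee_fin.
  - by move=> x _; rewrite lee_fin.
  exists N; split => // x xN; apply: contrapT => Nx; apply: xN => _.
  by rewrite hE indicE mem_set// mulr1.
rewrite ge0_integralTE//; apply: ereal_sup_ubound; exists h' => // x.
rewrite hE indicE; have [Nx|Nx] := pselect (N x).
  by rewrite memNset ?mulr0//; apply.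
rewrite mem_set// mulr1 (_ : g x = f x) ?hf//.
by apply: contrapT => gf; apply: Nx; apply: fgN => /= fg; apply: gf; rewrite fg.
Qed.

(* No measurability: the integral is a supremum over simple functions. *)
Lemma integral_ae_eq_any mu (f g : T -> \bar R) :
  {ae mu, forall x, f x = g x} -> \int[mu]_x f x = \int[mu]_x g x.
Proof.
move=> fg; rewrite integralE [RHS]integralE; congr (_ - _).
- apply/eqP; rewrite eq_le; apply/andP; split; apply: ge0_integral_ae_le => //;
    by apply: filterS fg => x /= e; rewrite !funeposE e.
- apply/eqP; rewrite eq_le; apply/andP; split; apply: ge0_integral_ae_le => //;
    by apply: filterS fg => x /= e; rewrite !funenegE e.
Qed.

(** Measurability for the completed measure, the form available for the hitting time and for a path
    read at a random time. *)
Definition ae_measurable mu (f : T -> R) :=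
  exists2 g : T -> R, measurable_fun setT g & {ae mu, forall x, f x = g x}.

Lemma measurable_ae_measurable mu (f : T -> R) :
  measurable_fun setT f -> ae_measurable mu f.
Proof. by move=> mf; exists f => //; apply: aeW. Qed.

Lemma ae_nat mu (Q : nat -> T -> Prop) :
  (forall n, {ae mu, forall x, Q n x}) -> {ae mu, forall x, forall n, Q n x}.
Proof. by move=> aeQ; apply/ae_foralln. Qed.

Lemma cvg_ae_measurable mu (f_ : nat -> T -> R) (f : T -> R) :
  (forall n, ae_measurable mu (f_ n)) ->
  {ae mu, forall x, f_ ^~ x @ \oo --> f x} -> ae_measurable mu f.
Proof.
move=> mf_ cf.
have /choice[g mg] : forall n, exists gn : T -> R,
    measurable_fun setT gn /\ {ae mu, forall x, f_ n x = gn x}.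
  by move=> n; have [gn ? ?] := mf_ n; exists gn.
have [N [mN N0 hN]] : {ae mu, forall x, g ^~ x @ \oo --> f x}.
  have /ae_nat := fun n => (mg n).2.
  apply: filterS2 cf => x cfx fg.
  by rewrite (_ : g^~ x = f_ ^~ x)//; apply/funext => n; rewrite fg.
exists (fun x => (f x * \1_(~` N) x)%R).
  apply: (@measurable_fun_cvg _ _ _ _ (fun n x => (g n x * \1_(~` N) x)%R)).
    move=> n; apply: measurable_funM; first exact: (mg n).1.
    exact/measurable_indic/measurableC.
  move=> x _; rewrite indicE; have [Nx|Nx] := pselect (N x).
    rewrite memNset; last exact.
    by rewrite mulr0; under eq_fun do rewrite mulr0; exact: cvg_cst.
  rewrite mem_set// mulr1; under eq_fun do rewrite mulr1.
  by apply: contrapT => h; apply: Nx; exact: hN.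
exists N; split => // x /= h; apply: contrapT => Nx; apply: h.
by rewrite indicE mem_set// mulr1.
Qed.

Lemma ae_bounded_convergence P (f_ : nat -> T -> R) (f : T -> R) (C : R) :
  (forall n, ae_measurable P (f_ n)) ->
  (forall n, {ae P, forall x, (`|f_ n x| <= C)%R}) ->
  {ae P, forall x, f_ ^~ x @ \oo --> f x} ->
  \int[P]_x (f x)%:E \is a fin_num /\
  \int[P]_x (f_ n x)%:E @[n --> \oo] --> \int[P]_x (f x)%:E.
Proof.
move=> mf_ bf cf.
have [g mg gf] := cvg_ae_measurable mf_ cf.
have /choice[h mh] : forall n, exists gn : T -> R,
    measurable_fun setT gn /\ {ae P, forall x, f_ n x = gn x}.
  by move=> n; have [gn ? ?] := mf_ n; exists gn.
rewrite (_ : (fun n => _) = (fun n => \int[P]_x (h n x)%:E)); last first.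
  apply/funext => n; apply: integral_ae_eq_any.
  by apply: filterS (mh n).2 => x ->.
rewrite (@integral_ae_eq_any _ _ (EFin \o g)); last first.
  by apply: filterS gf => x /= ->.
have /ae_nat hfx := fun n => (mh n).2.
have [|||||+ _ +] := @dominated_convergence _ T R P setT measurableT
  (fun n x => (h n x)%:E) (EFin \o g) (cst C%:E) => //.
- by move=> n; apply/measurable_EFinP; exact: (mh n).1.
- exact/measurable_EFinP.
- apply: filterS3 cf gf hfx => x cfx gx hx _ /=.
  apply: cvg_EFin; first by apply: nearW.
  rewrite (_ : fine \o _ = f_ ^~ x) -?gx//.
  by apply/funext => n /=; rewrite hx.
- by apply: finite_measure_integrable_cst.
- have /ae_nat bfx := bf.
  apply: filterS2 bfx hfx => x b hx n _ /=.
  by rewrite -hx lee_fin.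
- by move=> /integrable_fin_num ifin; split => //; exact: ifin.
Qed.

(** Replacing [f] by the pointwise minimum of [f] and [g] changes it on a null set only and makes
    the comparison hold everywhere; monotonicity is then that of the supremum over simple
    functions. *)
Lemma ge0_ae_le_integral_any mu (f g : T -> \bar R) :
  (forall x, 0 <= f x) -> (forall x, 0 <= g x) ->
  {ae mu, forall x, f x <= g x} -> \int[mu]_x f x <= \int[mu]_x g x.
Proof.
move=> f0 g0 fg; rewrite (@integral_ae_eq_any _ _ (fun x => mine (f x) (g x))); last first.
  by apply: filterS fg => x fgx; apply/esym/min_idPl.
have m0 x : 0 <= mine (f x) (g x) by rewrite le_min f0 g0.
rewrite !ge0_integralTE//; apply: ge_ereal_sup => _ [h hf <-].
apply: ereal_sup_ubound; exists h => // x.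
by apply: le_trans (hf x) _; rewrite ge_min lexx orbT.
Qed.

Lemma ae_measurable_comp mu (phi : R -> R) (f : T -> R) : measurable_fun setT phi ->
  ae_measurable mu f -> ae_measurable mu (phi \o f).
Proof.
move=> mphi [g mg fg]; exists (phi \o g); first exact: measurableT_comp.
by apply: filterS fg => x /= ->.
Qed.

Lemma ae_measurableD mu (f g : T -> R) : ae_measurable mu f -> ae_measurable mu g ->
  ae_measurable mu (fun x => f x + g x)%R.
Proof.
move=> [f' mf ff] [g' mg gg]; exists (fun x => f' x + g' x)%R; first exact: measurable_funD.
by apply: filterS2 ff gg => x -> ->.
Qed.

Lemma ae_measurableM mu (f g : T -> R) : ae_measurable mu f -> ae_measurable mu g ->
  ae_measurable mu (fun x => f x * g x)%R.
Proof.
move=> [f' mf ff] [g' mg gg]; exists (fun x => f' x * g' x)%R; first exact: measurable_funM.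
by apply: filterS2 ff gg => x -> ->.
Qed.

End ae_tools.

(** * Convergence of expectations under a second moment bound *)

Section ui.
Local Open Scope ereal_scope.
Context d (T : measurableType d) (R : realType).
Implicit Types (P : probability T R).

(** Provides versions that are measurable, nonnegative and convergent at every point, so that
    Fatou's lemma and pointwise inequalities apply without exceptional sets. *)
Lemma ge0_ae_regularize P (f_ : nat -> T -> R) (f : T -> R) :
  (forall n, ae_measurable P (f_ n)) ->
  (forall n, {ae P, forall x, (0 <= f_ n x)%R}) ->
  {ae P, forall x, f_ ^~ x @ \oo --> f x} ->
  exists (g_ : nat -> T -> R) (g : T -> R),
  [/\ (forall n, measurable_fun setT (g_ n)) /\ measurable_fun setT g,
      (forall n x, (0 <= g_ n x)%R) /\ (forall x, (0 <= g x)%R),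
      forall x, g_ ^~ x @ \oo --> g x,
      (forall n, {ae P, forall x, f_ n x = g_ n x}) &
      {ae P, forall x, f x = g x}].
Proof.
move=> mf_ f0 cf.
have /choice[h mh] : forall n, exists gn : T -> R,
    measurable_fun setT gn /\ {ae P, forall x, f_ n x = gn x}.
  by move=> n; have [gn ? ?] := mf_ n; exists gn.
have /ae_nat hfx := fun n => (mh n).2.
have /ae_nat f0x := f0.
have [N [mN N0 hN]] : {ae P, forall x, [/\ h ^~ x @ \oo --> f x,
    forall n, (0 <= h n x)%R & forall n, f_ n x = h n x]}.
  apply: filterS3 cf hfx f0x => x cfx hx f0xx; split => //.
  - by rewrite (_ : h^~ x = f_ ^~ x)//; apply/funext => n; rewrite hx.
  - by move=> n; rewrite -hx.
have hN' x : ~ N x -> [/\ h ^~ x @ \oo --> f x,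
    forall n, (0 <= h n x)%R & forall n, f_ n x = h n x].
  by move=> Nx; apply: contrapT => hx; apply: Nx; exact: hN.
pose g_ n x := (h n x * \1_(~` N) x)%R.
pose g x := (f x * \1_(~` N) x)%R.
have gcvg x : g_ ^~ x @ \oo --> g x.
  rewrite /g_ /g indicE; have [Nx|Nx] := pselect (N x).
    rewrite memNset; last exact.
    by rewrite mulr0; under eq_fun do rewrite mulr0; exact: cvg_cst.
  rewrite mem_set// mulr1; under eq_fun do rewrite mulr1.
  by have [] := hN' _ Nx.
have g_0 n x : (0 <= g_ n x)%R.
  rewrite /g_ indicE; have [Nx|Nx] := pselect (N x).
    by rewrite memNset ?mulr0//; apply.
  by rewrite mem_set// mulr1; have [] := hN' _ Nx.
have mg_ n : measurable_fun setT (g_ n).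
  apply: measurable_funM; first exact: (mh n).1.
  exact/measurable_indic/measurableC.
exists g_, g; split.
- by split => //; apply: (@measurable_fun_cvg _ _ _ _ g_).
- split => // x; rewrite -(cvg_lim (@Rhausdorff R) (gcvg x)).
  by apply: limr_ge; [exact: cvgP (gcvg x)|exact: nearW].
- by [].
- move=> n; exists N; split => // x /= gx; apply: contrapT => Nx; apply: gx.
  by rewrite /g_ indicE mem_set// mulr1; have [] := hN' _ Nx.
- exists N; split => // x /= gx; apply: contrapT => Nx; apply: gx.
  by rewrite /g indicE mem_set// mulr1.
Qed.

(** The bound gives uniform integrability: truncation at [M] costs at most [C / M] in expectation,
    uniformly in [n], and the truncated functions converge by bounded convergence. It serves for
    exponentials of Brownian motion at a grid time, which may lie past the hitting time. *)
Lemma l2_bounded_convergence P (f_ : nat -> T -> R) (f : T -> R) (C : R) :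
  (forall n, ae_measurable P (f_ n)) ->
  (forall n, {ae P, forall x, (0 <= f_ n x)%R}) ->
  (forall n, \int[P]_x (f_ n x ^+ 2)%:E <= C%:E) ->
  {ae P, forall x, f_ ^~ x @ \oo --> f x} ->
  \int[P]_x (f x)%:E \is a fin_num /\
  \int[P]_x (f_ n x)%:E @[n --> \oo] --> \int[P]_x (f x)%:E.
Proof.
move=> mf_ f0 bf cf.
have [g_ [g [[mg_ mg] [g_0 g0] cg fg_ fg]]] := ge0_ae_regularize mf_ f0 cf.
rewrite (_ : (fun n => _) = (fun n => \int[P]_x (g_ n x)%:E)); last first.
  apply/funext => n; apply: integral_ae_eq_any.
  by apply: filterS (fg_ n) => x ->.
rewrite (@integral_ae_eq_any _ _ _ _ _ (EFin \o g)); last first.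
  by apply: filterS fg => x /= ->.
have bg n : \int[P]_x (g_ n x ^+ 2)%:E <= C%:E.
  apply: le_trans (bf n); rewrite (@integral_ae_eq_any _ _ _ _ _ (fun x => (f_ n x ^+ 2)%:E))//.
  by apply: filterS (fg_ n) => x ->.
have mg2 n : measurable_fun setT (fun x => (g_ n x ^+ 2)%:E).
  by apply/measurable_EFinP; exact: measurable_funX.
(* By Fatou the limit inherits the bound and can be truncated at the same cost. *)
have bg' : \int[P]_x (g x ^+ 2)%:E <= C%:E.
  have := @fatou _ T R P setT measurableT (fun n x => (g_ n x ^+ 2)%:E) mg2.
  rewrite (_ : (fun x => limn_einf _) = (fun x => (g x ^+ 2)%:E)); last first.
    apply/funext => x; apply: (cvg_limn_einf_sup _).1.
    apply: cvg_EFin; first exact: nearW.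
    by under eq_fun do rewrite /=; exact: cvgM (cg x) (cg x).
  move/(_ (fun n x _ => (_ : 0 <= (g_ n x ^+ 2)%:E))) => h.
  apply: le_trans; first by apply: h => n x; rewrite lee_fin sqr_ge0.
  rewrite limn_einf_lim; apply: lime_le; first exact: is_cvg_einfs.
  apply: nearW => n; apply: le_trans (bg n); apply: ereal_inf_lbound.
  by exists n => /=.
have C0 : (0 <= C)%R.
  by rewrite -lee_fin; apply: le_trans (bg 0%N); apply: integral_ge0 => x _; rewrite lee_fin sqr_ge0.
(* Both inequalities follow from [min k M <= k <= min k M + k ^+ 2 / M]. *)
have key (M : R) (k : T -> R) : (0 < M)%R -> measurable_fun setT k -> (forall x, 0 <= k x)%R ->
    \int[P]_x (k x ^+ 2)%:E <= C%:E ->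
    exists a b : R, [/\ \int[P]_x (k x)%:E = a%:E,
       \int[P]_x (Num.min (k x) M)%:E = b%:E & (b <= a <= b + C / M)%R].
  move=> M0 mk k0 kC.
  have mm : measurable_fun setT (fun x => (Num.min (k x) M)%:E).
    by apply/measurable_EFinP; exact: measurable_minr.
  have m0 x : (0 <= Num.min (k x) M)%R by rewrite le_min k0 ltW.
  have bM : \int[P]_x (Num.min (k x) M)%:E <= M%:E.
    rewrite -[leRHS]mule1 -(probability_setT P) -integral_cst//.
    apply: ge0_le_integral => //.
    + by move=> x _; rewrite lee_fin.
    + by move=> x _; rewrite lee_fin ge_min lexx orbT.
  have aM : \int[P]_x (k x)%:E <= \int[P]_x (Num.min (k x) M)%:E + (C/M)%:E.
    apply: (@le_trans _ _ (\int[P]_x ((Num.min (k x) M)%:E + (M^-1)%:E * (k x ^+2)%:E))).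
      apply: ge0_le_integral => //.
      + by move=> x _; rewrite lee_fin.
      + exact/measurable_EFinP.
      + apply: emeasurable_funD => //; apply: emeasurable_funM => //.
        by apply/measurable_EFinP; exact: measurable_funX.
      + move=> x _; rewrite -EFinM -EFinD lee_fin minElt; case: ifPn => kM.
          by rewrite lerDl mulr_ge0 ?sqr_ge0// invr_ge0 ltW.
        rewrite -leNgt in kM; rewrite -lerBlDl.
        apply: (@le_trans _ _ (k x)); first by rewrite lerBlDr lerDl ltW.
        by rewrite mulrC ler_pdivlMr// expr2 ler_pM// ltW.
    rewrite ge0_integralD//; last 3 first.
    + by move=> x _; rewrite lee_fin.
    + by move=> x _; rewrite -EFinM lee_fin mulr_ge0 ?sqr_ge0// invr_ge0 ltW.
    + by apply: emeasurable_funM => //; apply/measurable_EFinP; exact: measurable_funX.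
    rewrite ge0_integralZl//; last 3 first.
    + by apply/measurable_EFinP; exact: measurable_funX.
    + by move=> x _; rewrite lee_fin sqr_ge0.
    + by rewrite lee_fin invr_ge0 ltW.
    by rewrite leeD2l// mulrC EFinM lee_wpmul2l// lee_fin invr_ge0 ltW.
  have ba : \int[P]_x (Num.min (k x) M)%:E <= \int[P]_x (k x)%:E.
    apply: ge0_le_integral => //.
    + by move=> x _; rewrite lee_fin.
    + exact/measurable_EFinP.
    + by move=> x _; rewrite lee_fin ge_min lexx.
  have bfin : \int[P]_x (Num.min (k x) M)%:E \is a fin_num.
    rewrite ge0_fin_numE; first exact: le_lt_trans bM (ltry _).
    by apply: integral_ge0 => x _; rewrite lee_fin.
  have afin : \int[P]_x (k x)%:E \is a fin_num.
    rewrite ge0_fin_numE.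
      by apply: le_lt_trans aM _; rewrite lte_add_pinfty ?ltry// -ge0_fin_numE// integral_ge0// => x _; rewrite lee_fin.
    by apply: integral_ge0 => x _; rewrite lee_fin.
  exists (fine (\int[P]_x (k x)%:E)), (fine (\int[P]_x (Num.min (k x) M)%:E)).
  rewrite !fineK//; split => //; rewrite -!lee_fin EFinD !fineK// ba /=.
  exact: aM.
have fint (k : T -> R) : measurable_fun setT k -> (forall x, 0 <= k x)%R ->
    \int[P]_x (k x ^+ 2)%:E <= C%:E -> \int[P]_x (k x)%:E \is a fin_num.
  by move=> mk k0 kC; have [a [b [-> _ _]]] := key 1%R k ltr01 mk k0 kC.
split; first exact: fint.
rewrite -(fineK (fint g mg g0 bg')).
rewrite (_ : (fun n => _) = EFin \o (fun n => fine (\int[P]_x (g_ n x)%:E))); last first.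
  by apply/funext => n /=; rewrite fineK// fint.
apply: cvg_EFin; first exact: nearW.
apply/cvgrPdist_le => /= e e0.
(* Makes [C / M] at most [e / 3]; the summand 1 keeps [M] positive when [C = 0]. *)
pose M := (3 * (C + 1) / e)%R.
have M0 : (0 < M)%R by rewrite divr_gt0// mulr_gt0// ltr_wpDl.
have CM : (C / M <= e / 3)%R.
  rewrite ler_pdivrMr// /M; have -> : ((e : R) / 3 * (3 * (C + 1) / e) = C + 1 :> R)%R.
    by field; rewrite gt_eqF.
  by rewrite lerDl.
have : (fun n => \int[P]_x (Num.min (g_ n x) M)%:E) @ \oo --> \int[P]_x (Num.min (g x) M)%:E.
  apply: (proj2 (@ae_bounded_convergence _ _ _ _ _ _ M _ _ _)).
  - by move=> n; apply: measurable_ae_measurable; exact: measurable_minr.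
  - move=> n; apply: aeW => x; rewrite ger0_norm ?ge_min ?lexx ?orbT//.
    by rewrite le_min g_0 ltW.
  - apply: aeW => x; rewrite minr_absE; under eq_fun do rewrite minr_absE.
    apply: cvgMl; apply: cvgB; first by apply: cvgD => //; exact: cvg_cst.
    by apply: cvg_norm; apply: cvgB => //; exact: cvg_cst.
have [a [b [aE bE /andP[ba ab]]]] := key M g M0 mg g0 bg'.
rewrite bE aE /=.
move=> /fine_cvgP[_ /cvgrPdist_le/(_ (e/3)%R)].
have e30 : (0 < e / 3)%R by rewrite divr_gt0.
move/(_ e30); apply: filterS => n /=.
have [an [bn [anE bnE /andP[ban abn]]]] := key M (g_ n) M0 (mg_ n) (g_0 n) (bg n).
rewrite bnE anE /= => h.
move: h; rewrite !ler_norml => /andP[h1 h2]; apply/andP; split; lra.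
Qed.

End ui.

(** * Independence and product measures *)

Section independence.
Local Open Scope ereal_scope.
Context d d1 d2 (T : measurableType d) (T1 : measurableType d1)
  (T2 : measurableType d2) (R : realType) (P : probability T R).

(** The joint law agrees with the product of the marginal laws on rectangles, hence everywhere, and
    Tonelli applies. The law of [g] appears as integration over a second sample point [w']. *)
Lemma indep_integral_pair (f : T -> T1) (g : T -> T2) (phi : T1 * T2 -> \bar R) :
  measurable_fun setT f -> measurable_fun setT g -> measurable_fun setT phi ->
  (forall z, 0 <= phi z) ->
  (forall A B, measurable A -> measurable B ->
     P (f @^-1` A `&` g @^-1` B) = P (f @^-1` A) * P (g @^-1` B)) ->
  \int[P]_w phi (f w, g w) = \int[P]_w \int[P]_w' phi (f w, g w').
Proof.
move=> mf mg mphi phi0 fg.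
pose F : {mfun T >-> T1} := HB.pack f (isMeasurableFun.Build _ _ _ _ _ mf).
pose G : {mfun T >-> T2} := HB.pack g (isMeasurableFun.Build _ _ _ _ _ mg).
have mh : measurable_fun setT (fun w => (f w, g w)) by exact: measurable_fun_pair.
pose H : {mfun T >-> (T1 * T2)%type} :=
  HB.pack (fun w => (f w, g w)) (isMeasurableFun.Build _ _ _ _ _ mh).
transitivity (\int[distribution P H]_z phi z).
  by rewrite ge0_integral_distribution.
rewrite (eq_measure_integral (distribution P F \x distribution P G)); last first.
  move=> A mA _; apply/esym; exact: product_measure_unique.
rewrite fubini_tonelli1//= ge0_integral_distribution//=; last 2 first.
- exact: measurable_fun_fubini_tonelli_F.
- by move=> x; apply: integral_ge0.
apply: eq_integral => w _ /=; rewrite /fubini_F ge0_integral_distribution//.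
exact: measurableT_comp.
Qed.

End independence.

Section independence_product.
Local Open Scope ereal_scope.
Context d (T : measurableType d) (R : realType) (P : probability T R).

Lemma indep_integral_mul (f g : T -> R) :
  measurable_fun setT f -> measurable_fun setT g ->
  (forall w, 0 <= f w)%R -> (forall w, 0 <= g w)%R ->
  (forall A B, measurable A -> measurable B ->
     P (f @^-1` A `&` g @^-1` B) = P (f @^-1` A) * P (g @^-1` B)) ->
  \int[P]_w (f w * g w)%:E = \int[P]_w (f w)%:E * \int[P]_w (g w)%:E.
Proof.
move=> mf mg f0 g0 fg.
transitivity (\int[P]_w (`|f w| * `|g w|)%:E).
  by apply: eq_integral => w _; rewrite !ger0_norm.
rewrite (@indep_integral_pair _ _ _ _ _ _ _ P f g (fun z => (`|z.1| * `|z.2|)%:E))//=.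
  rewrite -ge0_integralZr//=; last 3 first.
  - exact/measurable_EFinP.
  - by move=> w _; rewrite lee_fin.
  - by apply: integral_ge0 => w _; rewrite lee_fin.
  apply: eq_integral => w _.
  under eq_integral do rewrite EFinM.
  rewrite ge0_integralZl//=; last first.
    by apply/measurable_EFinP; exact: measurableT_comp.
  rewrite ger0_norm//; congr (_ * _).
  by apply: eq_integral => w' _; rewrite ger0_norm.
apply/measurable_EFinP; apply: measurable_funM.
  by apply: measurableT_comp => //; exact: measurable_fst.
by apply: measurableT_comp => //; exact: measurable_snd.
Qed.

End independence_product.

(** * Densities and Gaussian integrals *)

Section density.
Local Open Scope ereal_scope.
Context d (T : measurableType d) (R : realType).
Variables (mu nu : {measure set T -> \bar R}) (p : T -> R).
Hypothesis mp : measurable_fun setT p.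
Hypothesis p0 : forall x, (0 <= p x)%R.
Hypothesis nuE : forall A, measurable A -> nu A = \int[mu]_(x in A) (p x)%:E.

Import HBNNSimple.

Let density_nnsfun (h : {nnsfun T >-> R}) :
  \int[nu]_x (h x)%:E = \int[mu]_x ((h x)%:E * (p x)%:E).
Proof.
rewrite integralT_nnsfun sintegralE.
under [RHS]eq_integral => x _.
  rewrite (fimfunE h x) -fsumEFin// ge0_mule_fsuml; last first.
    by move=> r; rewrite EFinM nnfun_muleindic_ge0.
  over.
rewrite ge0_integral_fsum//; last 2 first.
- move=> r; apply: emeasurable_funM; last exact/measurable_EFinP.
  by apply/measurable_EFinP; apply: measurable_funM => //; exact: measurable_indic.
- move=> r x _; apply: mule_ge0; last by rewrite lee_fin.
  by rewrite EFinM nnfun_muleindic_ge0.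
apply: eq_fsbigr => r _.
have mr : measurable (h @^-1` [set r]) by [].
have [r0|r0] := leP 0%R r; last first.
  have hr : h @^-1` [set r] = set0.
    rewrite -subset0 => x /= hx; suff : (0 <= r)%R by rewrite leNgt r0.
    by rewrite -hx.
  rewrite hr measure0 mule0; apply/esym; apply: integral0_eq => x _.
  by rewrite indic0 mulr0 mul0e.
rewrite nuE//.
under [RHS]eq_integral => x _ do rewrite EFinM -muleA.
rewrite ge0_integralZl//=; last 2 first.
- apply: emeasurable_funM; apply/measurable_EFinP => //.
- by move=> x _; rewrite -EFinM lee_fin mulr_ge0.
congr (_ * _); rewrite integral_mkcond; apply: eq_integral => x _.
by rewrite patchE indicE; case: ifPn => _; rewrite ?mul1e ?mul0e.
Qed.

Lemma ge0_integral_density (f : T -> \bar R) :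
  measurable_fun setT f -> (forall x, 0 <= f x) ->
  \int[nu]_x f x = \int[mu]_x (f x * (p x)%:E).
Proof.
move=> mf f0; pose f_ := nnsfun_approx measurableT mf.
have fE x : f x = limn (fun n => (f_ n x)%:E).
  by apply/esym/cvg_lim => //; exact: cvg_nnsfun_approx.
transitivity (limn (fun n => \int[nu]_x (f_ n x)%:E)).
  rewrite -monotone_convergence//=.
  - by apply: eq_integral => x _.
  - by move=> n; exact/measurable_EFinP.
  - by move=> n x _; rewrite lee_fin.
  - by move=> x _ a b ab; rewrite lee_fin; exact/lefP/nd_nnsfun_approx.
under eq_fun do rewrite density_nnsfun.
rewrite -monotone_convergence//=.
- apply: eq_integral => x _; rewrite fE limeMr//.
  by apply: ereal_nondecreasing_is_cvgn => a b ab; rewrite lee_fin; exact/lefP/nd_nnsfun_approx.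
- by move=> n; apply: emeasurable_funM; exact/measurable_EFinP.
- by move=> n x _; rewrite -EFinM lee_fin mulr_ge0.
- move=> x _ a b ab; rewrite -!EFinM lee_fin ler_wpM2r//.
  exact/lefP/nd_nnsfun_approx.
Qed.

End density.

Section gaussian.
Local Open Scope ereal_scope.
Context {R : realType}.

(* Completing the square: up to a constant the integrand is the density of another normal law. *)
Lemma normal_prob_quadratic (s a b : R) : (0 < s)%R -> (0 <= a)%R ->
  \int[normal_prob 0 s]_x (expR (- (a * x ^+ 2) / 2 + b * x))%:E =
  (expR (b ^+ 2 * s ^+ 2 / (2 * (1 + a * s ^+ 2))) / Num.sqrt (1 + a * s ^+ 2))%:E.
Proof.
move=> s0 a0.
pose q := (1 + a * s ^+ 2)%R.
have q0 : (0 < q)%R by rewrite /q ltr_wpDr// mulr_ge0// sqr_ge0.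
pose s' := (s / Num.sqrt q)%R.
have sq0 : (0 < Num.sqrt q)%R by rewrite sqrtr_gt0.
have s'0 : (0 < s')%R by rewrite divr_gt0.
have s'2 : (s' ^+ 2 = s ^+ 2 / q)%R by rewrite /s' expr_div_n sqr_sqrtr// ltW.
pose m := (b * s' ^+ 2)%R.
rewrite (@ge0_integral_density _ _ _ lebesgue_measure _ (normal_pdf 0 s))//; last 3 first.
- exact: measurable_normal_pdf.
- by move=> x; exact: normal_pdf_ge0.
- apply/measurable_EFinP; apply: measurableT_comp => //; apply: measurable_funD.
    by apply: measurable_funM => //; apply: measurableT_comp => //; exact: measurable_funM.
  exact: measurable_funM.
pose c := (expR (b ^+ 2 * s ^+ 2 / (2 * q)) / Num.sqrt q)%R.
transitivity (\int[lebesgue_measure]_x (c%:E * (normal_pdf m s' x)%:E)).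
  apply: eq_integral => x _; rewrite -!EFinM; congr EFin.
  rewrite !normal_pdfE ?gt_eqF// /normal_fun /normal_peak /c.
  rewrite s'2.
  have -> : Num.sqrt (s ^+ 2 / q * pi *+ 2) = (Num.sqrt (s ^+ 2 * pi *+ 2) / Num.sqrt q)%R.
    have sp0 : (0 <= s ^+ 2 * pi *+ 2)%R.
      by rewrite mulrn_wge0// mulr_ge0 ?pi_ge0// sqr_ge0.
    rewrite -sqrtrV ?(ltW q0)// -(sqrtrM _ sp0).
    by congr Num.sqrt; ring.
  set S := Num.sqrt (s ^+ 2 * pi *+ 2).
  have S0 : S != 0%R.
    by rewrite gt_eqF// sqrtr_gt0 mulrn_wgt0// mulr_gt0 ?pi_gt0// exprn_gt0.
  rewrite mulrCA -expRD.
  transitivity (S^-1 * (expR (b ^+ 2 * s ^+ 2 / (2 * q)) *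
     expR (- (x - m) ^+ 2 / (s ^+ 2 / q *+ 2))))%R; last first.
    by field; rewrite gt_eqF.
  rewrite -expRD; congr (_ * expR _)%R.
  rewrite /m s'2 subr0 /q; field.
  by rewrite -/q !gt_eqF.
rewrite ge0_integralZl//; last 3 first.
- by apply/measurable_EFinP; exact: measurable_normal_pdf.
- by move=> x _; rewrite lee_fin normal_pdf_ge0.
- by rewrite lee_fin divr_ge0 ?expR_ge0 ?ltW.
by rewrite integral_normal_pdf mule1.
Qed.

Lemma normal_prob_expR (s b : R) : (0 < s)%R ->
  \int[normal_prob 0 s]_x (expR (b * x))%:E = (expR (b ^+ 2 * s ^+ 2 / 2))%:E.
Proof.
move=> s0; have := normal_prob_quadratic b s0 (lexx 0%R).
rewrite mul0r addr0 sqrtr1 divr1 mulr1 => <-.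
by apply: eq_integral => x _; rewrite mul0r oppr0 mul0r add0r.
Qed.

End gaussian.

(** * Brownian motion and its stopped exponential martingales *)

(** The sample space with [sigma_process I X] as its measurable structure: being determined by the
    times in [I] becomes plain [measurable_fun] out of this type. *)
Notation history X I :=
  (g_sigma_algebraType (\bigcup_(t in I) preimage_set_system setT (X t) measurable)).

Section history.
Context (R : realType) d (T : measurableType d).
Implicit Types (X : R -> T -> R) (I J : set R).

Lemma history_eval X I t : I t -> measurable_fun setT (X t : history X I -> R).
Proof.
move=> It _ A mA; apply: sub_sigma_algebra; exists t => //.
by exists A.
Qed.

Lemma history_measurable X I (f : T -> R) :
  (forall t, I t -> measurable_fun setT (X t)) ->
  measurable_fun setT (f : history X I -> R) -> measurable_fun setT f.
Proof.
move=> mX mf _ A mA; have := mf measurableT A mA.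
apply: smallest_sub; first exact: sigma_algebra_measurable.
by move=> _ [t It [B mB <-]]; exact: mX.
Qed.

Lemma history_sub X I J (f : T -> R) : I `<=` J ->
  measurable_fun setT (f : history X I -> R) ->
  measurable_fun setT (f : history X J -> R).
Proof.
move=> IJ mf _ A mA; have := mf measurableT A mA.
apply: sub_smallest2r; first exact: smallest_sigma_algebra.
by move=> B [t It ?]; exists t => //; exact: IJ.
Qed.

End history.

Section brownian.
Local Open Scope ereal_scope.
Context d (T : measurableType d) (R : realType) (P : probability T R).
Variable B : R -> T -> R.
Hypothesis hB : standard_brownian P B.

Lemma brownian_measurable t : (0 <= t)%R -> measurable_fun setT (B t).
Proof. by case: hB => -[mB _] _ _ _; exact: mB. Qed.

Lemma past_measurable s (f : T -> R) :
  measurable_fun setT (f : history B `[0%R, s] -> R) -> measurable_fun setT f.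
Proof.
apply: history_measurable => t; rewrite /= in_itv/= => /andP[t0 _].
exact: brownian_measurable.
Qed.

Lemma brownian_increment s t (g : R -> \bar R) : (0 <= s)%R -> (s < t)%R ->
  measurable_fun setT g -> (forall x, 0 <= g x) ->
  \int[P]_w g (B t w - B s w)%R = \int[normal_prob 0 (Num.sqrt (t - s))]_x g x.
Proof.
move=> s0 st mg g0.
have mD : measurable_fun setT (B t \- B s)%R.
  by apply: measurable_funB; apply: brownian_measurable => //; lra.
have mD' : measurable_fun setT ((B t \- B s)%R : T -> measurableTypeR R) by exact: mD.
pose D : {mfun T >-> measurableTypeR R} :=
  HB.pack (B t \- B s)%R (isMeasurableFun.Build _ _ _ _ _ mD').
transitivity (\int[distribution P D]_x g x).
  by rewrite ge0_integral_distribution.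
rewrite (@eq_measure_integral _ _ _ setT (normal_prob 0 (Num.sqrt (t - s)))
  (distribution P D) g)// => A mA _.
by case: hB => _ _ h _; exact: h.
Qed.

Lemma brownian_increment_indep s t (f : T -> R) (g : R -> R) : (0 <= s)%R -> (s < t)%R ->
  measurable_fun setT (f : history B `[0%R, s] -> R) -> (forall w, (0 <= f w)%R) ->
  measurable_fun setT g -> (forall x, (0 <= g x)%R) ->
  \int[P]_w (f w * g (B t w - B s w))%:E =
  \int[P]_w (f w)%:E * \int[normal_prob 0 (Num.sqrt (t - s))]_x (g x)%:E.
Proof.
move=> s0 st mf f0 mg g0.
have mD : measurable_fun setT (B t \- B s)%R.
  by apply: measurable_funB; apply: brownian_measurable => //; lra.
have mg' : measurable_fun setT (fun x : R => (g x)%:E) by exact/measurable_EFinP.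
rewrite -(brownian_increment s0 st)//.
rewrite indep_integral_mul//.
- exact: past_measurable mf.
- exact: measurableT_comp.
move=> A C mA mC; rewrite setIC muleC.
have [_ _ _ /(_ s t s0 st)] := hB; apply.
  exists (g @^-1` C); last by rewrite setTI.
  by rewrite -[_ @^-1` _]setTI; exact: mg.
by rewrite -[_ @^-1` _]setTI; exact: mf.
Qed.

(** One step of the exponential martingale with a past weight [f]. The weight will carry the
    survival event and, for the occupation, a Riemann sum. *)
Lemma brownian_expR s t (f : T -> R) (b : R) : (0 <= s)%R -> (s < t)%R ->
  measurable_fun setT (f : history B `[0%R, s] -> R) -> (forall w, (0 <= f w)%R) ->
  \int[P]_w (f w * expR (b * (B t w - B s w)))%:E =
  (expR (b ^+ 2 * (t - s) / 2))%:E * \int[P]_w (f w)%:E.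
Proof.
move=> s0 st mf f0.
rewrite (@brownian_increment_indep s t f (fun x => expR (b * x)))//; last first.
  by apply: measurableT_comp => //; exact: measurable_funM.
rewrite normal_prob_expR ?sqrtr_gt0 ?subr_gt0//.
by rewrite sqr_sqrtr ?subr_ge0 ?ltW// muleC.
Qed.

End brownian.

(** * Optional stopping on a discrete grid *)

Section stopping.
Variables (T : Type) (A : nat -> set T).
Hypothesis A_dec : forall k, A k.+1 `<=` A k.

(* Number of survival events [A 0, ..., A m.-1] that occur, that is the minimum of [m] and of the
   first index [k] outside [A k]. *)
Definition stop m w : nat := (\sum_(k < m) (w \in A k))%N.

Lemma survival_le j k : (j <= k)%N -> A k `<=` A j.
Proof.
elim: k => [|k ih]; first by rewrite leqn0 => /eqP ->.
rewrite leq_eqVlt => /orP[/eqP ->//|jk]; exact: subset_trans (@A_dec k) (ih jk).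
Qed.

Lemma stop0 w : stop 0 w = 0%N.
Proof. by rewrite /stop big_ord0. Qed.

Lemma stop_le m w : (stop m w <= m)%N.
Proof.
rewrite /stop -[X in (_ <= X)%N](card_ord m) -sum1_card; apply: leq_sum => i _.
by case: (_ \in _).
Qed.

Lemma stop_survival m w : A m w -> stop m w = m.
Proof.
move=> Am; rewrite /stop -[RHS](card_ord m) -sum1_card; apply: eq_bigr => i _.
by rewrite mem_set//; exact: (survival_le (ltnW (ltn_ord i)) Am).
Qed.

Lemma stopS m w : stop m.+1 w = if w \in A m then m.+1 else stop m w.
Proof.
rewrite /stop big_ord_recr/= -/(stop m w); case: ifPn => [/set_mem Am|_].
  by rewrite stop_survival// addn1.
by rewrite addn0.
Qed.

Lemma lt_stop j m w : (j < stop m w)%N -> A j w.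
Proof.
elim: m => [|m ih]; first by rewrite stop0.
rewrite stopS; case: ifPn => [/set_mem Am|_]; last exact: ih.
by rewrite ltnS => jm; exact: (survival_le jm Am).
Qed.

Lemma stop_lt j m w : (j < m)%N -> A j w -> (j < stop m w)%N.
Proof.
elim: m => // m ih jm Aj; rewrite stopS; case: ifPn => // /negP Am.
apply: ih => //; move: jm; rewrite ltnS leq_eqVlt => /orP[/eqP jm|//].
by exfalso; apply: Am; rewrite -jm mem_set.
Qed.

(** The stopped sequence moves from [X m] to [X m.+1] exactly on [A m]. Only sums occur, so that for
    nonnegative [X] both sides can be integrated before any finiteness is known. *)
Lemma stop_telescope (R : realType) (X : nat -> T -> R) m w :
  X (stop m.+1 w) w + \1_(A m) w * X m w = X (stop m w) w + \1_(A m) w * X m.+1 w.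
Proof.
rewrite stopS indicE; case: ifPn => [/set_mem Am|_]; last by rewrite !mul0r.
by rewrite !mul1r addrC stop_survival.
Qed.

End stopping.

Lemma measurable_stopped d (T : measurableType d) (R : realType) (A : nat -> set T)
    (X : nat -> T -> R) m :
  (forall k, A k.+1 `<=` A k) ->
  (forall k, measurable_fun setT (\1_(A k) : T -> R)) ->
  (forall k, measurable_fun setT (X k)) ->
  measurable_fun setT (fun w => X (stop A m w) w).
Proof.
move=> A_dec mA mX; elim: m => [|m ih].
  rewrite (_ : (fun w => _) = X 0%N); first exact: mX.
  by apply/funext => w; rewrite stop0.
rewrite (_ : (fun w => _) = (fun w => X (stop A m w) w +
    \1_(A m) w * X m.+1 w - \1_(A m) w * X m w)); last first.
  by apply/funext => w; rewrite -stop_telescope// addrK.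
apply: measurable_funB; last exact: measurable_funM.
by apply: measurable_funD => //; exact: measurable_funM.
Qed.

Section optional_stopping.
Local Open Scope ereal_scope.
Context d (T : measurableType d) (R : realType) (P : probability T R).
Variable B : R -> T -> R.
Hypothesis hB : standard_brownian P B.
Variables (delta : R) (A : nat -> set T).
Hypothesis delta0 : (0 < delta)%R.
Hypothesis A_dec : forall k, A k.+1 `<=` A k.
Hypothesis mA : forall k, measurable_fun setT
  (\1_(A k) : history B `[0%R, (k%:R * delta)%R] -> R).

Let S k := B (k%:R * delta)%R.
Let tk0 k : (0 <= k%:R * delta :> R)%R. Proof. by rewrite mulr_ge0// ltW. Qed.

Lemma past_grid j k : (j <= k)%N ->
  measurable_fun setT (S j : history B `[0%R, (k%:R * delta)%R] -> R).
Proof.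
move=> jk; apply: history_eval; rewrite /= in_itv/= tk0/=.
by apply: ler_wpM2r; [exact: ltW|rewrite ler_nat].
Qed.

Let mAT k : measurable_fun setT (\1_(A k) : T -> R).
Proof. exact: (past_measurable hB (@mA k)). Qed.

(** The expectation of the stopped sequence moves by [c - b], the expected increment on survival;
    for a martingale [b = c]. *)
Lemma stopped_step (X : nat -> T -> R) m (a b c : R) :
  (forall k, measurable_fun setT (X k)) -> (forall k w, (0 <= X k w)%R) ->
  \int[P]_w (X (stop A m w) w)%:E = a%:E ->
  \int[P]_w (\1_(A m) w * X m w)%:E = b%:E ->
  \int[P]_w (\1_(A m) w * X m.+1 w)%:E = c%:E ->
  \int[P]_w (X (stop A m.+1 w) w)%:E = (a - b + c)%:E.
Proof.
move=> mX X0 ha hb hc.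
have mAm : measurable_fun setT (\1_(A m) : T -> R) := past_measurable hB (@mA m).
have i0 w : (0 <= (\1_(A m) w : R))%R by rewrite indicE.
have : \int[P]_w (X (stop A m.+1 w) w)%:E + b%:E = a%:E + c%:E.
  rewrite -ha -hb -hc -!ge0_integralD//.
  - by apply: eq_integral => w _; rewrite -!EFinD stop_telescope.
  - by move=> w _; rewrite lee_fin.
  - by apply/measurable_EFinP; exact: measurable_stopped.
  - by move=> w _; rewrite lee_fin mulr_ge0.
  - by apply/measurable_EFinP; exact: measurable_funM.
  - by move=> w _; rewrite lee_fin.
  - by apply/measurable_EFinP; exact: measurable_stopped.
  - by move=> w _; rewrite lee_fin mulr_ge0.
  - by apply/measurable_EFinP; exact: measurable_funM.
move=> /(congr1 (fun x => x - b%:E)); rewrite addeK// => ->.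
by transitivity ((a + c - b)%:E) => //; congr EFin; ring.
Qed.

Lemma grid_expR k (f : T -> R) (p : R) :
  measurable_fun setT (f : history B `[0%R, (k%:R * delta)%R] -> R) ->
  (forall w, (0 <= f w)%R) ->
  \int[P]_w (f w * expR (p * S k.+1 w))%:E =
  (expR (p ^+ 2 * delta / 2))%:E * \int[P]_w (f w * expR (p * S k w))%:E.
Proof.
move=> mf f0.
have lt : (k%:R * delta < k.+1%:R * delta :> R)%R by rewrite ltr_pM2r// ltr_nat.
have := @brownian_expR _ _ _ P B hB _ _ (fun w => (f w * expR (p * S k w))%R) p (tk0 k) lt.
rewrite (_ : (k.+1%:R * delta - k%:R * delta = delta)%R); last by rewrite -natr1; ring.
move=> <-.
- apply: eq_integral => w _; rewrite -mulrA -expRD; congr (_ * expR _)%:E.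
  by rewrite /S; ring.
- apply: measurable_funM => //; apply: measurableT_comp => //.
  by apply: measurable_funM => //; exact: past_grid.
- by move=> w; rewrite mulr_ge0 ?expR_ge0.
Qed.

Let G p k w := expR (p * S k w - p ^+ 2 / 2 * (k%:R * delta)).

Let mS k : measurable_fun setT (S k).
Proof. exact: (brownian_measurable hB (tk0 k)). Qed.

Let mG p k : measurable_fun setT (G p k).
Proof.
apply: measurableT_comp => //; apply: measurable_funB => //.
exact: measurable_funM.
Qed.

Let G0 p k w : (0 <= G p k w)%R. Proof. exact: expR_ge0. Qed.

Lemma indic_stopped_le (X : nat -> T -> R) m w : (forall k w, (0 <= X k w)%R) ->
  (\1_(A m) w * X m w <= X (stop A m w) w)%R.
Proof.
move=> X0; rewrite indicE; have [Am|Am] := pselect (A m w).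
  by rewrite mem_set// mul1r stop_survival.
by rewrite memNset// mul0r.
Qed.

(** On [A m] the stopped value is [X m], so its finite expectation dominates. This is the finiteness
    that the subtraction in [stopped_step] requires. *)
Lemma indic_stopped_fin (X : nat -> T -> R) m (a : R) :
  (forall k, measurable_fun setT (X k)) -> (forall k w, (0 <= X k w)%R) ->
  \int[P]_w (X (stop A m w) w)%:E = a%:E ->
  exists b : R, \int[P]_w (\1_(A m) w * X m w)%:E = b%:E.
Proof.
move=> mX X0 ha.
have mAm : measurable_fun setT (\1_(A m) : T -> R) := past_measurable hB (@mA m).
have i0 w : (0 <= (\1_(A m) w : R))%R by rewrite indicE.
exists (fine (\int[P]_w (\1_(A m) w * X m w)%:E)); rewrite fineK//.
rewrite ge0_fin_numE; last by apply: integral_ge0 => w _; rewrite lee_fin mulr_ge0.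
apply: (@le_lt_trans _ _ a%:E); last exact: ltry.
rewrite -ha; apply: ge0_le_integral => //.
- by move=> w _; rewrite lee_fin mulr_ge0.
- by apply/measurable_EFinP; exact: measurable_funM.
- by apply/measurable_EFinP; exact: measurable_stopped.
- by move=> w _; rewrite lee_fin indic_stopped_le.
Qed.

Lemma stopped_initial (X : nat -> T -> R) (x : R) :
  {ae P, forall w, X 0%N w = x} -> \int[P]_w (X (stop A 0 w) w)%:E = x%:E.
Proof.
move=> Xx; under eq_integral do rewrite stop0.
rewrite (@integral_ae_eq_any _ _ _ _ _ (cst x%:E)).
  by rewrite integral_cst//= (probability_setT P) mule1.
by apply: filterS Xx => w ->.
Qed.

Lemma ae_start : {ae P, forall w, S 0%N w = 0%R}.
Proof. by case: hB => _ h _ _; apply: filterS h => w; rewrite /S mul0r. Qed.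

(** On survival up to [m], the factor [exp (p^2 delta / 2)] gained by the next increment is
    cancelled by the compensator, so every step leaves the expectation at 1. *)
Lemma stopped_exponential p m :
  \int[P]_w (expR (p * S (stop A m w) w - p ^+ 2 / 2 * ((stop A m w)%:R * delta)))%:E = 1.
Proof.
rewrite -[LHS]/(\int[P]_w (G p (stop A m w) w)%:E).
elim: m => [|m ih].
  apply: (stopped_initial (X := G p)).
  by apply: filterS ae_start => w; rewrite /G => ->; rewrite mulr0 mul0r mulr0 subr0 expR0.
have [b hb] := indic_stopped_fin (mG p) (G0 p) ih.
rewrite (stopped_step (mG p) (G0 p) ih hb (c := b)); first by rewrite subrK.
pose f w := (\1_(A m) w * expR (- (p ^+ 2 / 2 * (m.+1%:R * delta))))%R.
transitivity (\int[P]_w (f w * expR (p * S m.+1 w))%:E).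
  apply: eq_integral => w _; congr EFin; rewrite /f /G -[RHS]mulrA -expRD.
  by congr (_ * expR _)%R; ring.
rewrite grid_expR; last 2 first.
- exact: measurable_funM.
- by move=> w; rewrite mulr_ge0 ?expR_ge0// indicE.
rewrite -ge0_integralZl//.
- rewrite -hb; apply: eq_integral => w _; rewrite -EFinM; congr EFin.
  rewrite /f mulrCA -!(mulrA (\1_(A m) w)) mulrCA -!expRD mulrCA -expRD.
  congr (_ * expR _)%R.
  by rewrite -natr1; field.
- apply/measurable_EFinP; apply: measurable_funM.
    by apply: measurable_funM; [exact: (past_measurable hB (@mA m))|exact: measurable_cst].
  by apply: measurableT_comp => //; exact: measurable_funM.
- by move=> w _; rewrite lee_fin !mulr_ge0 ?expR_ge0// indicE.
Qed.

(** The stopped time is at most [m delta], so [exp (c S)] is at most [exp (c^2 m delta / 2)] times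
    the stopped martingale. This is the source of the second moment bounds. *)
Lemma stopped_expR_le c m :
  \int[P]_w (expR (c * S (stop A m w) w))%:E <= (expR (c ^+ 2 / 2 * (m%:R * delta)))%:E.
Proof.
have mSt : measurable_fun setT (fun w => (expR (c * S (stop A m w) w))%:E).
  apply/measurable_EFinP; apply: measurableT_comp => //; apply: measurable_funM => //.
  exact: measurable_stopped.
have mE : measurable_fun setT (fun w => (G c (stop A m w) w)%:E).
  by apply/measurable_EFinP; exact: measurable_stopped.
rewrite -[leRHS]mule1 -(stopped_exponential c m) -ge0_integralZl//.
- apply: ge0_le_integral => //.
  + by apply: measurable_funeM; exact: mE.
  + move=> w _; rewrite -EFinM -expRD lee_fin ler_expR.
    rewrite addrCA lerDl subr_ge0; apply: ler_wpM2l.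
      by rewrite divr_ge0 ?sqr_ge0.
    by apply: ler_wpM2r; [exact: ltW|rewrite ler_nat stop_le].
Qed.

End optional_stopping.

(** * Exponential martingales weighted by occupation *)

Section occupation.
Local Open Scope ereal_scope.
Context d (T : measurableType d) (R : realType) (P : probability T R).
Variable B : R -> T -> R.
Hypothesis hB : standard_brownian P B.
Variables (delta : R) (A : nat -> set T).
Hypothesis delta0 : (0 < delta)%R.
Hypothesis A_dec : forall k, A k.+1 `<=` A k.
Hypothesis mA : forall k, measurable_fun setT
  (\1_(A k) : history B `[0%R, (k%:R * delta)%R] -> R).

Let S k := B (k%:R * delta)%R.

(** The rate [q] is separate from [p]: one step multiplies the expectation by
    [exp ((p^2 / 2 - q) delta)], and with [q = theta^2 / 2] both [p = theta] and [p = theta + h] are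
    used. *)
Definition expmart p q k w := expR (p * S k w - q * (k%:R * delta)).

(** Left Riemann sum of the time integral of [exp (h (B_s - 1))]; for [h > 0] the shift by 1 keeps
    the integrand at most 1 before the hitting time. *)
Definition occupation h k w := (\sum_(j < k) delta * expR (h * (S j w - 1)))%R.

Let mS k : measurable_fun setT (S k).
Proof. by apply: (brownian_measurable hB); rewrite mulr_ge0// ltW. Qed.

Let past_S j k : (j <= k)%N ->
  measurable_fun setT (S j : history B `[0%R, (k%:R * delta)%R] -> R).
Proof. exact: past_grid. Qed.

Lemma measurable_expmart p q k : measurable_fun setT (expmart p q k).
Proof.
apply: measurableT_comp => //; apply: measurable_funB => //.
exact: measurable_funM.
Qed.

Lemma expmart_ge0 p q k w : (0 <= expmart p q k w)%R.
Proof. exact: expR_ge0. Qed.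

(** The bound is [k.+1] and not [k]: with left endpoints, a sum of [k.+1] terms ends at [S k]. *)
Lemma past_occupation h j k : (j <= k.+1)%N ->
  measurable_fun setT (occupation h j : history B `[0%R, (k%:R * delta)%R] -> R).
Proof.
move=> jk; apply: measurable_sum => i; apply: measurable_funM => //.
apply: measurableT_comp => //; apply: measurable_funM => //.
apply: measurable_funB => //; apply: past_S.
by rewrite -ltnS; apply: leq_trans (ltn_ord i) jk.
Qed.

Lemma occupation_ge0 h k w : (0 <= occupation h k w)%R.
Proof. by apply: sumr_ge0 => i _; rewrite mulr_ge0 ?expR_ge0// ltW. Qed.

Lemma measurable_occupation h k : measurable_fun setT (occupation h k).
Proof. by apply: (past_measurable hB); apply: past_occupation (leqnSn k). Qed.

Lemma expmart_step k (f : T -> R) p q :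
  measurable_fun setT (f : history B `[0%R, (k%:R * delta)%R] -> R) ->
  (forall w, (0 <= f w)%R) ->
  \int[P]_w (f w * expmart p q k.+1 w)%:E =
  (expR ((p ^+ 2 / 2 - q) * delta))%:E * \int[P]_w (f w * expmart p q k w)%:E.
Proof.
move=> mf f0.
have mf' := past_measurable hB mf.
pose g w := (f w * expR (- (q * (k.+1%:R * delta))))%R.
have g0 w : (0 <= g w)%R by rewrite mulr_ge0 ?expR_ge0.
have mg : measurable_fun setT (g : history B `[0%R, (k%:R * delta)%R] -> R).
  exact: measurable_funM.
have mg' := past_measurable hB mg.
transitivity (\int[P]_w (g w * expR (p * S k.+1 w))%:E).
  apply: eq_integral => w _; congr EFin; rewrite /g /expmart -[RHS]mulrA -expRD.
  by congr (_ * expR _)%R; ring.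
rewrite (grid_expR hB delta0 p mg g0) -!ge0_integralZl//.
- apply: eq_integral => w _; rewrite -!EFinM; congr EFin.
  rewrite /g mulrCA -!(mulrA (f w)) mulrCA -!expRD mulrCA -expRD.
  rewrite [RHS]mulrCA /expmart -expRD; congr (_ * expR _)%R.
  by rewrite /S -natr1; field.
- apply/measurable_EFinP; apply: measurable_funM => //; exact: measurable_expmart.
- by move=> w _; rewrite lee_fin mulr_ge0 ?expR_ge0.
- apply/measurable_EFinP; apply: measurable_funM => //.
  by apply: measurableT_comp => //; apply: measurable_funM => //; exact: mS.
- by move=> w _; rewrite lee_fin mulr_ge0 ?expR_ge0.
Qed.

(** Let [X] be the martingale of parameter [theta] times the occupation and [V] the exponential of
    parameter [theta + h]. A surviving step adds, in expectation, [delta * expR (- h) * V m] to [X]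
    and [(rho - 1) * V m] to [V]. The two expectations therefore grow proportionally, starting from
    0 and 1. *)
Lemma stopped_occupation theta h m : (0 < h)%R -> (0 < theta)%R ->
  exists a b : R,
  [/\ \int[P]_w (expmart theta (theta ^+ 2 / 2) (stop A m w) w *
        occupation h (stop A m w) w)%:E = a%:E,
      \int[P]_w (expmart (theta + h) (theta ^+ 2 / 2) (stop A m w) w)%:E = b%:E &
      ((expR ((h ^+ 2 / 2 + theta * h) * delta) - 1) * a =
       delta * expR (- h) * (b - 1))%R].
Proof.
move=> h0 theta0.
set q := (theta ^+ 2 / 2)%R; set rho := expR _.
pose X k w := (expmart theta q k w * occupation h k w)%R.
pose V k w := expmart (theta + h) q k w.
have X0 k w : (0 <= X k w)%R by rewrite mulr_ge0 ?expmart_ge0 ?occupation_ge0.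
have V0 k w : (0 <= V k w)%R by exact: expmart_ge0.
have mX k : measurable_fun setT (X k).
  by apply: measurable_funM; [exact: measurable_expmart|exact: measurable_occupation].
have mV k : measurable_fun setT (V k) by exact: measurable_expmart.
have iA0 k w : (0 <= (\1_(A k) w : R))%R by rewrite indicE.
elim: m => [|m [a [b [ha hb hab]]]].
  exists 0%R, 1%R; split.
  - apply: (stopped_initial A (X := X)); apply: aeW => w.
    by rewrite /X /occupation big_ord0 mulr0.
  - apply: (stopped_initial A (X := V)).
    apply: filterS (ae_start hB delta) => w h1.
    have h2 : S 0%N w = 0%R := h1.
    by rewrite /V /expmart h2 mulr0 mul0r mulr0 subr0 expR0.
  - by rewrite subrr !mulr0.
have [a' ha'] := indic_stopped_fin hB A_dec mA mX X0 ha.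
have [b' hb'] := indic_stopped_fin hB A_dec mA mV V0 hb.
have mAm := past_measurable hB (@mA m).
have hb'' : \int[P]_w (\1_(A m) w * V m.+1 w)%:E = (rho * b')%:E.
  rewrite expmart_step// hb' -EFinM; congr (expR _ * _)%:E.
  by rewrite /q; field.
have ha'' : \int[P]_w (\1_(A m) w * X m.+1 w)%:E = (a' + delta * expR (- h) * b')%:E.
  (* This Riemann sum is already known at time [m * delta], so it joins the survival indicator as
     the weight of a martingale step. *)
  pose f w := (\1_(A m) w * occupation h m.+1 w)%R.
  transitivity (\int[P]_w (f w * expmart theta q m.+1 w)%:E).
    by apply: eq_integral => w _; rewrite /f /X; congr EFin; ring.
  rewrite expmart_step; last 2 first.
  - by apply: measurable_funM => //; exact: past_occupation.
  - by move=> w; rewrite mulr_ge0// occupation_ge0.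
  rewrite /q subrr mul0r expR0 mul1e.
  rewrite EFinD EFinM -ha' -hb' -ge0_integralZl//; last 3 first.
  - by apply/measurable_EFinP; exact: measurable_funM.
  - by move=> w _; rewrite lee_fin mulr_ge0.
  - by rewrite lee_fin mulr_ge0 ?expR_ge0// ltW.
  rewrite -ge0_integralD//; last 4 first.
  - by move=> w _; rewrite lee_fin mulr_ge0.
  - by apply/measurable_EFinP; exact: measurable_funM.
  - by move=> w _; rewrite -EFinM lee_fin !mulr_ge0 ?expR_ge0// ltW.
  - by apply: measurable_funeM; apply/measurable_EFinP; exact: measurable_funM.
  apply: eq_integral => w _; rewrite -EFinM -EFinD; congr EFin.
  rewrite /f /X /V /occupation big_ord_recr/= -/(occupation h m w).
  have -> : (expmart (theta + h) q m w = expmart theta q m w * expR (h * S m w))%R.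
    by rewrite /expmart -expRD; congr expR; ring.
  rewrite (_ : h * (S m w - 1) = - h + h * S m w)%R; last by ring.
  by rewrite expRD /q; ring.
exists (a - a' + (a' + delta * expR (- h) * b'))%R, (b - b' + rho * b')%R; split.
- exact: (stopped_step hB A_dec mA mX X0 ha ha' ha'').
- exact: (stopped_step hB A_dec mA mV V0 hb hb' hb'').
- have -> : ((rho - 1) * (a - a' + (a' + delta * expR (- h) * b')) =
    (rho - 1) * a + (rho - 1) * (delta * expR (- h) * b'))%R by ring.
  by rewrite hab; ring.
Qed.

End occupation.

(** * Sampling at an independent uniform time *)

Section uniform_sampling.
Local Open Scope ereal_scope.
Context d (T : measurableType d) (R : realType) (P : probability T R).
Variables (X : R -> T -> R) (U : T -> R).
Hypothesis mX : forall t, (0 <= t)%R -> measurable_fun setT (X t).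
Hypothesis hU : uniform01 P U.
Hypothesis hUX : independent_of_process P U X.

Lemma uniform_prob01 (A : set R) : measurable A -> A `<=` `[0%R, 1%R] ->
  uniform_prob (@ltr01 R) A = lebesgue_measure A.
Proof.
move=> mA A01; rewrite /uniform_prob.
rewrite (eq_integral (cst 1)); first by rewrite integral_cst//= mul1e.
move=> x; rewrite inE/= => /A01; rewrite /= in_itv/= => x01.
by rewrite /uniform_pdf x01 subr0 invr1.
Qed.

Lemma uniform_prob_itvco (a b : R) : (0 <= a)%R -> (a <= b)%R -> (b <= 1)%R ->
  uniform_prob (@ltr01 R) `[a, b[%classic = (b - a)%:E.
Proof.
move=> a0 ab b1; rewrite uniform_prob01//.
  by rewrite lebesgue_measure_itv/= lte_fin; case: ltgtP ab => // -> _; rewrite subrr.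
move=> x; rewrite /= !in_itv/= => /andP[ax xb].
by rewrite (le_trans a0 ax) (ltW (lt_le_trans xb b1)).
Qed.

(** The value 1 is excluded because it would produce the sample index [N], one too many. *)
Lemma ae_uniform01 : {ae P, forall w, (0 <= U w < 1)%R}.
Proof.
case: hU => mU hA; exists (~` (U @^-1` `[0%R, 1%R[)); split => //.
- by apply: measurableC; rewrite -[X in measurable X]setTI; exact: mU.
- rewrite probability_setC; last by rewrite -[X in measurable X]setTI; exact: mU.
  by rewrite hA// uniform_prob_itvco// subr0 subee.
Qed.

Lemma future_measurable (f : T -> R) :
  measurable_fun setT (f : history X `[0%R, +oo[ -> R) -> measurable_fun setT f.
Proof.
by apply: history_measurable => t; rewrite /= in_itv/= andbT; exact: mX.
Qed.

Lemma uniform_indep (f : T -> R) (a b : R) :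
  (0 <= a)%R -> (a <= b)%R -> (b <= 1)%R ->
  measurable_fun setT (f : history X `[0%R, +oo[ -> R) -> (forall w, (0 <= f w)%R) ->
  \int[P]_w (\1_`[a, b[ (U w) * f w)%:E = (b - a)%:E * \int[P]_w (f w)%:E.
Proof.
move=> a0 ab b1 mf f0; case: hU => mU hA.
have mI : measurable_fun setT ((\1_`[a, b[ : R -> R) \o U).
  by apply: measurableT_comp => //; exact: measurable_indic.
rewrite (@indep_integral_mul _ _ _ P ((\1_`[a, b[ : R -> R) \o U))//.
- congr (_ * _).
  rewrite (_ : (fun w => _) = (EFin \o (\1_(U @^-1` `[a, b[) : T -> R))); last first.
    by apply/funext => w /=; rewrite !indicE.
  rewrite integral_indic//; last by rewrite -[X in measurable X]setTI; exact: mU.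
  rewrite setIT; transitivity (uniform_prob (@ltr01 R) `[a, b[%classic).
    exact: hA.
  exact: uniform_prob_itvco.
- exact: future_measurable.
move=> A C mA mC; apply: hUX.
  exists (((\1_`[a, b[ : R -> R)) @^-1` A); last by rewrite setTI.
  by rewrite -[X in measurable X]setTI; apply: measurable_indic.
by rewrite -[_ @^-1` _]setTI; exact: mf.
Qed.

Definition sample_index (N : nat) w := Num.truncn (U w * N%:R).

Lemma sample_index_lt N w : (0 <= U w < 1)%R -> (0 < N)%N -> (sample_index N w < N)%N.
Proof.
move=> /andP[U0 U1] N0; rewrite -(ltr_nat R).
have UN0 : (0 <= U w * N%:R)%R by rewrite mulr_ge0.
have /andP[h _] := truncn_itv UN0.
by apply: le_lt_trans h _; rewrite gtr_pMl// ltr0n.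
Qed.

Lemma sample_index_eq N j w : (0 <= U w < 1)%R -> (0 < N)%N ->
  (sample_index N w == j) = (U w \in `[(j%:R / N%:R)%R, (j.+1%:R / N%:R)%R[).
Proof.
move=> /andP[U0 U1] N0; rewrite in_itv/= ler_pdivrMr ?ltr_pdivlMr ?ltr0n//.
by rewrite truncn_eq// mulr_ge0.
Qed.

(** Given [N w = n > 0], the index [floor (U n)] is uniform on the integers below [n] and
    independent of the process, so [n] times the sampled term has the expectation of the whole sum.
    When [N w = 0] both sides vanish. *)
Lemma uniform_sampling (N : T -> nat) m (c : nat -> nat -> T -> R) :
  (forall w, (N w <= m)%N) ->
  (forall n, measurable_fun setT (\1_[set w | N w = n] : history X `[0%R, +oo[ -> R)) ->
  (forall n j, (j < n)%N -> measurable_fun setT (c n j : history X `[0%R, +oo[ -> R)) ->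
  (forall n j w, (0 <= c n j w)%R) ->
  \int[P]_w ((N w)%:R * c (N w) (sample_index (N w) w) w)%:E =
  \int[P]_w (\sum_(j < N w) c (N w) j w)%:E.
Proof.
move=> Nm mN mc c0.
pose I n := (\1_[set w | N w = n] : T -> R).
have I0 n w : (0 <= I n w)%R by rewrite /I indicE.
have IE n w : I n w = (N w == n)%:R.
  by rewrite /I indicE; congr (nat_of_bool _)%:R; apply/idP/eqP; rewrite inE.
pose F n j w := (\1_`[(j%:R / n%:R)%R, (j.+1%:R / n%:R)%R[ (U w) *
   (n%:R * (I n w * c n j w)))%R.
have F0 n j w : (0 <= F n j w)%R by rewrite /F indicE !mulr_ge0.
have mG n j : (j < n)%N ->
    measurable_fun setT ((fun w => I n w * c n j w)%R : history X `[0%R, +oo[ -> R).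
  by move=> jn; apply: measurable_funM; [exact: mN|exact: mc].
have mF n j : (j < n)%N -> measurable_fun setT (F n j).
  move=> jn; apply: measurable_funM.
    by apply: measurableT_comp; [exact: measurable_indic|case: hU].
  by apply: measurable_funM => //; apply: future_measurable; exact: mG.
transitivity (\int[P]_w \sum_(n < m.+1) \sum_(j < n) (F n j w)%:E).
  (* Split over the value [n] of [N w] and the sampled index [j]; when [N w > 0] exactly one summand
     is nonzero. *)
  apply: integral_ae_eq_any; apply: filterS ae_uniform01 => w Uw.
  under eq_bigr do rewrite sumEFin; rewrite sumEFin; congr EFin.
  have lNm : (N w < m.+1)%N by rewrite ltnS.
  rewrite (bigD1 (Ordinal lNm))//= [X in (_ + X)%R]big1 ?addr0; last first.
    move=> n nN; apply: big1 => j _; rewrite /F IE.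
    by rewrite (_ : (N w == n) = false) ?mul0r ?mulr0//; apply: contraNF nN => /eqP h; apply/eqP/val_inj.
  have [N0|N0] := posnP (N w); first by rewrite N0 mul0r big_ord0.
  have ln := sample_index_lt Uw N0.
  rewrite (bigD1 (Ordinal ln))//= big1 ?addr0; last first.
    move=> j jn; rewrite /F indicE.
    rewrite (_ : (_ \in _) = false) ?mul0r//; apply: contraNF jn; rewrite inE => h.
    apply/eqP/val_inj => /=; apply/esym/eqP; by rewrite sample_index_eq.
  rewrite /F IE eqxx mul1r indicE mem_set ?mul1r//=.
  by rewrite -sample_index_eq.
rewrite ge0_integral_sum//; last 2 first.
- by move=> n; apply: emeasurable_sum => j; apply/measurable_EFinP; exact: mF.
- by move=> n w _; apply: sume_ge0 => j _; rewrite lee_fin.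
transitivity (\int[P]_w \sum_(n < m.+1) \sum_(j < n) (I n w * c n j w)%:E); last first.
  apply: eq_integral => w _.
  under eq_bigr do rewrite sumEFin; rewrite sumEFin; congr EFin.
  have lNm : (N w < m.+1)%N by rewrite ltnS.
  rewrite (bigD1 (Ordinal lNm))//= [X in (_ + X)%R]big1 ?addr0; last first.
    move=> n nN; apply: big1 => j _; rewrite IE.
    by rewrite (_ : (N w == n) = false) ?mul0r//; apply: contraNF nN => /eqP h; apply/eqP/val_inj.
  by apply: eq_bigr => j _; rewrite IE eqxx mul1r.
rewrite ge0_integral_sum//; last 2 first.
- move=> n; apply: emeasurable_sum => j; apply/measurable_EFinP.
  by apply: future_measurable; exact: mG.
- by move=> n w _; apply: sume_ge0 => j _; rewrite lee_fin mulr_ge0.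
apply: eq_bigr => n _.
rewrite !ge0_integral_sum//; last 4 first.
- by move=> j; apply/measurable_EFinP; apply: future_measurable; exact: mG.
- by move=> j w _; rewrite lee_fin mulr_ge0.
- by move=> j; apply/measurable_EFinP; exact: mF.
- by move=> j w _; rewrite lee_fin.
apply: eq_bigr => j _.
have n0 : (0 < n%:R :> R)%R by rewrite ltr0n (leq_ltn_trans _ (ltn_ord j)).
rewrite uniform_indep.
- rewrite -mulrBl -natrB// subSnn mul1r.
  rewrite [X in _ * X](_ : _ = n%:R%:E * \int[P]_w (I n w * c n j w)%:E).
    by rewrite muleA -EFinM mulVf ?mul1e// gt_eqF.
  rewrite -ge0_integralZl//.
  + by apply/measurable_EFinP; apply: future_measurable; exact: mG.
  + by move=> w _; rewrite lee_fin mulr_ge0.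
- by rewrite divr_ge0.
- by rewrite ler_pM2r ?invr_gt0// ler_nat.
- by rewrite ler_pdivrMr// mul1r ler_nat.
- by apply: measurable_funM => //; exact: mG.
- by move=> w; rewrite !mulr_ge0.
Qed.

End uniform_sampling.

(** * The hitting time of level one *)

Section paths.
Context (R : realType).
Implicit Types b : R -> R.

Lemma path_dist b : {within `[0, +oo[, continuous b} ->
  forall x e : R, 0 <= x -> 0 < e ->
  exists2 r, 0 < r & forall y, 0 <= y -> `|x - y| < r -> `|b x - b y| < e.
Proof.
move=> /subspace_continuousP cb x e x0 e0.
have := cb x; rewrite /= in_itv/= andbT => /(_ x0) /cvgrPdist_lt /(_ e e0).
rewrite /within/= => -[r /= r0 hr]; exists r => // y y0 xy.
by apply: hr => //; rewrite in_itv/= andbT.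
Qed.

Lemma path_cvg b (u : nat -> R) (x : R) : {within `[0, +oo[, continuous b} ->
  (forall n, 0 <= u n) -> 0 <= x -> u @ \oo --> x -> b \o u @ \oo --> b x.
Proof.
move=> cb u0 x0 ux; apply/cvgrPdist_lt => /= e e0.
have [r r0 hr] := path_dist cb x0 e0.
move/cvgrPdist_lt : ux => /(_ r r0); apply: filterS => n h.
exact: hr.
Qed.

(** The time [t] itself is left out: the property then holds at the hitting time, and the supremum
    in [level_time] is attained. *)
Definition alive b t := forall s, 0 <= s -> s < t -> b s < 1.

(** For a continuous path started at 0 and [K >= 0] this is the minimum of [K] and the first hitting
    time of 1, in a form that also makes sense on paths that never reach 1. *)
Definition level_time b K := sup [set t | 0 <= t <= K /\ alive b t].

Section level_time.
Variables (b : R -> R) (K : R).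
Hypothesis cb : {within `[0, +oo[, continuous b}.
Hypothesis b0 : b 0 = 0.
Hypothesis K0 : 0 <= K.
Local Notation sigma := (level_time b K).

Let has_sup_alive : has_sup [set t | 0 <= t <= K /\ alive b t].
Proof.
split; last by exists K => t [/andP[]].
by exists 0; split; [rewrite lexx|move=> s s0; rewrite ltNge s0].
Qed.

Lemma level_time_ge0 : 0 <= sigma.
Proof.
apply: ub_le_sup; first by case: has_sup_alive.
by split; [rewrite lexx|move=> s s0; rewrite ltNge s0].
Qed.

Lemma level_time_le : sigma <= K.
Proof. by apply: ge_sup; [case: has_sup_alive|move=> t [/andP[]]]. Qed.

Lemma alive_level_time : alive b sigma.
Proof.
move=> s s0 ss; have [t [_ ha] st] := sup_adherent (eps := sigma - s) ltac:(by rewrite subr_gt0) has_sup_alive.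
by apply: ha => //; move: st; rewrite subKr.
Qed.

Lemma alive_le t : 0 <= t -> t <= K -> alive b t <-> t <= sigma.
Proof.
move=> t0 tK; split=> [ta|ts].
  by apply: ub_le_sup; [case: has_sup_alive|split => //; rewrite t0].
by move=> s s0 st; apply: alive_level_time => //; exact: lt_le_trans ts.
Qed.

Lemma level_time_value_le : b sigma <= 1.
Proof.
rewrite leNgt; apply/negP => bs.
have [s0|s0] := ltP 0 sigma; last first.
  have s00 : sigma = 0 by apply/le_anti; rewrite s0 level_time_ge0.
  by move: bs; rewrite s00 b0 ltr10.
have [r r0 hr] := path_dist cb level_time_ge0 (e := b sigma - 1) ltac:(by rewrite subr_gt0).
pose y := Num.max 0 (sigma - r / 2).
have y0 : 0 <= y by rewrite le_max lexx.
have ys : y < sigma by rewrite gt_max s0 ltrBlDr ltrDl divr_gt0.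
have := alive_level_time y0 ys.
have : `|sigma - y| < r.
  rewrite ger0_norm ?subr_ge0 ?(ltW ys)//.
  have : sigma - r / 2 <= y by rewrite le_max lexx orbT.
  lra.
move=> /(hr _ y0); rewrite ltr_norml => /andP[_ h1] h2; lra.
Qed.

Let within_sub t : {within `[0, t], continuous b}.
Proof.
apply: continuous_subspaceW cb => x /=; rewrite !in_itv/= andbT.
by move=> /andP[].
Qed.

(* Before the first visit to 1 a path started below 1 stays below 1. *)
Lemma alive_no_visit t : (forall s, 0 <= s -> s < t -> b s != 1) -> alive b t.
Proof.
move=> h s s0 st; rewrite ltNge; apply/negP => bs.
have [c] := @IVT R b 0 s 1 s0 (@within_sub s) ltac:(by
  rewrite b0 /Num.min /Num.max (lt_le_trans ltr01 bs) ler01 bs).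
rewrite in_itv/= => /andP[c0 cs] bc.
by have := h c c0 (le_lt_trans cs st); rewrite bc eqxx.
Qed.

Definition hits := exists2 t, 0 <= t & b t = 1.

Local Notation tau := (inf [set t | 0 <= t /\ b t = 1]).

Lemma no_hit_level_time : ~ hits -> sigma = K.
Proof.
move=> nh; apply/le_anti; rewrite level_time_le/=; apply/alive_le => //.
by apply: alive_no_visit => s s0 _; apply/eqP => bs; apply: nh; exists s.
Qed.

Lemma hitting_time_ge0 : 0 <= tau.
Proof.
have [[t [t0 bt]]|h] := pselect (exists t, 0 <= t /\ b t = 1).
  by apply: lb_le_inf; [exists t|move=> s []].
rewrite (_ : [set t | _] = set0) ?inf0//.
by rewrite -subset0 => t ht; apply: h; exists t.
Qed.

Lemma hitting_time_value : hits -> b tau = 1.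
Proof.
move=> [t0 t00 bt0]; apply/eqP/negPn/negP => bt.
have hi : has_inf [set t | 0 <= t /\ b t = 1].
  by split; [exists t0|exists 0 => t []].
have e0 : 0 < `|b tau - 1| by rewrite normr_gt0 subr_eq0.
have [r r0 hr] := path_dist cb hitting_time_ge0 e0.
have [t [tt0 bt1]] := inf_adherent r0 hi; rewrite -ltrBlDl => tr.
have tt : tau <= t by apply: ge_inf; [case: hi|].
have : `|tau - t| < r by rewrite distrC ger0_norm ?subr_ge0.
by move/(hr _ tt0); rewrite bt1 ltxx.
Qed.

Lemma hitting_time_gt0 : hits -> 0 < tau.
Proof.
move=> /hitting_time_value bt; rewrite lt_neqAle hitting_time_ge0 andbT.
by apply/eqP => h; move: bt; rewrite -h b0 => /eqP; rewrite eq_sym oner_eq0.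
Qed.

Lemma alive_hitting_time : alive b tau.
Proof.
apply: alive_no_visit => s s0 st; apply/eqP => bs.
have : tau <= s by apply: ge_inf => //; exists 0 => t [].
by rewrite leNgt st.
Qed.

Lemma hit_level_time : hits -> tau <= K -> sigma = tau.
Proof.
move=> h tK; apply/le_anti/andP; split; last first.
  by apply/alive_le; [exact: hitting_time_ge0|exact: tK|exact: alive_hitting_time].
rewrite leNgt; apply/negP => lt; have := alive_level_time hitting_time_ge0 lt.
by rewrite hitting_time_value// ltxx.
Qed.

End level_time.

Lemma alive_value_le b t : {within `[0, +oo[, continuous b} -> b 0 = 0 ->
  0 <= t -> alive b t -> b t <= 1.
Proof.
move=> cb b0 t0 ta; have <- : level_time b t = t.
  apply/le_anti/andP; split; first exact: level_time_le.
  exact/alive_le.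
exact: level_time_value_le.
Qed.

End paths.

Section survival.
Context (R : realType) (T : Type).
Variable B : R -> T -> R.

(* A countable reformulation of "no visit to 1 before time t", up to null sets. *)
Definition survive (t : R) : set T := [set w | forall i, exists r : nat, forall q : rat,
  0 <= ratr q :> R -> ratr q + i.+1%:R^-1 <= t -> B (ratr q) w <= 1 - r.+1%:R^-1].

Lemma survive_le s t : s <= t -> survive t `<=` survive s.
Proof.
move=> st w h i; have [r hr] := h i; exists r => q q0 qs.
by apply: hr => //; exact: le_trans st.
Qed.

(** The margin [1 / i.+1] in time leaves a compact interval, on which an alive path has a maximum
    strictly below 1. Conversely, the margin [1 / r.+1] in level passes from rational to real times
    by continuity. *)
Lemma surviveP t w : {within `[0, +oo[, continuous (B ^~ w)} ->
  survive t w <-> alive (B ^~ w) t.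
Proof.
move=> cb; split=> [h s s0 st|h i].
- have [i hi] : exists i : nat, i.+1%:R^-1 < t - s.
    exists (Num.truncn (t - s)^-1); rewrite invf_plt ?posrE ?subr_gt0//.
    by rewrite truncnS_gt.
  have [r hr] := h i.
  suff : B s w <= 1 - r.+1%:R^-1.
    by move=> /le_lt_trans; apply; rewrite ltrBlDr ltrDl invr_gt0.
  rewrite leNgt; apply/negP => lt.
  have [e e0 he] := path_dist cb s0 (e := B s w - (1 - r.+1%:R^-1)) ltac:(by rewrite subr_gt0).
  have [q] : exists q : rat, ratr q \in `]s, (Num.min (s + e) (t - i.+1%:R^-1))[.
    apply: rat_in_itvoo; rewrite lt_min ltrDl e0/=.
    by rewrite ltrBrDr addrC -ltrBrDr.
  rewrite in_itv/= lt_min => /and3P[sq qe qt].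
  have q0 : 0 <= ratr q :> R by rewrite (le_trans s0)// ltW.
  have := hr q q0; rewrite -lerBrDr (ltW qt) => /(_ isT) hq.
  have : `|s - ratr q| < e by rewrite ltr0_norm ?subr_lt0// opprB ltrBlDl.
  move/(he _ q0) => /=; rewrite ltr_norml => /andP[_].
  by rewrite ltrD2l ltrN2 ltNge hq.
- have [t0|t0] := ltP (t - i.+1%:R^-1) 0.
    exists 0%N => q q0 qt; move: t0; rewrite subr_lt0 ltNge.
    by rewrite (le_trans _ qt)// lerDr.
  have cb' : {within `[0, t - i.+1%:R^-1], continuous (B ^~ w)}.
    by apply: continuous_subspaceW cb => x /=; rewrite !in_itv/= andbT => /andP[].
  have [c] := EVT_max t0 cb'; rewrite in_itv/= => /andP[c0 ct] hc.
  have ip : 0 < i.+1%:R^-1 :> R by rewrite invr_gt0.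
  have bc : B c w < 1 by apply: h => //; rewrite (le_lt_trans ct)// ltrBlDr ltrDl.
  exists (Num.truncn (1 - B c w)^-1) => q q0 qt.
  have hq : ratr q \in `[0, t - i.+1%:R^-1] by rewrite in_itv/= q0/= lerBrDr.
  apply: (le_trans (hc _ hq)).
  rewrite lerBrDr addrC -lerBrDr ltW//.
  by rewrite invf_plt ?posrE ?subr_gt0// truncnS_gt.
Qed.

End survival.

Section survival_measurable.
Context (R : realType) d (T : measurableType d).
Variable B : R -> T -> R.

Lemma past_survive t : measurable_fun setT
  (\1_(survive B t) : history B `[0, t] -> R).
Proof.
pose Ht : measurableType _ := history B `[0, t].
apply: measurable_indic.
pose F (i r : nat) (q : rat) : set Ht := [set w | 0 <= ratr q :> R ->
  ratr q + i.+1%:R^-1 <= t -> B (ratr q) w <= 1 - r.+1%:R^-1].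
rewrite (_ : survive B t = \bigcap_i \bigcup_r \bigcap_q F i r q); last first.
  apply/seteqP; split => w.
    by move=> h i _; have [r hr] := h i; exists r => // q _; exact: hr.
  by move=> h i; have [r _ hr] := h i I; exists r => q; exact: hr.
apply: bigcapT_measurable => i; apply: bigcupT_measurable => r.
rewrite -[X in measurable X]setCK setC_bigcap; apply: measurableC.
apply: bigcupT_measurable_rat => q; apply: measurableC.
have [q0|q0] := leP 0 (ratr q : R); last first.
  rewrite (_ : F i r q = setT)//; apply/seteqP; split => // w _.
  by move=> h; move: q0; rewrite ltNge h.
have [qt|qt] := leP (ratr q + i.+1%:R^-1) t; last first.
  rewrite (_ : F i r q = setT)//; apply/seteqP; split => // w _.
  by move=> _ h; move: qt; rewrite ltNge h.
rewrite (_ : F i r q = setT `&` (B (ratr q) : Ht -> R) @^-1` `]-oo, 1 - r.+1%:R^-1]); last first.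
  apply/seteqP; split => w; rewrite /= in_itv/=; first by move=> h; split => //; exact: h.
  by move=> [_ h] _ _.
apply: history_eval => //; rewrite /= in_itv/= q0/=.
by apply: le_trans qt; rewrite lerDl.
Qed.

End survival_measurable.

(** * Approximation of the level time along a grid *)

Section grid_time.
Context (R : realType) (T : Type).
Variables (B : R -> T -> R) (K : R).
Hypothesis K0 : 0 < K.

Definition mesh (n : nat) : R := K / n.+1%:R.

(** On a continuous path from 0, the first grid index lying strictly after the level time, capped at
    [n.+1], whose grid time is the horizon [K]. *)
Definition grid_index n w := stop (fun k => survive B (k%:R * mesh n)) n.+1 w.

Lemma mesh_gt0 n : 0 < mesh n. Proof. by rewrite divr_gt0. Qed.

Lemma survive_dec n k : survive B (k.+1%:R * mesh n) `<=` survive B (k%:R * mesh n).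
Proof. by apply: survive_le; apply: ler_wpM2r; [exact: ltW (mesh_gt0 n)|rewrite ler_nat]. Qed.

Lemma cvg_mesh : mesh @ \oo --> 0.
Proof.
rewrite -[X in _ --> X](mulr0 K); apply: cvgM; first exact: cvg_cst.
exact: cvg_harmonic.
Qed.

Variable w : T.
Hypothesis cb : {within `[0, +oo[, continuous (B ^~ w)}.
Hypothesis b0 : B 0 w = 0.
Local Notation sigma := (level_time (B ^~ w) K).

Lemma grid_index_close n :
  sigma <= (grid_index n w)%:R * mesh n <= sigma + mesh n.
Proof.
have m0 := mesh_gt0 n.
have mK : n.+1%:R * mesh n = K by rewrite mulrCA mulfV ?mulr1.
have kK k : (k <= n.+1)%N -> k%:R * mesh n <= K.
  by move=> kn; rewrite -mK; apply: ler_wpM2r; [exact: ltW|rewrite ler_nat].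
have k0 (k : nat) : 0 <= k%:R * mesh n by rewrite mulr_ge0// ltW.
have aE k : (k <= n.+1)%N -> survive B (k%:R * mesh n) w <-> k%:R * mesh n <= sigma.
  move=> kn; rewrite surviveP//; apply: alive_le => //; [exact: ltW|exact: kK].
apply/andP; split.
  have := stop_le (fun k => survive B (k%:R * mesh n)) n.+1 w.
  rewrite leq_eqVlt => /orP[/eqP|].
    by rewrite -/(grid_index n w) => ->; rewrite mK; apply: level_time_le => //; exact: ltW.
  move=> lt; rewrite leNgt; apply/negP => h.
  have /(stop_lt (@survive_dec n) lt) : survive B ((grid_index n w)%:R * mesh n) w.
    by apply/aE; [exact: ltnW|exact: ltW].
  by rewrite ltnn.
(* When the index is positive its predecessor still survives, so it lies at or before the level
   time. *)
have := leqnn (grid_index n w); case: {1 3}(grid_index n w) => [_|k hk].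
  rewrite mul0r; apply: addr_ge0; last exact: ltW.
  exact: level_time_ge0 (ltW K0).
rewrite -natr1 mulrDl mul1r lerD2r.
apply/aE; first by rewrite ltnW// (leq_trans hk)// stop_le.
by apply: (lt_stop (@survive_dec n)) hk.
Qed.

Lemma cvg_grid_time : (fun n => (grid_index n w)%:R * mesh n) @ \oo --> sigma.
Proof.
apply: (squeeze_cvgr (f := fun=> sigma) (h := fun n => sigma + mesh n)).
- by apply: nearW => n; exact: grid_index_close.
- exact: cvg_cst.
- by rewrite -[X in _ --> X]addr0; apply: cvgD; [exact: cvg_cst|exact: cvg_mesh].
Qed.

Lemma cvg_grid_sample (u : R) : 0 <= u < 1 ->
  (fun n => (Num.truncn (u * (grid_index n w)%:R))%:R * mesh n) @ \oo --> u * sigma.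
Proof.
move=> /andP[u0 u1].
have c : (fun n => u * ((grid_index n w)%:R * mesh n)) @ \oo --> u * sigma.
  by apply: cvgM; [exact: cvg_cst|exact: cvg_grid_time].
apply: (squeeze_cvgr (f := fun n => u * ((grid_index n w)%:R * mesh n) - mesh n)
  (h := fun n => u * ((grid_index n w)%:R * mesh n))) => //.
- apply: nearW => n.
  have un0 : 0 <= u * (grid_index n w)%:R by rewrite mulr_ge0.
  have /andP[h1 h2] := truncn_itv un0.
  have m0 := mesh_gt0 n; apply/andP; split.
    rewrite lerBlDr mulrA -{3}(mul1r (mesh n)) -mulrDl; apply: ler_wpM2r; first exact: ltW.
    by rewrite natr1 ltW.
  by rewrite mulrA; apply: ler_wpM2r => //; exact: ltW.
- rewrite -[X in _ --> X]subr0; apply: cvgB => //; exact: cvg_mesh.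
Qed.

End grid_time.

(** Squeezed between [L] and [L * expR (L * u n)]; both bounds come from [1 + x <= expR x]. *)
Lemma cvg_expR_slope (R : realType) (L : R) (u : nat -> R) : 0 < L ->
  (forall n, 0 < u n) -> u @ \oo --> 0 ->
  (fun n => (expR (L * u n) - 1) / u n) @ \oo --> L.
Proof.
move=> L0 u0 cu.
apply: (squeeze_cvgr (f := fun=> L) (h := fun n => L * expR (L * u n))).
- apply: nearW => n; rewrite ler_pdivlMr// ler_pdivrMr//; apply/andP; split.
    by rewrite lerBrDl; exact: expR_ge1Dx.
  have := expR_ge1Dx (- (L * u n)); rewrite expRN => h.
  have e0 := expR_gt0 (L * u n).
  have : (1 - L * u n) * expR (L * u n) <= 1.
    by rewrite -ler_pdivlMr// div1r.
  by set E := expR _; move=> h2; lra.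
- exact: cvg_cst.
- rewrite -[X in _ --> X]mulr1; apply: cvgM; first exact: cvg_cst.
  rewrite -expR0; apply: continuous_cvg; first exact: continuous_expR.
  by rewrite -(mulr0 L); apply: cvgM => //; exact: cvg_cst.
Qed.

(** * From the grid to the level time with a fixed horizon *)

Section level_time_identities.
Local Open Scope ereal_scope.
Context d (T : measurableType d) (R : realType) (P : probability T R).
Variables (B : R -> T -> R) (U : T -> R).
Hypothesis hB : standard_brownian P B.
Hypothesis hU : uniform01 P U.
Hypothesis hUB : independent_of_process P U B.

Definition good_path w := {within `[0%R, +oo[, continuous (B ^~ w)} /\ B 0%R w = 0%R.

Lemma ae_good_path : {ae P, forall w, good_path w}.
Proof. by case: hB => -[_ h1] h2 _ _; apply: filterS2 h1 h2. Qed.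

Let mB t : (0 <= t)%R -> measurable_fun setT (B t).
Proof. exact: (brownian_measurable hB). Qed.

Variable K : R.
Hypothesis K0 : (0 < K)%R.
Let N n w : nat := grid_index B K n w.
Let idx n w : nat := sample_index U (N n w) w.
Let delta n := mesh K n.
Let A n k := survive B (k%:R * delta n).
Let tau n w := ((N n w)%:R * delta n)%R.
Let bt n w := B (tau n w) w.
Let bs n w := B ((idx n w)%:R * delta n)%R w.
Let sigma w := level_time (B ^~ w) K.

Let delta0 n : (0 < delta n)%R. Proof. exact: mesh_gt0. Qed.
Let tk0 n k : (0 <= k%:R * delta n)%R. Proof. by rewrite mulr_ge0// ltW. Qed.
Let A_dec n k : A n k.+1 `<=` A n k. Proof. exact: survive_dec. Qed.
Let mA n k : measurable_fun setT (\1_(A n k) : history B `[0%R, (k%:R * delta n)%R] -> R).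
Proof. exact: past_survive. Qed.
Let mAT n k : measurable_fun setT (\1_(A n k) : T -> R).
Proof. exact: (past_measurable hB (@mA n k)). Qed.
Let mAF n k : measurable_fun setT (\1_(A n k) : history B `[0%R, +oo[ -> R).
Proof.
apply: history_sub (@mA n k) => t; rewrite /= !in_itv/= andbT.
by move=> /andP[].
Qed.

Let mtau n : measurable_fun setT (tau n).
Proof. exact: (@measurable_stopped _ _ _ (A n) (fun k _ => k%:R * delta n)%R). Qed.

Let mbt n : measurable_fun setT (bt n).
Proof.
apply: (@measurable_stopped _ _ _ (A n) (fun k => B (k%:R * delta n)%R)) => // k.
exact: mB.
Qed.

Let tau_le n w : (tau n w <= K)%R.
Proof.
have := stop_le (A n) n.+1 w; rewrite -(ler_nat R) => h.
have -> : K = (n.+1%:R * delta n)%R by rewrite /delta /mesh mulrCA mulfV ?mulr1.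
by apply: ler_wpM2r => //; exact: ltW.
Qed.

Let tau_ge0 n w : (0 <= tau n w)%R. Proof. exact: tk0. Qed.

(** The value at a random index is a finite sum over the possible indices [j], each on the event
    that [U * N n] lies in the unit interval starting at [j]. *)
Let abs_bs n : ae_measurable P (bs n).
Proof.
exists (fun w => \sum_(j < n.+1) \1_`[j%:R, j.+1%:R[ (U w * (N n w)%:R) * B (j%:R * delta n) w)%R.
  apply: measurable_sum => j; apply: measurable_funM; last exact: mB.
  apply: measurableT_comp; first exact: measurable_indic.
  apply: measurable_funM; first by case: hU.
  exact: (@measurable_stopped _ _ _ (A n) (fun k _ => k%:R)%R).
apply: filterS (ae_uniform01 hU) => w Uw.
have UN0 : (0 <= U w * (N n w)%:R)%R by case/andP: Uw => U0 _; rewrite mulr_ge0.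
have iE (j : nat) : (idx n w == j) = (U w * (N n w)%:R \in `[(j%:R : R), j.+1%:R[)%R.
  by rewrite in_itv/= truncn_eq.
have il : (idx n w < n.+1)%N.
  have [N00|N0] := posnP (N n w).
    by have := iE 0%N; rewrite N00 mulr0 in_itv/= lexx ltr01 => /eqP ->.
  by rewrite (leq_trans (sample_index_lt Uw N0))// stop_le.
rewrite (bigD1 (Ordinal il))//= indicE mem_set ?mul1r; last by have := iE (idx n w); rewrite eqxx => /esym.
rewrite big1 ?addr0// => j ji; rewrite indicE memNset ?mul0r//=.
move=> h; have := iE j; rewrite h => /eqP jE.
by move/eqP: ji; apply; apply/val_inj.
Qed.

Let cvg_tau : {ae P, forall w, tau ^~ w @ \oo --> sigma w}.
Proof. by apply: filterS ae_good_path => w [cb b0]; exact: cvg_grid_time. Qed.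

Let cvg_bt : {ae P, forall w, bt ^~ w @ \oo --> B (sigma w) w}.
Proof.
apply: filterS ae_good_path => w [cb b0].
apply: (path_cvg cb) => //; last exact: cvg_grid_time.
exact: level_time_ge0 (ltW K0).
Qed.

Let cvg_bs : {ae P, forall w, bs ^~ w @ \oo --> B (U w * sigma w)%R w}.
Proof.
apply: filterS2 ae_good_path (ae_uniform01 hU) => w [cb b0] Uw.
apply: (path_cvg cb) => //; last exact: cvg_grid_sample.
by case/andP: Uw => U0 _; rewrite mulr_ge0// level_time_ge0// ltW.
Qed.

Lemma ae_measurable_level_time : ae_measurable P sigma.
Proof.
by apply: cvg_ae_measurable cvg_tau => n; exact: measurable_ae_measurable.
Qed.

Lemma ae_measurable_level_value : ae_measurable P (fun w => B (sigma w) w).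
Proof.
by apply: cvg_ae_measurable cvg_bt => n; exact: measurable_ae_measurable.
Qed.

Lemma ae_measurable_level_sample : ae_measurable P (fun w => B (U w * sigma w)%R w).
Proof. exact: cvg_ae_measurable cvg_bs. Qed.

(** Squaring [exp (p B)] doubles its parameter, and [stopped_expR_le] bounds the result at the
    horizon [K], uniformly in the mesh. *)
Let bt_l2 n (p C : R) (f : T -> R) : (0 <= C)%R -> {ae P, forall w, (0 <= f w <= C * expR (p * bt n w))%R} ->
  \int[P]_w (f w ^+ 2)%:E <= (C ^+ 2 * expR ((2 * p) ^+ 2 / 2 * K))%:E.
Proof.
move=> C0 fC.
have mE : measurable_fun setT (fun w => (expR (2 * p * bt n w))%:E).
  apply/measurable_EFinP; apply: measurableT_comp => //.
  by apply: measurable_funM => //; exact: mbt.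
apply: (@le_trans _ _ (\int[P]_w ((C ^+ 2)%:E * (expR (2 * p * bt n w))%:E))).
  apply: ge0_ae_le_integral_any.
  - by move=> w; rewrite lee_fin sqr_ge0.
  - by move=> w; rewrite -EFinM lee_fin mulr_ge0 ?sqr_ge0 ?expR_ge0.
  - apply: filterS fC => w /andP[f0 fC].
    rewrite -EFinM lee_fin (_ : C ^+ 2 * _ = (C * expR (p * bt n w)) ^+ 2)%R; last first.
      by rewrite exprMn -expRM_natl; congr (_ * expR _)%R; ring.
    by rewrite ler_sqr ?nnegrE// mulr_ge0 ?expR_ge0.
rewrite ge0_integralZl//; last by rewrite lee_fin sqr_ge0.
rewrite [leRHS]EFinM; apply: lee_wpmul2l; first by rewrite lee_fin sqr_ge0.
have := stopped_expR_le hB (delta0 n) (@A_dec n) (@mA n) (2 * p) n.+1.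
by rewrite (_ : n.+1%:R * delta n = K)%R// /delta /mesh mulrCA mulfV ?mulr1.
Qed.

Lemma level_time_exponential p :
  \int[P]_w (expR (p * B (sigma w) w - p ^+ 2 / 2 * sigma w))%:E = 1.
Proof.
have [||||_] := @l2_bounded_convergence _ T R P
  (fun n w => expR (p * bt n w - p ^+ 2 / 2 * tau n w))
  (fun w => expR (p * B (sigma w) w - p ^+ 2 / 2 * sigma w))
  (1 ^+ 2 * expR ((2 * p) ^+ 2 / 2 * K)).
- move=> n; apply: measurable_ae_measurable; apply: measurableT_comp => //.
  by apply: measurable_funB; exact: measurable_funM.
- by move=> n; apply: aeW => w; exact: expR_ge0.
- move=> n; apply: (@bt_l2 n) => //; apply: aeW => w; rewrite expR_ge0 mul1r/= ler_expR.
  by rewrite gerBl mulr_ge0// divr_ge0 ?sqr_ge0.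
- apply: filterS2 cvg_tau cvg_bt => w ct cb.
  apply: continuous_cvg; first exact: continuous_expR.
  by apply: cvgB; apply: cvgM => //; exact: cvg_cst.
rewrite (_ : (fun n : nat => _) = cst 1); last first.
  apply/funext => n; rewrite [RHS]/cst.
  exact: (stopped_exponential hB (delta0 n) (@A_dec n) (@mA n) p n.+1).
by move=> /cvg_unique; apply => //; exact: cvg_cst.
Qed.

(** Limit of [stopped_occupation] divided by the mesh: [rho - 1] over the mesh tends to
    [h ^+ 2 / 2 + theta * h], and the Riemann sum, rewritten as the stopped time times a sampled
    term, gives the value at [U w * sigma w]. *)
Lemma level_time_occupation theta h : (0 < theta)%R -> (0 < h)%R ->
  exists a b : R,
  [/\ \int[P]_w (expR (theta * B (sigma w) w - theta ^+ 2 / 2 * sigma w) *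
        (sigma w * expR (h * (B (U w * sigma w) w - 1))))%:E = a%:E,
      \int[P]_w (expR ((theta + h) * B (sigma w) w - theta ^+ 2 / 2 * sigma w))%:E = b%:E &
      ((h ^+ 2 / 2 + theta * h) * a = expR (- h) * (b - 1))%R].
Proof.
move=> theta0 h0.
pose q := (theta ^+ 2 / 2)%R.
have q0 : (0 <= q)%R by rewrite divr_ge0 ?sqr_ge0.
pose f_ n w := (expR (theta * bt n w - q * tau n w) *
  (tau n w * expR (h * (bs n w - 1))))%R.
pose g_ n w := expR ((theta + h) * bt n w - q * tau n w).
have f0 n w : (0 <= f_ n w)%R
  by apply: mulr_ge0; [exact: expR_ge0|apply: mulr_ge0; [exact: tau_ge0|exact: expR_ge0]].
have bs1 n : {ae P, forall w, (bs n w <= 1)%R}.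
  (* A sampled grid time strictly precedes a positive stopped one, hence the path is still alive
     there and the sampled exponential is at most 1. *)
  apply: filterS2 ae_good_path (ae_uniform01 hU) => w [cb b0] Uw.
  have [N00|N0] := posnP (N n w).
    have -> : bs n w = 0%R.
      rewrite /bs (_ : idx n w = 0%N) ?mul0r//.
      by apply/eqP; rewrite /idx /sample_index N00 mulr0 truncn0.
    exact: ler01.
  have lt := sample_index_lt Uw N0.
  have /(@surviveP _ _ B _ w cb) al := lt_stop (@A_dec n) lt.
  exact: (alive_value_le cb).
have [||||fin cvgf] := @l2_bounded_convergence _ T R P f_
  (fun w => expR (theta * B (sigma w) w - theta ^+ 2 / 2 * sigma w) *
        (sigma w * expR (h * (B (U w * sigma w) w - 1))))%R
  (K ^+ 2 * expR ((2 * theta) ^+ 2 / 2 * K)).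
- move=> n; apply: ae_measurableM.
    apply: measurable_ae_measurable; apply: measurableT_comp => //.
    by apply: measurable_funB; exact: measurable_funM.
  apply: ae_measurableM; first exact: measurable_ae_measurable.
  apply: (ae_measurable_comp (phi := fun x => expR (h * (x - 1)))) => //.
  apply: measurableT_comp => //; apply: measurable_funM => //.
  exact: measurable_funB.
- by move=> n; apply: aeW => w.
- move=> n; apply: (@bt_l2 n); first exact: ltW.
  apply: filterS (bs1 n) => w bs1w; rewrite f0/= /f_ mulrC.
  have t0 : (0 <= tau n w * expR (h * (bs n w - 1)))%R.
    by apply: mulr_ge0; [exact: tau_ge0|exact: expR_ge0].
  apply: ler_pM => //; last by rewrite ler_expR gerBl mulr_ge0.
  rewrite -[leRHS]mulr1; apply: ler_pM => //.
  by rewrite -[leRHS]expR0 ler_expR pmulr_rle0// subr_le0.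
- apply: filterS3 cvg_tau cvg_bt cvg_bs => w ct cb cs.
  apply: cvgM; last apply: cvgM => //.
    apply: continuous_cvg; first exact: continuous_expR.
    by apply: cvgB; apply: cvgM => //; exact: cvg_cst.
  apply: continuous_cvg; first exact: continuous_expR.
  by apply: cvgM; [exact: cvg_cst|apply: cvgB => //; exact: cvg_cst].
have [||||fin' cvgg] := @l2_bounded_convergence _ T R P g_
  (fun w => expR ((theta + h) * B (sigma w) w - theta ^+ 2 / 2 * sigma w))
  (1 ^+ 2 * expR ((2 * (theta + h)) ^+ 2 / 2 * K)).
- move=> n; apply: measurable_ae_measurable; apply: measurableT_comp => //.
  by apply: measurable_funB; exact: measurable_funM.
- by move=> n; apply: aeW => w; exact: expR_ge0.
- move=> n; apply: (@bt_l2 n) => //; apply: aeW => w; rewrite expR_ge0 mul1r/= ler_expR.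
  by rewrite gerBl mulr_ge0.
- apply: filterS2 cvg_tau cvg_bt => w ct cb.
  apply: continuous_cvg; first exact: continuous_expR.
  by apply: cvgB; apply: cvgM => //; exact: cvg_cst.
set If := \int[P]_w _ in fin cvgf *; set Ig := \int[P]_w _ in fin' cvgg *.
exists (fine If), (fine Ig); rewrite !fineK//; split => //.
have /choice[ab hab] n : exists ab : R * R,
   [/\ \int[P]_w (f_ n w)%:E = ab.1%:E, \int[P]_w (g_ n w)%:E = ab.2%:E &
     ((expR ((h ^+ 2 / 2 + theta * h) * delta n) - 1) * ab.1 =
       delta n * expR (- h) * (ab.2 - 1))%R].
  have [a [b [ha hb e]]] := stopped_occupation hB (delta0 n) (@A_dec n) (@mA n) n.+1 h0 theta0.
  exists (a, b); split => //=.
  rewrite -ha.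
  (* The factor [delta n] is put inside [c], so that the stopped index times the sampled term is
     [f_ n], while the sum over all indices is the martingale times [occupation]. *)
  pose c (l j : nat) w := (delta n * (expmart B (delta n) theta q l w *
     expR (h * (B (j%:R * delta n) w - 1))))%R.
  transitivity (\int[P]_w ((N n w)%:R * c (N n w) (idx n w) w)%:E).
    by apply: eq_integral => w _; congr EFin; rewrite /f_ /c /tau /expmart /bt /bs /tau; ring.
  rewrite (uniform_sampling mB hU hUB (m := n.+1)).
  - apply: eq_integral => w _; congr EFin.
    rewrite /c /occupation mulr_sumr; apply: eq_bigr => j _.
    by rewrite mulrCA.
  - by move=> w; exact: stop_le.
  - move=> l; rewrite (_ : \1__ = (fun w => (N n w == l)%:R)%R).
      exact: (@measurable_stopped _ (history B `[0%R, +oo[) R (A n) (fun k _ => (k == l)%:R)%R).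
    by apply/funext => w; rewrite indicE; congr (nat_of_bool _)%:R; apply/idP/eqP; rewrite inE.
  - have hS k : measurable_fun setT (B (k%:R * delta n)%R : history B `[0%R, +oo[ -> R).
      by apply: history_eval; rewrite /= in_itv/= andbT.
    move=> l j _; apply: measurable_funM => //; apply: measurable_funM.
      apply: measurableT_comp => //; apply: measurable_funB => //.
      exact: measurable_funM.
    apply: measurableT_comp => //; apply: measurable_funM => //.
    exact: measurable_funB.
  - by move=> l j w; rewrite !mulr_ge0 ?expR_ge0// ltW.
have ca : (fun n => (ab n).1) @ \oo --> fine If.
  apply: (fine_cvg (f := fun n => ((ab n).1)%:E)); rewrite fineK//.
  rewrite (_ : (fun n => _) = (fun n => \int[P]_w (f_ n w)%:E))//.
  by apply/funext => n; have [-> _ _] := hab n.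
have cb : (fun n => (ab n).2) @ \oo --> fine Ig.
  apply: (fine_cvg (f := fun n => ((ab n).2)%:E)); rewrite fineK//.
  rewrite (_ : (fun n => _) = (fun n => \int[P]_w (g_ n w)%:E))//.
  by apply/funext => n; have [_ -> _] := hab n.
have c1 : (fun n => (expR ((h ^+ 2 / 2 + theta * h) * delta n) - 1) / delta n * (ab n).1)%R @ \oo
    --> ((h ^+ 2 / 2 + theta * h) * fine If)%R.
  apply: cvgM => //; apply: cvg_expR_slope => //.
    by rewrite addr_gt0 ?mulr_gt0 ?divr_gt0 ?exprn_gt0.
  exact: cvg_mesh.
have c2 : (fun n => expR (- h) * ((ab n).2 - 1))%R @ \oo --> (expR (- h) * (fine Ig - 1))%R.
  by apply: cvgM; [exact: cvg_cst|apply: cvgB => //; exact: cvg_cst].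
apply: (cvg_unique _ c1) => //.
rewrite (_ : (fun n => _) = (fun n => expR (- h) * ((ab n).2 - 1))%R)//.
apply/funext => n; have [_ _ e] := hab n.
by rewrite mulrAC e; field; rewrite gt_eqF.
Qed.

End level_time_identities.

Lemma expRN_le_invr (R : realType) (x : R) : 0 < x -> expR (- x) <= x^-1.
Proof.
move=> x0; rewrite expRN lef_pV2 ?posrE ?expR_gt0//.
by apply: le_trans (expR_ge1Dx x); rewrite lerDr.
Qed.

(** * From finite horizons to the hitting time *)

Section hitting_time_identities.
Local Open Scope ereal_scope.
Context d (T : measurableType d) (R : realType) (P : probability T R).
Variables (B : R -> T -> R) (U : T -> R).
Hypothesis hB : standard_brownian P B.
Hypothesis hU : uniform01 P U.
Hypothesis hUB : independent_of_process P U B.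

Let K (n : nat) : R := n.+1%:R.
Let K0 n : (0 < K n)%R. Proof. by rewrite ltr0n. Qed.
Let sigma n w := level_time (B ^~ w) (K n).
Local Notation tau := (hitting_time1 B).
Local Notation good := (good_path B).

Let sigma_ge0 n w : good w -> (0 <= sigma n w)%R.
Proof. by move=> [cb b0]; apply: level_time_ge0 => //; exact: ltW. Qed.

Let value_le1 n w : good w -> (B (sigma n w) w <= 1)%R.
Proof. by move=> [cb b0]; apply: (level_time_value_le cb b0); exact: ltW. Qed.

Let sigma_eventually w : good w -> hits (B ^~ w) ->
  \forall n \near \oo, sigma n w = tau w.
Proof.
move=> [cb b0] h; near=> n; apply: hit_level_time => //.
have : (Num.truncn (tau w) <= n)%N by near: n; exact: nbhs_infty_ge.
move=> hn; apply: (le_trans (ltW (truncnS_gt _))).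
by rewrite /K ler_nat ltnS.
Unshelve. all: by end_near. Qed.

(** On a path that never hits 1, [tau] is the infimum of the empty set, that is 0, and the
    exponential would be 1; the limit for growing horizons is 0 there. *)
Let g theta w : R := if `[< hits (B ^~ w) >] then expR (- (theta ^+ 2 / 2 * tau w)) else 0%R.

(** Without a hit, [sigma n] is the horizon and [B <= 1], so the stopped exponential is at most
    [exp (- q K)]; with a hit, it is eventually constant with [B = 1]. Normalising by
    [expR (- theta)] bounds it by 1. *)
Let g_spec theta : (0 < theta)%R ->
  ae_measurable P (g theta) /\ \int[P]_w (g theta w)%:E = (expR (- theta))%:E.
Proof.
move=> t0; pose q := (theta ^+ 2 / 2)%R.
have q0 : (0 < q)%R by rewrite divr_gt0 ?exprn_gt0.
pose f n w := expR (theta * (B (sigma n w) w - 1) - q * sigma n w).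
have cf : {ae P, forall w, f ^~ w @ \oo --> g theta w}.
  apply: filterS (ae_good_path hB) => w gw; rewrite /g.
  case: asboolP => h.
    apply: cvg_near_cst; move: (sigma_eventually gw h); apply: filterS => n e.
    rewrite /f e (hitting_time_value gw.1 h) subrr mulr0 sub0r //.
  apply: (squeeze_cvgr (f := fun=> 0%R) (h := fun n => (q^-1 * n.+1%:R^-1)%R)).
  - apply: nearW => n.
    have sK : sigma n w = K n := no_hit_level_time gw.1 gw.2 (ltW (K0 n)) h.
    have := value_le1 n gw; rewrite /f sK expR_ge0/= => B1.
    apply: (@le_trans _ _ (expR (- (q * n.+1%:R)))).
      by rewrite ler_expR gerDr pmulr_rle0// subr_le0.
    by rewrite -invfM; apply: expRN_le_invr; rewrite mulr_gt0.
  - exact: cvg_cst.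
  - rewrite -[X in _ --> X](mulr0 (q^-1)%R); apply: cvgM; first exact: cvg_cst.
    exact: cvg_harmonic.
have mf n : ae_measurable P (f n).
  apply: (ae_measurable_comp (phi := expR)) => //.
  apply: ae_measurableD.
    apply: (ae_measurable_comp (phi := fun x => theta * (x - 1))%R).
      by apply: measurable_funM => //; exact: measurable_funB.
    exact: ae_measurable_level_value.
  apply: (ae_measurable_comp (phi := fun x => - (q * x))%R).
    by apply: measurableT_comp => //; exact: measurable_funM.
  exact: ae_measurable_level_time.
split; first exact: cvg_ae_measurable cf.
have [|_] := ae_bounded_convergence (C := 1%R) mf _ cf.
  move=> n; apply: filterS (ae_good_path hB) => w gw.
  rewrite ger0_norm ?expR_ge0// -[leRHS]expR0 ler_expR.
  rewrite subr_le0.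
  apply: (@le_trans _ _ 0%R); first by rewrite pmulr_rle0// subr_le0 value_le1.
  by rewrite mulr_ge0 ?sigma_ge0// ltW.
rewrite (_ : (fun n : nat => _) = cst (expR (- theta))%:E); last first.
  apply/funext => n; rewrite [RHS]/cst -[RHS]mule1 -(level_time_exponential hB (K0 n) theta).
  have [e me he] : ae_measurable P (fun w => expR (theta * B (sigma n w) w - q * sigma n w)).
    apply: (ae_measurable_comp (phi := expR)) => //.
    apply: ae_measurableD.
      apply: (ae_measurable_comp (phi := fun x => theta * x)%R) => //.
        exact: measurable_funM.
      exact: ae_measurable_level_value.
    apply: (ae_measurable_comp (phi := fun x => - (q * x))%R).
      by apply: measurableT_comp => //; exact: measurable_funM.
    exact: ae_measurable_level_time.
  rewrite (@integral_ae_eq_any _ _ _ _ _ (fun w => (expR (- theta))%:E * (`|e w|)%:E)); last first.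
    apply: filterS he => w <-; rewrite ger0_norm ?expR_ge0// -EFinM -expRD; congr (expR _)%:E.
    by rewrite /f; ring.
  rewrite ge0_integralZl//; last first.
    by apply/measurable_EFinP; exact: measurableT_comp.
  congr (_ * _); apply: integral_ae_eq_any; apply: filterS he => w <-.
  by rewrite ger0_norm ?expR_ge0.
by move=> /cvg_unique; apply => //; exact: cvg_cst.
Qed.

(** As [theta] tends to 0, [g theta] tends to the indicator of hitting while its expectation
    [exp (- theta)] tends to 1. *)
Lemma ae_hits : {ae P, forall w, hits (B ^~ w)}.
Proof.
pose I w : R := if `[< hits (B ^~ w) >] then 1%R else 0%R.
pose f n := g (n.+1%:R^-1).
have n0 (n : nat) : (0 < n.+1%:R^-1 :> R)%R by rewrite invr_gt0.
have mf n : ae_measurable P (f n) := (g_spec (n0 n)).1.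
have cf : {ae P, forall w, f ^~ w @ \oo --> I w}.
  apply: aeW => w; rewrite /f /g /I; case: asboolP => h; last exact: cvg_cst.
  rewrite -[X in _ --> X]expR0; apply: continuous_cvg; first exact: continuous_expR.
  rewrite -[X in _ --> X]oppr0; apply: cvgN.
  rewrite -[X in _ --> X](mul0r (tau w)); apply: cvgMl.
  rewrite -[X in _ --> X](mul0r (2^-1)%R); apply: cvgMl.
  rewrite -[X in _ --> X](mulr0 0%R); under eq_fun do rewrite expr2.
  by apply: cvgM; exact: cvg_harmonic.
have [J mJ IJ] := cvg_ae_measurable mf cf.
have [|_] := ae_bounded_convergence (C := 1%R) mf _ cf.
  move=> n; apply: aeW => w; rewrite /f /g; case: asboolP => _; last by rewrite normr0.
  rewrite ger0_norm ?expR_ge0// -[leRHS]expR0 ler_expR oppr_le0 mulr_ge0//.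
  exact: hitting_time_ge0.
rewrite (_ : (fun n : nat => _) = (fun n => (expR (- n.+1%:R^-1))%:E)); last first.
  by apply/funext => n; rewrite (g_spec (n0 n)).2.
move=> c1.
have c2 : (fun n => (expR (- n.+1%:R^-1))%:E : \bar R) @ \oo --> 1.
  apply: cvg_EFin; first exact: nearW.
  rewrite -[X in _ --> X]expR0; apply: continuous_cvg; first exact: continuous_expR.
  by rewrite -[X in _ --> X]oppr0; apply: cvgN; exact: cvg_harmonic.
have I1 : \int[P]_w (I w)%:E = 1 by apply: cvg_unique c1 c2.
have mJ1 : measurable (J @^-1` [set 1%R]).
  by rewrite -[X in measurable X]setTI; exact: mJ.
have PJ : P (J @^-1` [set 1%R]) = 1.
  rewrite -I1 -[X in P X]setIT -integral_indic//; apply: integral_ae_eq_any.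
  apply: filterS IJ => w; rewrite indicE /I; case: asboolP => _ e.
    by rewrite mem_set//=; exact/esym.
  by rewrite memNset//= -e => /esym /eqP; rewrite oner_eq0.
have : {ae P, forall w, J w = 1%R}.
  exists (~` (J @^-1` [set 1%R])); split => //; first exact: measurableC.
  by rewrite probability_setC// PJ subee.
apply: filterS2 IJ => w; rewrite /I; case: asboolP => // _ <- /eqP.
by rewrite eq_sym oner_eq0.
Qed.

(** The sequence is eventually constant, because the horizon eventually exceeds the hitting time. *)
Lemma ae_hitting_limit (F : T -> R -> R) :
  {ae P, forall w, (fun n => F w (sigma n w)) @ \oo --> F w (tau w)}.
Proof.
apply: filterS2 (ae_good_path hB) ae_hits => w gw h.
by apply: cvg_near_cst; move: (sigma_eventually gw h); apply: filterS => n ->.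
Qed.

Lemma ae_measurable_hitting_time : ae_measurable P tau.
Proof.
apply: (cvg_ae_measurable (f_ := sigma)); last exact: (ae_hitting_limit (fun _ => id)).
by move=> n; exact: ae_measurable_level_time.
Qed.

Lemma ae_measurable_hitting_sample : ae_measurable P (fun w => B (U w * tau w) w).
Proof.
apply: (cvg_ae_measurable (f_ := fun n w => B (U w * sigma n w) w)).
  by move=> n; exact: ae_measurable_level_sample.
exact: (ae_hitting_limit (fun w s => B (U w * s) w)).
Qed.

Lemma hitting_time_laplace theta : (0 < theta)%R ->
  \int[P]_w (expR (- (theta ^+ 2 / 2 * tau w)))%:E = (expR (- theta))%:E.
Proof.
move=> /g_spec[_ <-]; apply: integral_ae_eq_any; apply: filterS ae_hits => w h.
by rewrite /g asboolT.
Qed.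

Lemma hitting_time_gt0_ae : {ae P, forall w, 0 < tau w}%R.
Proof.
apply: filterS2 (ae_good_path hB) ae_hits => w [cb b0] h.
exact: hitting_time_gt0.
Qed.

Lemma hitting_sample_le1 : {ae P, forall w, B (U w * tau w) w <= 1}%R.
Proof.
apply: filterS3 (ae_good_path hB) ae_hits (ae_uniform01 hU) => w [cb b0] h /andP[U0 U1].
have t0 := hitting_time_ge0 (B ^~ w).
apply: (alive_value_le cb b0); first exact: mulr_ge0.
move=> s s0 sU; apply: (alive_hitting_time cb b0) => //.
by apply: lt_le_trans sU _; rewrite -[leRHS]mul1r ler_wpM2r// ltW.
Qed.

(** The horizon grows in [level_time_occupation]. Since [B = 1] at the hitting time, the expectation
    on its right becomes [exp (theta + h) exp (- theta) = exp h] by the Laplace transform, and a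
    factor [exp theta] comes out on its left. *)
Lemma hitting_time_occupation theta h : (0 < theta)%R -> (0 < h)%R ->
  ((h ^+ 2 / 2 + theta * h)%:E *
   \int[P]_w (expR (- (theta ^+ 2 / 2 * tau w)) *
     (tau w * expR (h * (B (U w * tau w) w - 1))))%:E =
   (expR (- theta) * (1 - expR (- h)))%:E)%E.
Proof.
move=> t0 h0; pose q := (theta ^+ 2 / 2)%R.
have q0 : (0 < q)%R by rewrite divr_gt0 ?exprn_gt0.
pose F w s := (expR (theta * B s w - q * s) * (s * expR (h * (B (U w * s) w - 1))))%R.
pose G w s := expR ((theta + h) * B s w - q * s).
have /choice[ab hab] n : exists ab : R * R,
    [/\ \int[P]_w (F w (sigma n w))%:E = ab.1%:E,
        \int[P]_w (G w (sigma n w))%:E = ab.2%:E &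
        ((h ^+ 2 / 2 + theta * h) * ab.1 = expR (- h) * (ab.2 - 1))%R].
  by have [a [b e]] := level_time_occupation hB hU hUB (K0 n) t0 h0; exists (a, b).
have mF n : ae_measurable P (fun w => F w (sigma n w)).
  apply: ae_measurableM.
    apply: (ae_measurable_comp (phi := expR)) => //.
    apply: ae_measurableD.
      apply: (ae_measurable_comp (phi := fun x => theta * x)%R) => //.
        exact: measurable_funM.
      exact: ae_measurable_level_value.
    apply: (ae_measurable_comp (phi := fun x => - (q * x))%R).
      by apply: measurableT_comp => //; exact: measurable_funM.
    exact: ae_measurable_level_time.
  apply: ae_measurableM; first exact: ae_measurable_level_time.
  apply: (ae_measurable_comp (phi := fun x => expR (h * (x - 1)))).
    apply: measurableT_comp => //; apply: measurable_funM => //.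
    exact: measurable_funB.
  exact: ae_measurable_level_sample.
have mG n : ae_measurable P (fun w => G w (sigma n w)).
  apply: (ae_measurable_comp (phi := expR)) => //.
  apply: ae_measurableD.
    apply: (ae_measurable_comp (phi := fun x => (theta + h) * x)%R) => //.
      exact: measurable_funM.
    exact: ae_measurable_level_value.
  apply: (ae_measurable_comp (phi := fun x => - (q * x))%R).
    by apply: measurableT_comp => //; exact: measurable_funM.
  exact: ae_measurable_level_time.
(* The constant comes from [s exp (- q s) <= 1 / q]; as [B <= 1], the remaining factors are at most
   [exp theta] and 1. *)
have [|finF cF] := ae_bounded_convergence (C := (expR theta * q^-1)%R) mF _ (ae_hitting_limit F).
  move=> n; apply: filterS2 (ae_good_path hB) (ae_uniform01 hU) => w gw /andP[U0 U1].
  have s0 := sigma_ge0 n gw.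
  have B1 := value_le1 n gw.
  have BU1 : (B (U w * sigma n w) w <= 1)%R.
    case: (gw) => cb b0; apply: (alive_value_le cb b0); first exact: mulr_ge0.
    move=> s hs sU; have sn : (s < sigma n w)%R.
      by apply: lt_le_trans sU _; rewrite -[leRHS]mul1r ler_wpM2r// ltW.
    exact: (alive_level_time (ltW (K0 n)) hs sn).
  rewrite ger0_norm; last by apply: mulr_ge0; [exact: expR_ge0|rewrite mulr_ge0 ?expR_ge0].
  rewrite /F expRD -mulrA; apply: ler_pM.
  - exact: expR_ge0.
  - by rewrite !mulr_ge0 ?expR_ge0.
  - by rewrite ler_expR -[leRHS]mulr1; apply: ler_wpM2l => //; exact: ltW.
  rewrite mulrA -[leRHS]mulr1; apply: ler_pM.
  - by rewrite mulr_ge0 ?expR_ge0.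
  - exact: expR_ge0.
  - have [->|sn0] := eqVneq (sigma n w) 0%R; first by rewrite mulr0 invr_ge0 ltW.
    have sp : (0 < sigma n w)%R by rewrite lt_neqAle eq_sym sn0.
    rewrite -ler_pdivlMr// -invfM; apply: expRN_le_invr; exact: mulr_gt0.
  - by rewrite -[leRHS]expR0 ler_expR pmulr_rle0// subr_le0.
have [|finG cG] := ae_bounded_convergence (C := expR (theta + h)) mG _ (ae_hitting_limit G).
  move=> n; apply: filterS (ae_good_path hB) => w gw.
  rewrite ger0_norm ?expR_ge0// ler_expR.
  apply: (@le_trans _ _ ((theta + h) * B (sigma n w) w)%R).
    by rewrite gerBl mulr_ge0 ?sigma_ge0// ltW.
  by rewrite -[leRHS]mulr1; apply: ler_wpM2l; rewrite ?value_le1// addr_ge0// ltW.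
have GE : \int[P]_w (G w (tau w))%:E = (expR h)%:E.
  have [e me he] := ae_measurable_comp (phi := fun x => expR (- (q * x)))
    ltac:(by apply: measurableT_comp => //; apply: measurableT_comp => //; exact: measurable_funM)
    ae_measurable_hitting_time.
  rewrite (@integral_ae_eq_any _ _ _ _ _ (fun w => (expR (theta + h))%:E * (`|e w|)%:E)); last first.
    apply: filterS3 he (ae_good_path hB) ae_hits => w /= <- [cb b0] hw.
    rewrite ger0_norm ?expR_ge0// -EFinM -expRD; congr (expR _)%:E.
    by rewrite (hitting_time_value cb hw) mulr1.
  rewrite ge0_integralZl//; last by apply/measurable_EFinP; exact: measurableT_comp.
  rewrite (@integral_ae_eq_any _ _ _ _ _ (fun w => (expR (- (q * tau w)))%:E)); last first.
    by apply: filterS he => w /= <-; rewrite ger0_norm ?expR_ge0.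
  by rewrite hitting_time_laplace// -EFinM -expRD; congr (expR _)%:E; ring.
have ca : (fun n => (ab n).1) @ \oo --> fine (\int[P]_w (F w (tau w))%:E).
  apply: (fine_cvg (f := fun n => ((ab n).1)%:E)); rewrite fineK//.
  rewrite (_ : (fun n => _) = (fun n => \int[P]_w (F w (sigma n w))%:E))//.
  by apply/funext => n; have [-> _ _] := hab n.
have cb : (fun n => (ab n).2) @ \oo --> fine (\int[P]_w (G w (tau w))%:E).
  apply: (fine_cvg (f := fun n => ((ab n).2)%:E)); rewrite fineK//.
  rewrite (_ : (fun n => _) = (fun n => \int[P]_w (G w (sigma n w))%:E))//.
  by apply/funext => n; have [_ -> _] := hab n.
have lim1 : ((h ^+ 2 / 2 + theta * h) * fine (\int[P]_w (F w (tau w))%:E) =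
    expR (- h) * (expR h - 1))%R.
  have c1 : (fun n => (h ^+ 2 / 2 + theta * h) * (ab n).1)%R @ \oo -->
    ((h ^+ 2 / 2 + theta * h) * fine (\int[P]_w (F w (tau w))%:E))%R.
    by apply: cvgM => //; exact: cvg_cst.
  apply: (cvg_unique _ c1) => //.
  rewrite (_ : (fun n => _) = (fun n => expR (- h) * ((ab n).2 - 1))%R); last first.
    by apply/funext => n; have [_ _ ->] := hab n.
  apply: cvgM; first exact: cvg_cst.
  by apply: cvgB; [rewrite GE/= in cb|exact: cvg_cst].
have FE : \int[P]_w (F w (tau w))%:E = (expR theta)%:E *
   \int[P]_w (expR (- (theta ^+ 2 / 2 * tau w)) *
     (tau w * expR (h * (B (U w * tau w) w - 1))))%:E.
  have [e me he] : ae_measurable P (fun w => expR (- (q * tau w)) *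
     (tau w * expR (h * (B (U w * tau w) w - 1))))%R.
    apply: ae_measurableM.
      apply: (ae_measurable_comp (phi := fun x => expR (- (q * x)))).
        by apply: measurableT_comp => //; apply: measurableT_comp => //; exact: measurable_funM.
      exact: ae_measurable_hitting_time.
    apply: ae_measurableM; first exact: ae_measurable_hitting_time.
    apply: (ae_measurable_comp (phi := fun x => expR (h * (x - 1)))).
      apply: measurableT_comp => //; apply: measurable_funM => //.
      exact: measurable_funB.
    exact: ae_measurable_hitting_sample.
  have he0 w : (0 <= expR (- (q * tau w)) *
     (tau w * expR (h * (B (U w * tau w) w - 1))))%R.
    by rewrite !mulr_ge0 ?expR_ge0// hitting_time_ge0.
  rewrite (@integral_ae_eq_any _ _ _ _ (fun w => (F w (tau w))%:E) (fun w => (expR theta)%:E * (`|e w|)%:E)); last first.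
    apply: filterS3 he (ae_good_path hB) ae_hits => w /= <- [cb' b0] hw.
    rewrite ger0_norm// -EFinM; congr EFin; rewrite /F [RHS]mulrA -expRD; congr (expR _ * _)%R.
    by rewrite (hitting_time_value cb' hw) mulr1.
  rewrite ge0_integralZl//; last by apply/measurable_EFinP; exact: measurableT_comp.
  congr (_ * _); apply: integral_ae_eq_any.
  by apply: filterS he => w /= <-; rewrite ger0_norm.
rewrite (_ : integral _ _ _ = (expR (- theta))%:E * \int[P]_w (F w (tau w))%:E); last first.
  by rewrite FE muleA -EFinM -expRD addNr expR0 mul1e.
rewrite -(fineK finF) -!EFinM; congr EFin.
rewrite mulrCA lim1; congr (_ * _)%R.
by rewrite mulrBr mulr1 -expRD addNr expR0.
Qed.

End hitting_time_identities.

(** * The first moment from the occupation identity *)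

Section first_moment.
Local Open Scope ereal_scope.
Context d (T : measurableType d) (R : realType) (P : probability T R).
Variables (t y : T -> R) (theta : R).
Hypothesis mt : measurable_fun setT t.
Hypothesis my : measurable_fun setT y.
Hypothesis t0 : forall w, (0 <= t w)%R.
Hypothesis y0 : forall w, (0 <= y w)%R.
Hypothesis theta0 : (0 < theta)%R.
Hypothesis occ : forall h, (0 < h)%R ->
  (h ^+ 2 / 2 + theta * h)%:E *
  \int[P]_w (expR (- (theta ^+ 2 / 2 * t w)) * (t w * expR (- (h * y w))))%:E =
  (expR (- theta) * (1 - expR (- h)))%:E.

Let W w := (expR (- (theta ^+ 2 / 2 * t w)) * t w)%R.
Let W0 w : (0 <= W w)%R. Proof. by rewrite mulr_ge0 ?expR_ge0. Qed.
Let mW : measurable_fun setT W.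
Proof.
apply: measurable_funM => //; apply: measurableT_comp => //.
by apply: measurableT_comp => //; exact: measurable_funM.
Qed.

Let I (h : R) : R := expR (- theta) * (1 - expR (- h)) / (h ^+ 2 / 2 + theta * h).

Let mWh h : measurable_fun setT (fun w => W w * expR (- (h * y w)))%R.
Proof.
apply: measurable_funM => //; apply: measurableT_comp => //.
by apply: measurableT_comp => //; exact: measurable_funM.
Qed.

Let IE h : (0 < h)%R -> \int[P]_w (W w * expR (- (h * y w)))%:E = (I h)%:E.
Proof.
move=> h0; have L0 : (0 < h ^+ 2 / 2 + theta * h)%R.
  by rewrite addr_gt0 ?mulr_gt0 ?divr_gt0 ?exprn_gt0.
have := occ h0; under eq_integral do rewrite mulrA.
move=> /(congr1 (fun x => ((h ^+ 2 / 2 + theta * h)^-1)%:E * x)).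
rewrite muleA -!EFinM mulVf ?gt_eqF// mul1e => ->; congr EFin.
by rewrite /I mulrC.
Qed.

(** A difference quotient between [h] and [2 h], where the transform is known, and not between 0 and
    [h]. For [x >= 0] it increases to [x] as [h] is halved, so monotone convergence applies before
    the limit is known to be integrable. *)
Let phi (h x : R) : R := (expR (- (h * x)) - expR (- (2 * h * x))) / h.

Let phiE h : (0 < h)%R -> \int[P]_w (W w * phi h (y w))%:E = ((I h - I (2 * h)) / h)%:E.
Proof.
move=> h0; have h20 : (0 < 2 * h)%R by rewrite mulr_gt0.
have pos w : (0 <= phi h (y w))%R.
  rewrite divr_ge0 ?(ltW h0)// subr_ge0 ler_expR lerN2.
  by apply: ler_wpM2r => //; rewrite ler_peMl ?(ltW h0)// ler1n.
have mphi : measurable_fun setT (phi h).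
  apply: measurable_funM => //; apply: measurable_funB;
    apply: measurableT_comp => //; apply: measurableT_comp => //; exact: measurable_funM.
have e : h%:E * \int[P]_w (W w * phi h (y w))%:E + (I (2 * h))%:E = (I h)%:E.
  rewrite -!IE// -ge0_integralZl//; last 3 first.
  - by apply/measurable_EFinP; apply: measurable_funM => //; exact: measurableT_comp.
  - by move=> w _; rewrite lee_fin mulr_ge0.
  - by rewrite lee_fin ltW.
  rewrite -ge0_integralD//.
  - apply: eq_integral => w _; rewrite -EFinM -EFinD /phi; congr EFin.
    by field; rewrite gt_eqF.
  - move=> w _; rewrite -EFinM lee_fin; apply: mulr_ge0; first exact: ltW.
    exact: mulr_ge0.
  - apply: measurable_funeM; apply/measurable_EFinP; apply: measurable_funM => //.
    exact: measurableT_comp.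
  - by move=> w _; rewrite lee_fin mulr_ge0 ?expR_ge0.
  - by apply/measurable_EFinP; exact: mWh.
move: e => /(congr1 (fun x => x - (I (2 * h))%:E)); rewrite addeK// -EFinB.
move=> /(congr1 (fun x => (h^-1)%:E * x)).
by rewrite muleA -!EFinM mulVf ?gt_eqF// mul1e mulrC => ->.
Qed.

Let u (k : nat) : R := (2 ^+ k)^-1.
Let u0 k : (0 < u k)%R. Proof. by rewrite invr_gt0 exprn_gt0. Qed.
Let uS k : u k = (2 * u k.+1)%R.
Proof. by rewrite /u exprS invfM mulrA mulfV ?mul1r. Qed.

Let cvg_u : u @ \oo --> 0%R.
Proof.
rewrite (_ : u = fun k => (2^-1 ^+ k)%R); last by apply/funext => k; rewrite /u exprVn.
by apply: cvg_expr; rewrite ger0_norm// invf_lt1// ltr1n.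
Qed.

Let slope (h : R) : R := ((1 - expR (- h)) / h)%R.

Let cvg_slope : (fun k => slope (u k)) @ \oo --> (1 : R)%R.
Proof.
rewrite (_ : (fun k => _) = (fun k => expR (- u k) * ((expR (1 * u k) - 1) / u k)))%R; last first.
  apply/funext => k; rewrite /slope mulrA; congr (_ / _)%R.
  by rewrite mulrBr mulr1 mul1r -expRD addNr expR0.
rewrite -[X in _ --> X]mulr1; apply: cvgM; last exact: cvg_expR_slope.
rewrite -[X in _ --> X]expR0; apply: continuous_cvg; first exact: continuous_expR.
by rewrite -[X in _ --> X]oppr0; apply: cvgN.
Qed.

(** The moment is minus the derivative at 0 of [I], the Laplace transform of [y] under the weight
    [W]. *)
Lemma first_moment :
  \int[P]_w (W w * y w)%:E = (expR (- theta) * (1 + theta) / (2 * theta ^+ 2))%:E.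
Proof.
have mphi h : measurable_fun setT (phi h).
  apply: measurable_funM => //; apply: measurable_funB;
    apply: measurableT_comp => //; apply: measurableT_comp => //; exact: measurable_funM.
have c1 : \int[P]_w (W w * phi (u k) (y w))%:E @[k --> \oo] --> \int[P]_w (W w * y w)%:E.
  rewrite (_ : (fun w => _) = (fun w => limn (fun k => (W w * phi (u k) (y w))%:E))); last first.
    apply/funext => w; apply/esym/cvg_lim => //; apply: cvg_EFin; first exact: nearW.
    apply: cvgM; first exact: cvg_cst.
    have [yw0|yw0] := eqVneq (y w) 0%R.
      rewrite yw0 (_ : (fun k => _) = cst 0%R); first exact: cvg_cst.
      by apply/funext => k; rewrite /= /phi !mulr0 subrr mul0r.
    have yp : (0 < y w)%R by rewrite lt_neqAle eq_sym yw0 y0.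
    rewrite (_ : (fun k => _) = (fun k => expR (- (2 * (u k * y w))) *
        ((expR (y w * u k) - 1) / u k)))%R; last first.
      apply/funext => k /=; rewrite /phi mulrA; congr (_ / _)%R.
      by rewrite mulrBr mulr1 -expRD; congr (expR _ - expR _)%R; ring.
    rewrite -[X in _ --> X]mul1r; apply: cvgM; last exact: cvg_expR_slope.
    rewrite -[X in _ --> X]expR0; apply: continuous_cvg; first exact: continuous_expR.
    rewrite -[X in _ --> X]oppr0; apply: cvgN; rewrite -[X in _ --> X](mulr0 2%R).
    apply: cvgM; first exact: cvg_cst.
    by rewrite -[X in _ --> X](mul0r (y w)); apply: cvgMl.
  apply: cvg_monotone_convergence => //.
  - move=> k; apply/measurable_EFinP; apply: measurable_funM => //.
    exact: measurableT_comp.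
  - move=> k w _; rewrite lee_fin mulr_ge0// divr_ge0 ?(ltW (u0 _))// subr_ge0 ler_expR lerN2.
    by apply: ler_wpM2r => //; rewrite ler_peMl ?(ltW (u0 _))// ler1n.
  - move=> w _; apply/nondecreasing_seqP => k; rewrite lee_fin; apply: ler_wpM2l => //.
    rewrite /phi uS; set v := u k.+1; have v0 : (0 < v)%R by exact: u0.
    pose z := expR (- (v * y w)).
    have z0 : (0 <= z)%R by exact: expR_ge0.
    have -> : expR (- (2 * v * y w)) = (z ^+ 2)%R.
      by rewrite -expRM_natl; congr expR; ring.
    have -> : expR (- (2 * (2 * v) * y w)) = (z ^+ 4)%R.
      by rewrite -expRM_natl; congr expR; ring.
    rewrite -/z ler_pdivrMr ?mulr_gt0//.
    have -> : ((z - z ^+ 2) / v * (2 * v) = 2 * (z - z ^+ 2))%R by field; rewrite gt_eqF.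
    (* With [z = exp (- v y)] the comparison is a polynomial inequality with a double root at 1. *)
    rewrite -subr_ge0 (_ : _ - _ = z * (z - 1) ^+ 2 * (z + 2))%R; last by ring.
    apply: mulr_ge0; last by rewrite addr_ge0.
    by apply: mulr_ge0 => //; exact: sqr_ge0.
have c2 : (fun k => ((I (u k) - I (2 * u k)) / u k)%:E) @ \oo -->
    (expR (- theta) * (1 + theta) / (2 * theta ^+ 2))%:E.
  apply: cvg_EFin; first exact: nearW.
  (* Every quotient of the form 0 / 0 is absorbed in [slope], so the limit can be taken factor by
     factor. *)
  rewrite (_ : _ \o _ = (fun k => expR (- theta) * slope (u k) *
     ((2 - (1 + expR (- u k)) / 2) + theta * slope (u k)) /
     (2 * (u k + theta) * (u k / 2 + theta))))%R; last first.
    apply/funext => k /=; rewrite /I /slope.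
    have -> : expR (- (2 * u k)) = (expR (- u k) ^+ 2)%R.
      by rewrite -expRM_natl; congr expR; ring.
    field.
    have uk := u0 k.
    by rewrite !gt_eqF ?(addr_gt0, mulr_gt0, exprn_gt0).
  rewrite (_ : (expR (- theta) * (1 + theta) / (2 * theta ^+ 2)) =
     expR (- theta) * 1 * ((2 - (1 + 1) / 2) + theta * 1) / (2 * (0 + theta) * (0 / 2 + theta)))%R; last first.
    by field; rewrite gt_eqF.
  apply: cvgM.
    apply: cvgM; first by apply: cvgM => //; exact: cvg_cst.
    apply: cvgD; last by apply: cvgM => //; exact: cvg_cst.
    apply: cvgB; first exact: cvg_cst.
    apply: cvgMl; apply: cvgD; first exact: cvg_cst.
    rewrite -[X in _ --> X]expR0; apply: continuous_cvg; first exact: continuous_expR.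
    by rewrite -[X in _ --> X]oppr0; apply: cvgN.
  apply: cvgV; first by rewrite !add0r mul0r add0r !mulf_neq0 ?gt_eqF.
  apply: cvgM; last by apply: cvgD; [exact: cvgMl|exact: cvg_cst].
  by apply: cvgM; [exact: cvg_cst|apply: cvgD => //; exact: cvg_cst].
apply: (cvg_unique _ c1) => //.
by rewrite (_ : (fun k => _) = (fun k => ((I (u k) - I (2 * u k)) / u k)%:E))//;
   apply/funext => k; rewrite phiE.
Qed.

End first_moment.

(** * Integrals over the half-line *)

Section half_line_integrals.
Local Open Scope ereal_scope.
Context {R : realType}.
Local Notation mu := (@lebesgue_measure R).

(** The rate [C / x] is a convenient certificate for the limit of the antiderivative at infinity; a
    crude constant suffices. *)
Lemma integral_antiderivative_0y (F f : R -> R) (l C : R) :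
  (forall x : R, 0 <= x -> 0 <= f x)%R -> (forall x : R, (0 <= x)%R -> {for x, continuous f}) ->
  (forall x : R, (0 <= x)%R -> derivable F x 1%R /\ 'D_1%R F x = f x) ->
  (forall x : R, (0 < x)%R -> `|F x - l| <= C / x)%R ->
  \int[mu]_(x in `[0%R, +oo[) (f x)%:E = (l - F 0%R)%:E.
Proof.
move=> f0 cf dF Fl; rewrite EFinB; apply: ge0_continuous_FTC2y => //.
- apply: continuous_in_subspaceT => x; rewrite inE/= in_itv/= andbT; exact: cf.
- apply/cvgrPdist_le => /= e e0; near=> x.
  have x0 : (0 < x)%R by near: x; apply: nbhs_pinfty_gt; exact: num_real.
  have Cx : (C / e <= x)%R by near: x; apply: nbhs_pinfty_ge; exact: num_real.
  rewrite distrC; apply: (le_trans (Fl _ x0)).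
  by rewrite ler_pdivrMr// mulrC -ler_pdivrMr.
- by move=> x x0; have [] := dF x (ltW x0).
- apply: cvg_at_right_filter; have [dF0 _] := dF 0%R (lexx _).
  by apply: differentiable_continuous; exact/derivable1_diffP.
- move=> x; rewrite in_itv/= andbT => x0.
  by rewrite derive1E; have [_ ->] := dF x (ltW x0).
Unshelve. all: by end_near. Qed.

Lemma is_derive_val (F : R -> R) (x dF : R) : is_derive x 1%R F dF ->
  derivable F x 1%R /\ 'D_1%R F x = dF.
Proof. by case. Qed.

Lemma is_derive_congr (F G : R -> R) (x a b : R) : is_derive x 1%R F a ->
  F =1 G -> a = b -> is_derive x 1%R G b.
Proof. by move=> dF /funext <- <-. Qed.

Lemma is_derive_expR_comp (g : R -> R) (x dg : R) : is_derive x 1%R g dg ->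
  is_derive x 1%R (fun z => expR (g z)) (expR (g x) * dg)%R.
Proof. by move=> hg; exact: (is_derive1_comp (is_derive_expR (g x)) hg). Qed.

Lemma is_derive_expRN (x : R) : is_derive x 1%R (fun z => expR (- z)) (- expR (- x))%R.
Proof.
by rewrite -mulrN1; apply: is_derive_expR_comp.
Qed.

Lemma continuous_expR_comp (g : R -> R) (x : R) : {for x, continuous g} ->
  {for x, continuous (fun z => expR (g z))}.
Proof. by move=> cg; apply: continuous_comp cg _; exact: continuous_expR. Qed.

Lemma integral_expRN : \int[mu]_(x in `[0%R, +oo[) (expR (- x))%:E = 1.
Proof.
rewrite (@integral_antiderivative_0y (fun x => - expR (- x))%R _ 0%R 1%R).
- by rewrite oppr0 expR0 sub0r opprK.
- by move=> x _; exact: expR_ge0.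
- by move=> x _; apply: continuous_expR_comp; apply: cvgN; exact: cvg_id.
- move=> x _; apply: is_derive_val; rewrite -[X in is_derive _ _ _ X]opprK.
  by apply: is_deriveN; exact: is_derive_expRN.
- by move=> x x0; rewrite subr0 normrN ger0_norm ?expR_ge0// div1r; exact: expRN_le_invr.
Qed.

(** Twice the function of [theta] left when the first moment is multiplied by [theta ^+ 2]. *)
Lemma integral_affine_expRN :
  \int[mu]_(x in `[0%R, +oo[) ((x + 1) * expR (- x))%:E = 2%:E.
Proof.
rewrite (@integral_antiderivative_0y (fun x => - ((x + 2) * expR (- x)))%R _ 0%R 9%R).
- by rewrite sub0r opprK oppr0 expR0 add0r mulr1.
- by move=> x x0; rewrite mulr_ge0 ?expR_ge0// addr_ge0.
- move=> x _; apply: cvgM; first by apply: cvgD; [exact: cvg_id|exact: cvg_cst].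
  by apply: continuous_expR_comp; apply: cvgN; exact: cvg_id.
- move=> x _; apply: is_derive_val; rewrite -[X in is_derive _ _ _ X]opprK; apply: is_deriveN.
  have d1 : is_derive x 1%R (fun z : R => z + 2)%R 1%R by apply: is_derive_eq; rewrite addr0.
  apply: (is_derive_congr (is_deriveM d1 (is_derive_expRN x))) => //.
  by rewrite /= /GRing.scale/=; ring.
- move=> x x0; rewrite subr0 normrN ger0_norm; last by rewrite mulr_ge0 ?expR_ge0// addr_ge0 ?ltW.
  (* Its cube is a cubic lower bound for [exp x]; after multiplication by 9 it dominates
     [(x + 2) * x] coefficient by coefficient. *)
  have h : (1 + x / 3 <= expR (x / 3))%R := expR_ge1Dx _.
  have h3 : ((1 + x / 3) ^+ 3 <= expR x)%R.
    rewrite (_ : expR x = expR (x / 3) ^+ 3)%R; last first.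
      by rewrite -expRM_natl; congr expR; field.
    by rewrite lerXn2r// nnegrE ?expR_ge0// addr_ge0// divr_ge0// ltW.
  rewrite expRN ler_pdivrMr ?expR_gt0// mulrAC ler_pdivlMr//.
  apply: (@le_trans _ _ (9 * (1 + x / 3) ^+ 3)%R); last by rewrite ler_pM2l.
  rewrite (_ : 9 * _ = 9 + 9 * x + 3 * x ^+ 2 + x ^+ 3 / 3)%R; last by field.
  have x3 : (0 <= x ^+ 3)%R by rewrite exprn_ge0// ltW.
  have x2 : (0 <= x ^+ 2)%R by rewrite exprn_ge0// ltW.
  rewrite (_ : (x + 2) * x = x ^+ 2 + 2 * x)%R; last by ring.
  lra.
Qed.

Let gauss (a x : R) : R := expR (- (a * x ^+ 2 / 2)).

Let dsq (a x : R) : is_derive x 1%R (fun z : R => - (a * z ^+ 2 / 2))%R (- (a * x))%R.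
Proof.
by apply: is_derive_eq; rewrite /GRing.scale/=; field.
Qed.

Let cgauss (a x : R) : {for x, continuous (gauss a)}.
Proof.
apply: continuous_expR_comp; apply: differentiable_continuous.
by apply/derivable1_diffP; have [] := dsq a x.
Qed.

Let mgauss (a : R) : measurable_fun setT (gauss a).
Proof. by apply: continuous_measurable_fun => x; exact: cgauss. Qed.

Let gauss_le (a x : R) : (0 < a)%R -> (0 < x)%R -> (gauss a x <= 2 / a / x ^+ 2)%R.
Proof.
move=> a0 x0; have x20 : (0 < a * x ^+ 2 / 2)%R by rewrite divr_gt0 ?mulr_gt0 ?exprn_gt0.
apply: (le_trans (expRN_le_invr x20)).
by rewrite (_ : (_)^-1 = 2 / a / x ^+ 2)%R//; field; rewrite !gt_eqF.
Qed.

Let gauss_le_invr (a x : R) : (0 < a)%R -> (0 < x)%R -> (gauss a x <= (1 + 2 / a) / x)%R.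
Proof.
move=> a0 x0; have a20 : (0 <= 2 / a)%R by rewrite divr_ge0// ltW.
rewrite ler_pdivlMr//; have [x1|x1] := leP x 1%R.
  apply: (@le_trans _ _ 1%R); last by rewrite lerDl.
  rewrite -[leRHS]mulr1; apply: ler_pM => //; [exact: expR_ge0|exact: ltW|].
  by rewrite -[leRHS]expR0 ler_expR oppr_le0 divr_ge0// mulr_ge0 ?sqr_ge0// ltW.
apply: (@le_trans _ _ (2 / a / x ^+ 2 * x)%R).
  by rewrite ler_pM2r// gauss_le.
rewrite (_ : 2 / a / x ^+ 2 * x = 2 / a / x)%R; last by field; rewrite !gt_eqF.
apply: (@le_trans _ _ (2 / a)%R); last by rewrite lerDr.
by rewrite ler_pdivrMr// ler_peMr// ltW.
Qed.

Lemma integral_x_gauss (a : R) : (0 < a)%R ->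
  \int[mu]_(x in `[0%R, +oo[) (x * expR (- (a * x ^+ 2 / 2)))%:E = (a^-1)%:E.
Proof.
move=> a0; rewrite (@integral_antiderivative_0y (fun x => - a^-1 * gauss a x)%R _ 0%R (a^-1 * (1 + 2 / a))%R).
- by rewrite /gauss expr0n/= mulr0 mul0r oppr0 expR0 mulr1 sub0r opprK.
- by move=> x x0; rewrite mulr_ge0 ?expR_ge0.
- by move=> x _; apply: cvgM; [exact: cvg_id|exact: cgauss].
- move=> x _; apply: is_derive_val;
  apply: (is_derive_congr (is_deriveZ (- a^-1)%R (is_derive_expR_comp (dsq a x)))) => //.
  by rewrite /GRing.scale/=; field; rewrite gt_eqF.
- move=> x x0; rewrite subr0 mulNr normrN ger0_norm; last by rewrite mulr_ge0 ?expR_ge0// invr_ge0 ltW.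
  rewrite -mulrA; apply: ler_wpM2l; [by rewrite invr_ge0 ltW|exact: gauss_le_invr].
Qed.

(** By symmetry, half of the total mass of the normal law of variance [1 / a], normalised so as to
    write [1 / sqrt a] as a mixture of Gaussian functions. *)
Lemma integral_gauss_half (a : R) : (0 < a)%R ->
  (Num.sqrt (2 / pi))%:E * \int[mu]_(x in `[0%R, +oo[) (expR (- (a * x ^+ 2 / 2)))%:E =
  ((Num.sqrt a)^-1)%:E.
Proof.
move=> a0; pose s := ((Num.sqrt a)^-1)%R.
have s0 : (0 < s)%R by rewrite invr_gt0 sqrtr_gt0.
have s2 : (s ^+ 2 = a^-1)%R by rewrite exprVn sqr_sqrtr// ltW.
have pk : (normal_peak s = Num.sqrt (a / (2 * pi)))%R.
  rewrite /normal_peak -sqrtrV; last by rewrite s2 mulrn_wge0// mulr_ge0 ?pi_ge0// invr_ge0 ltW.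
  congr Num.sqrt; rewrite s2; move: (pi_gt0 R); generalize (pi : R) => p p0.
  by field; rewrite !gt_eqF.
have pdfE x : normal_pdf 0 s x = (normal_peak s * gauss a x)%R.
  rewrite normal_pdfE ?gt_eqF// /normal_fun subr0 s2; congr (_ * expR _)%R.
  by field; rewrite gt_eqF.
have mg : measurable_fun setT (fun x : R => (gauss a x)%:E).
  by apply/measurable_EFinP; exact: mgauss.
have := integral_normal_pdf 0%R s; under eq_integral do rewrite pdfE EFinM.
rewrite ge0_integralZl//; last 2 first.
- by move=> x _; rewrite lee_fin expR_ge0.
- by rewrite lee_fin normal_peak_ge0.
rewrite ge0_symfun_integralT; last 3 first.
- by move=> x; exact: expR_ge0.
- by move=> x; exact: cgauss.
- by move=> x /=; rewrite /gauss sqrrN.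
rewrite (_ : [set x | _] = `[0%R, +oo[%classic); last first.
  by apply/seteqP; split => x/=; rewrite in_itv/= andbT.
set J := \int[_]_(_ in _) _ => h.
have e : ((Num.sqrt a)^-1 * (normal_peak s * 2) = Num.sqrt (2 / pi))%R.
  have ap : (0 <= a / (2 * pi))%R by rewrite divr_ge0 ?mulr_ge0 ?pi_ge0// ltW.
  apply/eqP; rewrite -(@eqrXn2 _ 2) ?mulr_ge0 ?invr_ge0 ?sqrtr_ge0// ?normal_peak_ge0//.
  have p2 : (0 <= 2 / pi :> R)%R by rewrite divr_ge0 ?pi_ge0.
  rewrite !exprMn exprVn pk (sqr_sqrtr ap) (sqr_sqrtr p2) (sqr_sqrtr (ltW a0)); apply/eqP.
  by move: (pi_gt0 R); generalize (pi : R) => p p0; field; rewrite !gt_eqF.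
by rewrite -e EFinM -muleA EFinM -(muleA (normal_peak s)%:E) h mule1.
Qed.

Lemma integral_x2_gauss (a : R) : (0 < a)%R ->
  \int[mu]_(x in `[0%R, +oo[) (x ^+ 2 * (a * expR (- (a * x ^+ 2 / 2))))%:E =
  \int[mu]_(x in `[0%R, +oo[) (expR (- (a * x ^+ 2 / 2)))%:E.
Proof.
(* The integrand [(a x^2 - 1) exp (- a x^2 / 2)] is made nonnegative by adding
   [exp (1 / 2 - b x)], which dominates [exp (- a x^2 / 2)] for [b = sqrt a]. *)
move=> a0; pose b := Num.sqrt a.
have b0 : (0 < b)%R by rewrite sqrtr_gt0.
have b2 : (b ^+ 2 = a)%R by rewrite sqr_sqrtr// ltW.
pose k (x : R) : R := expR (2^-1 - b * x).
have gk (x : R) : (gauss a x <= k x)%R.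
  rewrite ler_expR -subr_ge0 (_ : _ - _ = (b * x - 1) ^+ 2 / 2)%R; last by rewrite -b2; field.
  by rewrite divr_ge0// sqr_ge0.
have dlin (x : R) : is_derive x 1%R (fun z : R => 2^-1 - b * z)%R (- b)%R.
  by apply: is_derive_eq; rewrite /GRing.scale/=; ring.
have ck (x : R) : {for x, continuous k}.
  apply: continuous_expR_comp; apply: differentiable_continuous.
  by apply/derivable1_diffP; have [] := dlin x.
have mk : measurable_fun setT k by apply: continuous_measurable_fun => x; exact: ck.
have k0 (x : R) : (0 <= k x)%R by exact: expR_ge0.
have kbnd (x : R) : (0 < x)%R -> (k x <= expR (2^-1) / b / x)%R.
  move=> x0; rewrite /k expRD -mulrA; apply: ler_wpM2l; first exact: expR_ge0.
  by rewrite -invfM; apply: expRN_le_invr; rewrite mulr_gt0.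
have Ik : \int[mu]_(x in `[0%R, +oo[) (k x)%:E = (b^-1 * expR (2^-1))%:E.
  rewrite (@integral_antiderivative_0y (fun x => - b^-1 * k x)%R _ 0%R (b^-1 * (expR (2^-1) / b))%R) //.
  - by rewrite /k mulr0 subr0 mulNr sub0r opprK.
  - move=> x _; apply: is_derive_val.
    apply: (is_derive_congr (is_deriveZ (- b^-1)%R (is_derive_expR_comp (dlin x)))) => //.
    by rewrite /GRing.scale/= /k; field; rewrite gt_eqF.
  - move=> x x0; rewrite subr0 mulNr normrN ger0_norm; last by rewrite mulr_ge0// invr_ge0 ltW.
    by rewrite -mulrA; apply: ler_wpM2l; [rewrite invr_ge0 ltW|exact: kbnd].
have Im : \int[mu]_(x in `[0%R, +oo[) ((a * x ^+ 2 - 1) * gauss a x + k x)%:E = (b^-1 * expR (2^-1))%:E.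
  rewrite (@integral_antiderivative_0y (fun x => - (x * gauss a x) - b^-1 * k x)%R _ 0%R
     (2 / a + b^-1 * (expR (2^-1) / b))%R) //.
  - by rewrite /k mulr0 subr0 mul0r oppr0 !sub0r opprK.
  - move=> x x0; rewrite mulrBl mul1r -addrA addr_ge0//.
      by rewrite mulr_ge0 ?expR_ge0// mulr_ge0 ?sqr_ge0// ltW.
    by rewrite addrC subr_ge0.
  - move=> x _; apply: cvgD; last exact: ck.
    apply: cvgM; last exact: cgauss.
    apply: cvgB; last exact: cvg_cst.
    by apply: cvgM; [exact: cvg_cst|exact: exprn_continuous].
  - move=> x _; apply: is_derive_val.
    have d1 := is_deriveM (is_derive_id x 1%R) (is_derive_expR_comp (dsq a x)).
    have d2 := is_deriveZ (b^-1)%R (is_derive_expR_comp (dlin x)).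
    apply: (is_derive_congr (is_deriveB (is_deriveN d1) d2)) => //.
    by rewrite /GRing.scale/= /k /gauss; field; rewrite gt_eqF.
  - move=> x x0; rewrite subr0 -opprD normrN ger0_norm; last first.
      by rewrite addr_ge0// mulr_ge0 ?expR_ge0// ?invr_ge0 ltW.
    rewrite mulrDl; apply: lerD.
      apply: (@le_trans _ _ (x * (2 / a / x ^+ 2))%R).
        by rewrite ler_pM2l// gauss_le.
      by rewrite (_ : x * _ = 2 / a / x)%R//; field; rewrite !gt_eqF.
    by rewrite -mulrA; apply: ler_wpM2l; [rewrite invr_ge0 ltW|exact: kbnd].
have mD : measurable (`[0%R, +oo[ : set R) by [].
have mg : measurable_fun (`[0%R, +oo[ : set R) (fun x => (gauss a x)%:E).
  by apply/measurable_funTS/measurable_EFinP; exact: mgauss.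
have mx2 : measurable_fun (`[0%R, +oo[ : set R) (fun x => (x ^+ 2 * (a * gauss a x))%:E).
  apply/measurable_funTS/measurable_EFinP; apply: measurable_funM => //.
  by apply: measurable_funM => //; exact: mgauss.
have mkE : measurable_fun (`[0%R, +oo[ : set R) (fun x => (k x)%:E).
  by apply/measurable_funTS/measurable_EFinP.
have mh : measurable_fun (`[0%R, +oo[ : set R) (fun x => ((a * x ^+ 2 - 1) * gauss a x + k x)%:E).
  apply/measurable_funTS/measurable_EFinP; apply: measurable_funD => //.
  apply: measurable_funM; last exact: mgauss.
  by apply: measurable_funB => //; exact: measurable_funM.
have : \int[mu]_(x in `[0%R, +oo[) (x ^+ 2 * (a * gauss a x))%:E + \int[mu]_(x in `[0%R, +oo[) (k x)%:E =
    \int[mu]_(x in `[0%R, +oo[) (gauss a x)%:E +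
    \int[mu]_(x in `[0%R, +oo[) ((a * x ^+ 2 - 1) * gauss a x + k x)%:E.
  rewrite -!ge0_integralD//.
  - by apply: eq_integral => x _; rewrite -!EFinD; congr EFin; ring.
  - by move=> x _; rewrite lee_fin expR_ge0.
  - move=> x _; rewrite lee_fin mulrBl mul1r -addrA addr_ge0//.
      by rewrite mulr_ge0 ?expR_ge0// mulr_ge0 ?sqr_ge0// ltW.
    by rewrite addrC subr_ge0.
  - by move=> x _; rewrite lee_fin mulr_ge0 ?sqr_ge0// mulr_ge0 ?expR_ge0// ltW.
  - by move=> x _; rewrite lee_fin.
rewrite Ik Im => /(congr1 (fun z => z - (b^-1 * expR (2^-1))%:E)).
by rewrite !addeK.
Qed.

End half_line_integrals.

Lemma measurable_inv_sqrt (R : realType) : measurable_fun setT (fun x : R => (Num.sqrt x)^-1).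
Proof.
rewrite (_ : (fun x => _) = (fun x => x `^ (- 1)) \o Num.sqrt).
  apply: measurableT_comp (measurable_powR _) _.
  by apply: continuous_measurable_fun; exact: sqrt_continuous.
by apply/funext => x /=; rewrite powRN powRr1 ?sqrtr_ge0.
Qed.

(** * Tonelli between the half-line and the probability space *)

Section half_line_tonelli.
Local Open Scope ereal_scope.
Context d (T : measurableType d) (R : realType) (P : probability T R).
Local Notation mu := (@lebesgue_measure R).

Lemma eq_integral_0y (f g : R -> \bar R) : (forall x, (0 < x)%R -> f x = g x) ->
  \int[mu]_(x in `[0%R, +oo[) f x = \int[mu]_(x in `[0%R, +oo[) g x.
Proof.
move=> fg; rewrite integral_mkcond [RHS]integral_mkcond; apply: integral_ae_eq_any.
exists [set 0%R]; split => //; first exact: lebesgue_measure_set1.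
move=> x /= h; apply: contrapT => x0; apply: h; rewrite !patchE.
case: ifPn => //; rewrite inE/= in_itv/= andbT => x1; apply: fg.
by rewrite lt_neqAle x1 andbT; apply/eqP => e; apply: x0.
Qed.

Section tonelli.
Variable f : R -> T -> \bar R.
Hypothesis mf : measurable_fun setT (fun z : R * T => f z.1 z.2).
Hypothesis f0 : forall x w, 0 <= f x w.

Let D : set R := `[0%R, +oo[%classic.
Let g (z : R * T) := f z.1 z.2 * (\1_D z.1)%:E.
Let i0 x : (0 <= (\1_D x : R))%R. Proof. by rewrite indicE. Qed.
Let mD : measurable D. Proof. exact: measurable_itv. Qed.
Let mg : measurable_fun setT g.
Proof.
apply: emeasurable_funM => //; apply/measurable_EFinP.
by apply: measurableT_comp; [exact: measurable_indic|exact: measurable_fst].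
Qed.
Let g0 z : 0 <= g z. Proof. by rewrite mule_ge0. Qed.
Let gE w : \int[mu]_(x in `[0%R, +oo[) f x w = \int[mu]_x g (x, w).
Proof.
rewrite integral_mkcond; apply: eq_integral => x _.
by rewrite patchE /g indicE/= /D; case: ifPn => _; rewrite ?mule1 ?mule0.
Qed.

Lemma measurable_half_line :
  measurable_fun setT (fun w => \int[mu]_(x in `[0%R, +oo[) f x w).
Proof.
rewrite (_ : (fun w => _) = fubini_G mu g); last first.
  by apply/funext => w; rewrite gE.
exact: measurable_fun_fubini_tonelli_G.
Qed.

Lemma tonelli_half_line :
  \int[P]_w \int[mu]_(x in `[0%R, +oo[) f x w =
  \int[mu]_(x in `[0%R, +oo[) \int[P]_w f x w.
Proof.
under eq_integral do rewrite gE.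
rewrite -(@fubini_tonelli _ _ _ _ R mu P g mg g0) [RHS]integral_mkcond; apply: eq_integral => x _.
rewrite patchE /g/=; case: ifPn => xD.
  by apply: eq_integral => w _; rewrite indicE xD mule1.
by apply: integral0_eq => w _; rewrite indicE (negbTE xD) mule0.
Qed.

End tonelli.

End half_line_tonelli.

(** * The expectation of [alpha] *)

Section expectation_of_alpha.
Local Open Scope ereal_scope.
Context d (T : measurableType d) (R : realType) (P : probability T R).
Local Notation mu := (@lebesgue_measure R).
Local Notation c := (Num.sqrt (2 / pi) : R).

Section laplace.
Variables (t y : T -> R).
Hypothesis mt : measurable_fun setT t.
Hypothesis my : measurable_fun setT y.
Hypothesis t0 : forall w, (0 <= t w)%R.
Hypothesis y0 : forall w, (0 <= y w)%R.
Hypothesis aet : {ae P, forall w, 0 < t w}%R.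

Let gm : measurable_fun setT (fun z : R * T => expR (- (t z.2 * z.1 ^+ 2 / 2))).
Proof.
apply: measurableT_comp => //; apply: measurableT_comp => //.
apply: measurable_funM => //; apply: measurable_funM.
  by apply: measurableT_comp => //; exact: measurable_snd.
by apply: measurable_funX; exact: measurable_fst.
Qed.

Lemma laplace_inv_sqrt :
  (forall theta, (0 < theta)%R ->
    \int[P]_w (expR (- (theta ^+ 2 / 2 * t w)))%:E = (expR (- theta))%:E) ->
  \int[P]_w ((Num.sqrt (t w))^-1)%:E = c%:E.
Proof.
move=> lap.
transitivity (\int[P]_w (c%:E * \int[mu]_(x in `[0%R, +oo[) (expR (- (t w * x ^+ 2 / 2)))%:E)).
  apply: integral_ae_eq_any; apply: filterS aet => w tw.
  by rewrite integral_gauss_half.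
have gmE : measurable_fun setT (fun z : R * T => (expR (- (t z.2 * z.1 ^+ 2 / 2)))%:E).
  exact/measurable_EFinP.
have gE0 (x : R) (w : T) : 0 <= (expR (- (t w * x ^+ 2 / 2)))%:E by rewrite lee_fin expR_ge0.
rewrite ge0_integralZl//; last 2 first.
- exact: (measurable_half_line gmE gE0).
- by move=> w _; apply: integral_ge0 => x _; rewrite lee_fin expR_ge0.
rewrite (@tonelli_half_line _ _ _ P _ gmE gE0).
rewrite (@eq_integral_0y _ _ (fun x => (expR (- x))%:E)); last first.
  move=> x x0; rewrite -lap//; apply: eq_integral => w _; congr (expR _)%:E.
  by field.
by rewrite integral_expRN mule1.
Qed.

(** Here [1 / sqrt t] is represented with the extra weight [x ^+ 2 * t] from [integral_x2_gauss],
    because against [y] this weight produces the known first moment. What remains is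
    [(x + 1) exp (- x) / 2], of integral 1. *)
Lemma laplace_moment_inv_sqrt :
  (forall theta, (0 < theta)%R ->
    \int[P]_w (expR (- (theta ^+ 2 / 2 * t w)) * t w * y w)%:E =
      (expR (- theta) * (1 + theta) / (2 * theta ^+ 2))%:E) ->
  \int[P]_w (y w / Num.sqrt (t w))%:E = c%:E.
Proof.
move=> mom.
pose f x w := (y w * (x ^+ 2 * (t w * expR (- (t w * x ^+ 2 / 2)))))%R.
have f0 x w : (0 <= f x w)%R.
  by apply: mulr_ge0 => //; apply: mulr_ge0; [exact: sqr_ge0|rewrite mulr_ge0 ?expR_ge0].
have mf : measurable_fun setT (fun z : R * T => f z.1 z.2).
  apply: measurable_funM; first by apply: measurableT_comp => //; exact: measurable_snd.
  apply: measurable_funM; first by apply: measurable_funX; exact: measurable_fst.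
  apply: measurable_funM => //; first by apply: measurableT_comp => //; exact: measurable_snd.
have mfE : measurable_fun setT (fun z : R * T => (f z.1 z.2)%:E) by exact/measurable_EFinP.
have fE0 x w : 0 <= (f x w)%:E by rewrite lee_fin.
transitivity (\int[P]_w (c%:E * \int[mu]_(x in `[0%R, +oo[) (f x w)%:E)).
  apply: integral_ae_eq_any; apply: filterS aet => w tw.
  rewrite EFinM -integral_gauss_half// -integral_x2_gauss// muleCA; congr (_ * _).
  rewrite -ge0_integralZl//.
  - apply: measurable_funTS; apply/measurable_EFinP.
    apply: measurable_funM; first exact: measurable_funX.
    apply: measurable_funM => //; apply: measurableT_comp => //; apply: measurableT_comp => //.
    by apply: measurable_funM => //; apply: measurable_funM => //; exact: measurable_funX.
  - by move=> x _; rewrite lee_fin mulr_ge0 ?sqr_ge0// mulr_ge0 ?expR_ge0.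
  - by rewrite lee_fin.
rewrite ge0_integralZl//; last 2 first.
- exact: measurable_half_line mfE fE0.
- by move=> w _; apply: integral_ge0 => x _; rewrite lee_fin.
rewrite (@tonelli_half_line _ _ _ P _ mfE fE0).
rewrite (@eq_integral_0y _ _ (fun x => (2^-1)%:E * ((x + 1) * expR (- x))%:E)); last first.
  move=> x x0.
  transitivity ((x ^+ 2)%:E * (expR (- x) * (1 + x) / (2 * x ^+ 2))%:E); last first.
    by rewrite -!EFinM; congr EFin; field; rewrite gt_eqF.
  rewrite -mom// -ge0_integralZl//.
  - apply: eq_integral => w _; rewrite -EFinM /f; congr EFin.
    rewrite (_ : x ^+ 2 / 2 * t w = t w * x ^+ 2 / 2)%R; last by field.
    by ring.
  - apply/measurable_EFinP; apply: measurable_funM => //; apply: measurable_funM => //.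
    apply: measurableT_comp => //; apply: measurableT_comp => //; exact: measurable_funM.
  - by move=> w _; rewrite lee_fin !mulr_ge0 ?expR_ge0.
  - by rewrite lee_fin sqr_ge0.
rewrite ge0_integralZl//.
- by rewrite integral_affine_expRN -!EFinM mulVf ?mulr1.
- apply: measurable_funTS; apply/measurable_EFinP; apply: measurable_funM.
    exact: measurable_funD.
  by apply: measurableT_comp => //; exact: measurableT_comp.
- move=> x; rewrite /= in_itv/= andbT => x0; rewrite lee_fin mulr_ge0 ?expR_ge0//.
  by rewrite addr_ge0.
Qed.

End laplace.

Lemma expectation_alpha (B : R -> T -> R) (U : T -> R) :
  standard_brownian P B -> uniform01 P U -> independent_of_process P U B ->
  'E_P[fun w => `|alpha B U w|%R] < +oo /\ 'E_P[alpha B U] = 0.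
Proof.
move=> hB hU hUB.
have [t' mt' ht'] := ae_measurable_hitting_time hB.
have [s' ms' hs'] := ae_measurable_hitting_sample hB hU.
(* Measurable versions of T_1 and [1 - B_(U T_1)], nonnegative at every sample point. Then [alpha]
   is almost surely [1 / sqrt t - y / sqrt t], and integrability follows from that of the two
   terms. *)
pose t w := `|t' w|%R; pose y w := `|1 - s' w|%R.
have mt : measurable_fun setT t by exact: measurableT_comp.
have my : measurable_fun setT y by apply: measurableT_comp => //; exact: measurable_funB.
have tE : {ae P, forall w, hitting_time1 B w = t w}.
  apply: filterS2 ht' (hitting_time_gt0_ae hB) => w e h.
  by rewrite /t -e ger0_norm// ltW.
have yE : {ae P, forall w, B (U w * hitting_time1 B w) w = 1 - y w}%R.
  apply: filterS2 hs' (hitting_sample_le1 hB hU) => w e h.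
  by rewrite /y -e ger0_norm ?subr_ge0// subKr.
have t0 w : (0 <= t w)%R by exact: normr_ge0.
have y0 w : (0 <= y w)%R by exact: normr_ge0.
have aet : {ae P, forall w, 0 < t w}%R.
  by apply: filterS2 tE (hitting_time_gt0_ae hB) => w ->.
pose a w := ((Num.sqrt (t w))^-1)%R; pose b w := (y w / Num.sqrt (t w))%R.
have Ia : \int[P]_w (a w)%:E = c%:E.
  apply: laplace_inv_sqrt => // theta theta0; rewrite -(hitting_time_laplace hB theta0).
  by apply: integral_ae_eq_any; apply: filterS tE => w ->.
have Ib : \int[P]_w (b w)%:E = c%:E.
  apply: laplace_moment_inv_sqrt => // theta theta0; apply: first_moment => // h h0.
  rewrite -(hitting_time_occupation hB hU hUB theta0 h0); congr (_ * _).
  apply: integral_ae_eq_any; apply: filterS2 tE yE => w -> ->.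
  by congr (_ * (_ * expR _))%:E; ring.
have a0 w : (0 <= a w)%R by rewrite invr_ge0.
have b0 w : (0 <= b w)%R by rewrite divr_ge0.
have ma : measurable_fun setT a by exact: (measurableT_comp (@measurable_inv_sqrt R) mt).
have mb : measurable_fun setT b by exact: measurable_funM.
have aE : {ae P, forall w, alpha B U w = a w - b w}%R.
  by apply: filterS2 tE yE => w e1 e2; rewrite /alpha e2 e1 /a /b mulrBl mul1r.
have fin (f : T -> R) : measurable_fun setT f -> (forall w, (0 <= f w)%R) -> \int[P]_w (f w)%:E = c%:E ->
    P.-integrable setT (EFin \o f).
  move=> mf f0 If; apply/integrableP; split; first exact/measurable_EFinP.
  under eq_integral do rewrite /= ger0_norm//.
  by rewrite If ltry.
split.
  rewrite unlock; apply: (@le_lt_trans _ _ (\int[P]_w ((a w)%:E + (b w)%:E))); last first.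
    rewrite ge0_integralD//; last 4 first.
    - by move=> w _; rewrite lee_fin.
    - exact/measurable_EFinP.
    - by move=> w _; rewrite lee_fin.
    - exact/measurable_EFinP.
    by rewrite Ia Ib -EFinD ltry.
  apply: ge0_ae_le_integral_any.
  - by move=> w; rewrite lee_fin.
  - by move=> w; rewrite -EFinD lee_fin addr_ge0.
  - apply: filterS aE => w ->; rewrite -EFinD lee_fin.
    by apply: (le_trans (ler_normB _ _)); rewrite !ger0_norm.
rewrite unlock (@integral_ae_eq_any _ _ _ _ _ (fun w => (a w)%:E - (b w)%:E)); last first.
  by apply: filterS aE => w ->; rewrite EFinB.
rewrite integralB//; last 2 first.
- exact: fin.
- exact: fin.
by rewrite Ia Ib subee.
Qed.

End expectation_of_alpha.

(** * The Bessel process *)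

Section rectangles.
Local Open Scope ereal_scope.
Context d1 d2 (T1 : measurableType d1) (T2 : measurableType d2) (R : realType).

Lemma finite_measure_rectangles (m1 m2 : {measure set (T1 * T2) -> \bar R}) :
  m1 setT < +oo ->
  (forall A B, measurable A -> measurable B -> m1 (A `*` B) = m2 (A `*` B)) ->
  forall X, measurable X -> m1 X = m2 X.
Proof.
move=> fin m12 X mX.
pose C : set (set (T1 * T2)) := [set A `*` B | A in measurable & B in measurable].
apply: (measure_unique C (fun=> setT)) => //.
- by rewrite measurable_prod_measurableType.
- move=> _ _ [A1 mA1 [B1 mB1 <-]] [A2 mA2 [B2 mB2 <-]]; rewrite -setXI.
  by exists (A1 `&` A2); [exact: measurableI|exists (B1 `&` B2) => //; exact: measurableI].
- by move=> n; exists setT => //; exists setT => //; rewrite setXTT.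
- by rewrite bigcup_const.
- by move=> _ [A mA [B mB <-]]; exact: m12.
Qed.

End rectangles.

Section independent_triple.
Local Open Scope ereal_scope.
Context d (T : measurableType d) (R : realType) (P : probability T R).

(** Independence of three preimages is first upgraded to independence of [f i0] from the pair
    [(f i1, f i2)], hence from their product; the rule for two factors is then used twice. *)
Lemma indep_integral_mul3 (f : 'I_3 -> T -> R) :
  (forall i, measurable_fun setT (f i)) -> (forall i w, (0 <= f i w)%R) ->
  (forall A : 'I_3 -> set R, (forall i, measurable (A i)) ->
    P (\bigcap_i (f i @^-1` A i)) = \prod_(i < 3) P (f i @^-1` A i)) ->
  \int[P]_w (\prod_(i < 3) f i w)%:E = \prod_(i < 3) \int[P]_w (f i w)%:E.
Proof.
move=> mf f0 ind.
pose i0 : 'I_3 := ord0; pose i1 : 'I_3 := lift ord0 ord0.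
pose i2 : 'I_3 := lift ord0 (lift ord0 ord0).
have ind3 A0 A1 A2 : measurable A0 -> measurable A1 -> measurable A2 ->
    P (f i0 @^-1` A0 `&` (f i1 @^-1` A1 `&` f i2 @^-1` A2)) =
    P (f i0 @^-1` A0) * (P (f i1 @^-1` A1) * P (f i2 @^-1` A2)).
  move=> m0 m1 m2.
  pose A (i : 'I_3) := if i == i0 then A0 else if i == i1 then A1 else A2.
  have := ind A; rewrite !big_ord_recl big_ord0 /A/= mule1 => <-; last first.
    by move=> i; case: ifP => // _; case: ifP.
  congr (P _); apply/seteqP; split => w /=.
    move=> [h0 [h1 h2]] i _ /=; case: ifP => [/eqP -> //|n0]; case: ifP => [/eqP -> //|n1].
    rewrite (_ : i = i2)//; apply/val_inj; move: n0 n1.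
    by case: i => -[|[|[|//]]] ? //=.
  move=> h; split; first exact: (h i0 I).
  by split; [exact: (h i1 I)|exact: (h i2 I)].
have P1 : P setT = 1 := probability_setT P.
have ind12 A1 A2 : measurable A1 -> measurable A2 ->
    P (f i1 @^-1` A1 `&` f i2 @^-1` A2) = P (f i1 @^-1` A1) * P (f i2 @^-1` A2).
  move=> m1 m2; have := ind3 setT A1 A2 measurableT m1 m2.
  by rewrite preimage_setT setTI P1 mul1e.
have mfA i A : measurable A -> measurable (f i @^-1` A).
  by move=> mA; rewrite -[X in measurable X]setTI; exact: mf.
pose g w := (f i1 w, f i2 w).
have mg : measurable_fun setT g by exact: measurable_fun_pair.
have mgA M : measurable M -> measurable (g @^-1` M).
  by move=> mM; rewrite -[X in measurable X]setTI; exact: mg.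
have ind0 A M : measurable A -> measurable M ->
    P (f i0 @^-1` A `&` g @^-1` M) = P (f i0 @^-1` A) * P (g @^-1` M).
  move=> mA mM.
  pose G : {mfun T >-> (R * R)%type} := HB.pack g (isMeasurableFun.Build _ _ _ _ _ mg).
  have PA : P (f i0 @^-1` A) \is a fin_num by apply: fin_num_measure; exact: mfA.
  pose k := NngNum (fine_ge0 (measure_ge0 P (f i0 @^-1` A))).
  (* For fixed [A], both sides are finite measures in [M], so it suffices to compare them on
     rectangles. *)
  pose m1 := pushforward (mrestr P (mfA i0 A mA)) G.
  pose m2 := mscale k (distribution P G).
  have m1E N : m1 N = P (g @^-1` N `&` f i0 @^-1` A) by [].
  have m2E N : m2 N = P (f i0 @^-1` A) * P (g @^-1` N) by rewrite /m2/= /mscale/= fineK.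
  rewrite setIC -m1E -m2E; apply: (@finite_measure_rectangles _ _ _ _ R m1 m2) => //.
    by rewrite [X in X < _]m1E preimage_setT setTI ltey_eq PA.
  move=> A1 A2 mA1 mA2; rewrite [LHS]m1E [RHS]m2E setIC.
  rewrite (_ : g @^-1` (A1 `*` A2) = f i1 @^-1` A1 `&` f i2 @^-1` A2)//.
  by rewrite ind3// ind12.
transitivity (\int[P]_w (f i0 w * (f i1 w * f i2 w))%:E).
  by apply: eq_integral => w _; rewrite !big_ord_recl big_ord0 mulr1.
rewrite !big_ord_recl big_ord0 mule1 (_ : lift i0 (lift ord0 ord0) = i2)//.
rewrite -(@indep_integral_mul _ _ _ P (f i1) (f i2))//.
rewrite (@indep_integral_mul _ _ _ P (f i0) (fun w => f i1 w * f i2 w)%R)//.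
- exact: measurable_funM.
- by move=> w; rewrite mulr_ge0.
move=> A C mA mC; apply: (ind0 A ((fun z : R * R => z.1 * z.2)%R @^-1` C)) => //.
rewrite -[X in measurable X]setTI.
have mp : measurable_fun setT (fun z : R * R => (z.1 * z.2)%R).
  by apply: measurable_funM; [exact: measurable_fst|exact: measurable_snd].
exact: mp.
Qed.

End independent_triple.

(** * Gaussian functionals at two times *)

Section brownian_two_times.
Local Open Scope ereal_scope.
Context d (T : measurableType d) (R : realType) (P : probability T R).
Variable B : R -> T -> R.
Hypothesis hB : standard_brownian P B.

Lemma brownian_quadratic1 (v a : R) : (0 < v)%R -> (0 <= a)%R ->
  \int[P]_w (expR (- (a * B v w ^+ 2) / 2))%:E = ((Num.sqrt (1 + a * v))^-1)%:E.
Proof.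
move=> v0 a0.
pose h (x : R) := (expR (- (a * x ^+ 2) / 2))%:E.
have mh : measurable_fun setT h.
  apply/measurable_EFinP; apply: measurableT_comp => //; apply: measurable_funM => //.
  by apply: measurableT_comp => //; apply: measurable_funM => //; exact: measurable_funX.
transitivity (\int[P]_w h (B v w - B 0 w)%R).
  case: hB => _ B0 _ _; apply: integral_ae_eq_any.
  by apply: filterS B0 => w ->; rewrite subr0.
rewrite (brownian_increment hB)//; last by move=> x; rewrite lee_fin expR_ge0.
have := @normal_prob_quadratic R (Num.sqrt (v - 0)) a 0 _ a0.
rewrite sqrtr_gt0 subr0 => /(_ v0).
rewrite expr0n/= mul0r mul0r expR0 sqr_sqrtr ?ltW// div1r => <-.
by apply: eq_integral => x _; rewrite mul0r addr0.
Qed.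

(** The increment after [v] is integrated first, with [B v] frozen: completing the square leaves a
    Gaussian function of [B v] with coefficient [a + b / q], where [q = 1 + b (1 - v)]. *)
Lemma brownian_quadratic2 (v a b : R) : (0 < v)%R -> (v < 1)%R -> (0 <= a)%R -> (0 <= b)%R ->
  \int[P]_w (expR (- (a * B v w ^+ 2 + b * B 1 w ^+ 2) / 2))%:E =
  ((Num.sqrt (1 + b + a * v * (1 + b * (1 - v))))^-1)%:E.
Proof.
move=> v0 v1 a0 b0.
pose phi (z : R * R) := (expR (- (a * z.1 ^+ 2 + b * (z.1 + z.2) ^+ 2) / 2))%:E.
have mphi : measurable_fun setT phi.
  apply/measurable_EFinP; apply: measurableT_comp => //; apply: measurable_funM => //.
  apply: measurableT_comp => //; apply: measurable_funD; apply: measurable_funM => //;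
    apply: measurable_funX; first exact: measurable_fst.
  by apply: measurable_funD; [exact: measurable_fst|exact: measurable_snd].
have mBv : measurable_fun setT (B v) by apply: (brownian_measurable hB); rewrite ltW.
have mB1 : measurable_fun setT (B 1%R) by exact: (brownian_measurable hB).
have mD : measurable_fun setT (B 1 \- B v)%R by exact: measurable_funB.
pose q := (1 + b * (1 - v))%R.
have q1v : (0 < 1 - v)%R by rewrite subr_gt0.
have q0 : (0 < q)%R by rewrite /q ltr_wpDr// mulr_ge0// ltW.
transitivity (\int[P]_w phi (B v w, (B 1 \- B v) w)%R).
  by apply: eq_integral => w _; rewrite /phi/= addrC (addrC (B v w)) subrK addrC.
rewrite (@indep_integral_pair _ _ _ _ _ _ _ P (B v) (B 1 \- B v)%R phi)//; last 2 first.
- by move=> z; rewrite lee_fin expR_ge0.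
- move=> A C mA mC; rewrite setIC muleC.
  have [_ _ _ /(_ v 1%R (ltW v0) v1)] := hB; apply; first by exists C => //; rewrite setTI.
  have vI : [set` `[0%R, v]] v by rewrite /= in_itv/= lexx (ltW v0).
  rewrite -[B v @^-1` A]setTI.
  exact: (history_eval (X := B) vI measurableT mA).
transitivity (\int[P]_w ((Num.sqrt q)^-1%:E * (expR (- ((a + b / q) * B v w ^+ 2) / 2))%:E)).
  apply: eq_integral => w _; set x := B v w.
  have mphix : measurable_fun setT (fun y => phi (x, y)).
    by apply: measurableT_comp => //; exact: measurable_pair1.
  rewrite (@brownian_increment _ _ _ _ _ hB v 1%R (fun y => phi (x, y)) (ltW v0) v1 mphix); last first.
    by move=> y; rewrite lee_fin expR_ge0.
  transitivity (\int[normal_prob 0 (Num.sqrt (1 - v))]_y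
      ((expR (- ((a + b) * x ^+ 2) / 2))%:E * (expR (- (b * y ^+ 2) / 2 + (- (b * x)) * y))%:E)).
    apply: eq_integral => y _; rewrite /phi/= -EFinM -expRD; congr (expR _)%:E.
    by field.
  have mE : measurable_fun setT
      (fun y : R => (expR (- (b * y ^+ 2) / 2 + (- (b * x)) * y))%:E).
    apply/measurable_EFinP; apply: measurableT_comp => //; apply: measurable_funD.
      apply: measurable_funM => //; apply: measurableT_comp => //.
      by apply: measurable_funM => //; exact: measurable_funX.
    exact: measurable_funM.
  rewrite ge0_integralZl//.
  rewrite normal_prob_quadratic ?sqrtr_gt0// sqr_sqrtr ?ltW// -/q.
  rewrite -!EFinM mulrCA mulrA -expRD mulrC -mulrA; congr (_ * _)%:E.
  by congr expR; rewrite /q; field; rewrite ?gt_eqF.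
rewrite ge0_integralZl//; last first.
  apply/measurable_EFinP; apply: measurableT_comp => //; apply: measurable_funM => //.
  by apply: measurableT_comp => //; apply: measurable_funM => //; exact: measurable_funX.
rewrite brownian_quadratic1//; last by rewrite addr_ge0// divr_ge0// ltW.
rewrite -EFinM -invfM -sqrtrM ?ltW//; congr ((Num.sqrt _)^-1)%:E.
by rewrite /q; field; rewrite ?gt_eqF.
Qed.

End brownian_two_times.

Section same_law_transfer.
Local Open Scope ereal_scope.
Context d d' (T : measurableType d) (T' : measurableType d') (R : realType).
Context (P : probability T R) (P' : probability T' R).

Lemma coordinate_measurable (t : R) : (0 <= t)%R ->
  measurable_fun setT ((fun f : R -> R => f t) : history (fun (t : R) (f : R -> R) => f t) `[0%R, +oo[ -> R).
Proof.
move=> t0 _ A mA; rewrite setTI; apply: sub_sigma_algebra; exists t.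
  by rewrite /= in_itv/= t0.
by exists A => //; rewrite setTI.
Qed.

Lemma same_law_integral (X : R -> T -> R) (Y : R -> T' -> R) (h : R * R -> \bar R) (s t : R) :
  same_law P P' X Y ->
  measurable_fun setT (X s) -> measurable_fun setT (X t) ->
  measurable_fun setT (Y s) -> measurable_fun setT (Y t) ->
  (0 <= s)%R -> (0 <= t)%R -> measurable_fun setT h -> (forall z, 0 <= h z) ->
  \int[P]_w h (X s w, X t w) = \int[P']_w h (Y s w, Y t w).
Proof.
move=> XY mXs mXt mYs mYt s0 t0 mh h0.
have mF : measurable_fun setT (fun w => (X s w, X t w)) by exact: measurable_fun_pair.
have mG : measurable_fun setT (fun w => (Y s w, Y t w)) by exact: measurable_fun_pair.
pose F : {mfun T >-> (R * R)%type} :=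
  HB.pack (fun w => (X s w, X t w)) (isMeasurableFun.Build _ _ _ _ _ mF).
pose G : {mfun T' >-> (R * R)%type} :=
  HB.pack (fun w => (Y s w, Y t w)) (isMeasurableFun.Build _ _ _ _ _ mG).
transitivity (\int[distribution P F]_z h z).
  by rewrite ge0_integral_distribution.
transitivity (\int[distribution P' G]_z h z); last first.
  by rewrite ge0_integral_distribution.
apply: eq_measure_integral => M mM _.
have := XY [set f | M (f s, f t)]; apply.
have mp := measurable_fun_pair (coordinate_measurable s0) (coordinate_measurable t0).
by have := mp measurableT M mM; rewrite setTI.
Qed.

End same_law_transfer.

Section bessel_laplace.
Local Open Scope ereal_scope.
Context d (T : measurableType d) (R : realType) (P : probability T R).
Variable X : R -> T -> R.
Hypothesis hX : bessel3 P X.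

Lemma bessel_measurable (t : R) : (0 <= t)%R -> measurable_fun setT (X t).
Proof. by case: hX => -[mX _] _ t0; exact: mX. Qed.

Lemma euclidean_norm3_measurable d' (T' : measurableType d') (P' : probability T' R)
    (W : 'I_3 -> R -> T' -> R) (t : R) :
  standard_brownian3 P' W -> (0 <= t)%R -> measurable_fun setT (euclidean_norm3 W t).
Proof.
move=> [hW _] t0; apply: measurableT_comp.
  by apply: continuous_measurable_fun; exact: sqrt_continuous.
apply: measurable_sum => i; apply: measurable_funX; exact: (brownian_measurable (hW i)).
Qed.

(** [bessel3] prescribes a law, so the sign of the norm transfers almost surely, one time after
    another. *)
Lemma bessel_ge0 (t : R) : (0 <= t)%R -> {ae P, forall w, (0 <= X t w)%R}.
Proof.
move=> t0; case: (hX) => _ [d' [T' [P' [W [hW XW]]]]].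
have mYt := euclidean_norm3_measurable hW t0.
pose h (z : R * R) := (\1_`]-oo, 0%R[%classic z.1 : R)%:E.
have mI : measurable_fun setT (\1_`]-oo, 0%R[%classic : R -> R).
  exact: measurable_indic.
have mh : measurable_fun setT h.
  by apply/measurable_EFinP; apply: measurableT_comp => //; exact: measurable_fst.
have h0 z : 0 <= h z by rewrite /h indicE lee_fin.
have mXt := bessel_measurable t0.
have := same_law_integral XW mXt mXt mYt mYt t0 t0 mh h0.
rewrite [RHS]integral0_eq; last first.
  move=> w _; rewrite /h indicE/= memNset//= in_itv/=.
  by apply/negP; rewrite -leNgt sqrtr_ge0.
move=> I0.
have mhX : measurable_fun setT (fun w => h (X t w, X t w)).
  by apply: measurableT_comp mh _; exact: measurable_fun_pair.
have : \int[P]_w `|h (X t w, X t w)| = 0.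
  by rewrite -[RHS]I0; apply: eq_integral => w _; rewrite gee0_abs.
move=> /(ae_eq_integral_abs P measurableT mhX); apply: filterS => w /= /(_ I).
rewrite /h indicE/= => -[] /eqP; rewrite pnatr_eq0 eqb0 => /negP.
by rewrite inE/= in_itv/= => /negP; rewrite -leNgt.
Qed.

Lemma bessel_laplace (v a b : R) : (0 < v)%R -> (v < 1)%R -> (0 <= a)%R -> (0 <= b)%R ->
  \int[P]_w (expR (- (a * X v w ^+ 2 + b * X 1 w ^+ 2) / 2))%:E =
  ((Num.sqrt (1 + b + a * v * (1 + b * (1 - v))) ^- 3)%R)%:E.
Proof.
move=> v0 v1 a0 b0; case: (hX) => _ [d' [T' [P' [W [hW XW]]]]].
pose h (z : R * R) := (expR (- (a * z.1 ^+ 2 + b * z.2 ^+ 2) / 2))%:E.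
have mh : measurable_fun setT h.
  apply/measurable_EFinP; apply: measurableT_comp => //; apply: measurable_funM => //.
  apply: measurableT_comp => //; apply: measurable_funD; apply: measurable_funM => //;
    apply: measurable_funX; [exact: measurable_fst|exact: measurable_snd].
have h0 z : 0 <= h z by rewrite lee_fin expR_ge0.
have mY t (t0 : (0 <= t)%R) := euclidean_norm3_measurable hW t0.
have mX t (t0 : (0 <= t)%R) := bessel_measurable t0.
have vge0 := ltW v0.
rewrite (same_law_integral XW (mX _ vge0) (mX _ ler01) (mY _ vge0) (mY _ ler01) vge0 ler01 mh h0).
pose f i w := expR (- (a * W i v w ^+ 2 + b * W i 1%R w ^+ 2) / 2).
transitivity (\int[P']_w (\prod_(i < 3) f i w)%:E).
  apply: eq_integral => w _; rewrite /h/= -expR_sum; congr (expR _)%:E.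
  rewrite /euclidean_norm3 !sqr_sqrtr; last 2 first.
  - by apply: sumr_ge0 => i _; rewrite sqr_ge0.
  - by apply: sumr_ge0 => i _; rewrite sqr_ge0.
  by rewrite !mulr_sumr -big_split/= -sumrN mulr_suml.
have mfh i : measurable_fun setT (f i : history (W i) `[0%R, +oo[ -> R).
  have mW t : (0 <= t)%R -> measurable_fun setT (W i t : history (W i) `[0%R, +oo[ -> R).
    by move=> t0; apply: history_eval; rewrite /= in_itv/= t0.
  apply: measurableT_comp => //; apply: measurable_funM => //.
  apply: measurableT_comp => //; apply: measurable_funD; apply: measurable_funM => //;
    apply: measurable_funX; apply: mW => //.
case: hW => hW iW.
rewrite indep_integral_mul3.
- under eq_bigr do rewrite (brownian_quadratic2 (hW _))//.
  by rewrite !big_ord_recl big_ord0 mule1 -!EFinM; congr EFin; rewrite -exprVn; ring.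
- move=> i; apply: history_measurable (mfh i) => t; rewrite /= in_itv/= andbT => t0.
  exact: (brownian_measurable (hW i)).
- by move=> i w; rewrite expR_ge0.
- move=> A mA; apply: iW => i.
  by rewrite -[_ @^-1` _]setTI; exact: mfh.
Qed.

End bessel_laplace.

(** * Evaluation at an independent uniform time *)

Section uniform_time.
Local Open Scope ereal_scope.
Context d (T : measurableType d) (R : realType) (P : probability T R).
Variables (X : R -> T -> R) (U : T -> R).
Hypothesis mX : forall t, (0 <= t)%R -> measurable_fun setT (X t).
Hypothesis hU : uniform01 P U.
Hypothesis hUX : independent_of_process P U X.

Let grid (n : nat) w : R := ((sample_index U n.+1 w)%:R / n.+1%:R)%R.

Let grid_itv n w : (0 <= U w < 1)%R -> (0 <= grid n w < 1)%R.
Proof.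
move=> Uw; rewrite divr_ge0//= ltr_pdivrMr ?ltr0n// mul1r ltr_nat.
exact: sample_index_lt.
Qed.

Lemma cvg_sample_time w : (0 <= U w < 1)%R ->
  (fun n => (sample_index U n.+1 w)%:R / n.+1%:R)%R @ \oo --> U w.
Proof.
move=> /andP[U0 _]; apply: (squeeze_cvgr (f := fun n => (U w - n.+1%:R^-1)%R) (h := fun=> U w)).
- apply: nearW => n; have n0 : (0 < n.+1%:R :> R)%R by rewrite ltr0n.
  have /truncn_itv/andP[h1 h2] : (0 <= U w * n.+1%:R)%R by rewrite mulr_ge0.
  rewrite ler_pdivrMr// h1 andbT ler_pdivlMr// mulrBl mulVf ?gt_eqF//.
  by rewrite lerBlDr natr1 ltW.
- rewrite -[X in _ --> X]subr0; apply: cvgB; first exact: cvg_cst.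
  exact: cvg_harmonic.
- exact: cvg_cst.
Qed.

Section sampled.
Variable g : R -> T -> R.
Hypothesis mg : forall t, (0 <= t < 1)%R ->
  measurable_fun setT (g t : history X `[0%R, +oo[ -> R).

Let mg' t : (0 <= t < 1)%R -> measurable_fun setT (g t).
Proof.
move=> t01; apply: history_measurable (mg t01) => s.
by rewrite /= in_itv/= andbT; exact: mX.
Qed.

Let ord_itv n (j : 'I_n) : (0 <= (j%:R / n%:R : R) < 1)%R.
Proof.
have n0 := leq_ltn_trans (leq0n _) (ltn_ord j).
by rewrite divr_ge0//= ltr_pdivrMr ?ltr0n// mul1r ltr_nat.
Qed.

Let ae_measurable_grid n : ae_measurable P (fun w => g (grid n w) w).
Proof.
exists (fun w => \sum_(j < n.+1)
  \1_`[(j%:R / n.+1%:R)%R, (j.+1%:R / n.+1%:R)%R[ (U w) * g (j%:R / n.+1%:R) w)%R.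
  apply: measurable_sum => j; apply: measurable_funM; last exact/mg'/ord_itv.
  by apply: measurableT_comp; [exact: measurable_indic|case: hU].
apply: filterS (ae_uniform01 hU) => w Uw.
have ln := sample_index_lt Uw (ltn0Sn n).
rewrite (bigD1 (Ordinal ln))//= big1 ?addr0; last first.
  move=> j jn; rewrite indicE.
  rewrite (_ : (_ \in _) = false) ?mul0r//; apply: contraNF jn; rewrite inE => h.
  by apply/eqP/val_inj => /=; apply/esym/eqP; rewrite sample_index_eq.
rewrite indicE mem_set ?mul1r//=.
by rewrite -sample_index_eq.
Qed.

Hypothesis cg : {ae P, forall w, forall u : nat -> R, (forall n, 0 <= u n < 1)%R ->
  (0 <= U w < 1)%R -> u @ \oo --> U w -> (fun n => g (u n) w) @ \oo --> g (U w) w}.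

Let cgg : {ae P, forall w, (fun n => g (grid n w) w) @ \oo --> g (U w) w}.
Proof.
apply: filterS2 cg (ae_uniform01 hU) => w h Uw; apply: h => //.
  by move=> n; exact: grid_itv.
exact: cvg_sample_time.
Qed.

Lemma ae_measurable_uniform_time : ae_measurable P (fun w => g (U w) w).
Proof. exact: cvg_ae_measurable ae_measurable_grid cgg. Qed.

Lemma uniform_time_bounded (C : R) :
  (forall t w, (0 <= t < 1)%R -> (`|g t w| <= C)%R) ->
  \int[P]_w (g (grid n w) w)%:E @[n --> \oo] --> \int[P]_w (g (U w) w)%:E.
Proof.
move=> gC; have [|//] := ae_bounded_convergence (C := C) ae_measurable_grid _ cgg.
by move=> n; apply: filterS (ae_uniform01 hU) => w Uw; apply: gC; exact: grid_itv.
Qed.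

Lemma uniform_time_sampleE n : (forall t w, (0 <= g t w)%R) ->
  \int[P]_w (g (grid n w) w)%:E =
  \sum_(j < n.+1) (n.+1%:R^-1)%:E * \int[P]_w (g (j%:R / n.+1%:R) w)%:E.
Proof.
move=> g0.
pose c (N j : nat) w := (N%:R^-1 * g (j%:R / N%:R) w)%R.
have n0 : (0 < n.+1%:R^-1 :> R)%R by rewrite invr_gt0 ltr0n.
transitivity (\int[P]_w (n.+1%:R * c n.+1 (sample_index U n.+1 w) w)%:E).
  by apply: eq_integral => w _; rewrite /c mulrA mulfV ?mul1r// pnatr_eq0.
have c0 N j w : (0 <= c N j w)%R by rewrite mulr_ge0.
have mc N j : (j < N)%N -> measurable_fun setT (c N j : history X `[0%R, +oo[ -> R).
  by move=> jN; apply: measurable_funM => //; exact: mg (ord_itv (Ordinal jN)).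
rewrite (uniform_sampling mX hU hUX (m := n.+1) (N := fun=> n.+1))//.
under eq_integral do rewrite -sumEFin.
rewrite ge0_integral_sum//.
- apply: eq_bigr => j _; rewrite -ge0_integralZl//.
  + by apply/measurable_EFinP; exact/mg'/ord_itv.
  + by move=> w _; rewrite lee_fin.
- move=> j; apply/measurable_EFinP; apply: measurable_funM => //; exact/mg'/ord_itv.
- by move=> j w _; rewrite lee_fin.
- move=> m; rewrite (_ : \1_ _ = cst ((n.+1 == m)%:R : R))//.
  by apply/funext => w; rewrite indicE/=; congr (nat_of_bool _)%:R; apply/idP/eqP; rewrite inE.
Qed.

End sampled.

(** At a grid approximation of [U] both expectations are the same Riemann sum of expectations at
    fixed times, and continuity in time with the bound [C] gives the limit. This replaces Fubini in
    [(t, w)], which would need joint measurability. *)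
Lemma uniform_time_integral (g h : R -> T -> R) (C : R) :
  (forall t, (0 <= t < 1)%R -> measurable_fun setT (g t : history X `[0%R, +oo[ -> R)) ->
  (forall t, (0 <= t < 1)%R -> measurable_fun setT (h t : history X `[0%R, +oo[ -> R)) ->
  (forall t w, (0 <= g t w)%R) -> (forall t w, (0 <= h t w)%R) ->
  (forall t w, (0 <= t < 1)%R -> (`|g t w| <= C)%R) ->
  (forall t w, (0 <= t < 1)%R -> (`|h t w| <= C)%R) ->
  {ae P, forall w, forall u : nat -> R, (forall n, 0 <= u n < 1)%R -> (0 <= U w < 1)%R ->
     u @ \oo --> U w -> (fun n => g (u n) w) @ \oo --> g (U w) w} ->
  {ae P, forall w, forall u : nat -> R, (forall n, 0 <= u n < 1)%R -> (0 <= U w < 1)%R ->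
     u @ \oo --> U w -> (fun n => h (u n) w) @ \oo --> h (U w) w} ->
  (forall t, (0 <= t < 1)%R -> \int[P]_w (g t w)%:E = \int[P]_w (h t w)%:E) ->
  \int[P]_w (g (U w) w)%:E = \int[P]_w (h (U w) w)%:E.
Proof.
move=> mg mh g0 h0 gC hC cg ch gh.
have c1 := uniform_time_bounded mg cg gC.
have c2 := uniform_time_bounded mh ch hC.
apply: (cvg_unique _ c1); rewrite //.
rewrite (_ : (fun n => _) = (fun n => \int[P]_w (h (grid n w) w)%:E))//.
apply/funext => n; rewrite !uniform_time_sampleE//.
apply: eq_bigr => j _; congr (_ * _); apply: gh.
by rewrite divr_ge0//= ltr_pdivrMr ?ltr0n// mul1r ltr_nat.
Qed.

End uniform_time.

Section bessel_uniform_time.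
Local Open Scope ereal_scope.
Context d (T : measurableType d) (R : realType) (P : probability T R).
Variables (X : R -> T -> R) (V : T -> R).
Hypothesis hX : bessel3 P X.
Hypothesis hV : uniform01 P V.
Hypothesis hVX : independent_of_process P V X.

Let mX t : (0 <= t)%R -> measurable_fun setT (X t). Proof. exact: (bessel_measurable hX). Qed.

Let mXh t : (0 <= t)%R -> measurable_fun setT (X t : history X `[0%R, +oo[ -> R).
Proof. by move=> t0; apply: history_eval; rewrite /= in_itv/= t0. Qed.

Let cX : {ae P, forall w, forall u : nat -> R, (forall n, 0 <= u n < 1)%R -> (0 <= V w < 1)%R ->
     u @ \oo --> V w -> (fun n => X (u n) w) @ \oo --> X (V w) w}.
Proof.
case: hX => -[_ cX] _; apply: filterS cX => w cw u u01 /andP[V0 _] uV.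
by apply: (path_cvg cw) => // n; have /andP[] := u01 n.
Qed.

(** The absolute value keeps the integrands nonnegative at all times and sample points, whereas [V]
    lies in the unit interval only almost surely. *)
Lemma bessel_uniform_laplace (a b : R) : (0 <= a)%R -> (0 <= b)%R ->
  \int[P]_w (`|V w| * expR (- (a * X (V w) w ^+ 2 + b * X 1 w ^+ 2) / 2))%:E =
  \int[P]_w (`|V w| * Num.sqrt (1 + b + a * V w * (1 + b * (1 - V w))) ^- 3)%:E.
Proof.
move=> a0 b0.
pose D (t : R) := (1 + b + a * t * (1 + b * (1 - t)))%R.
have D1 t : (0 <= t < 1)%R -> (1 <= D t)%R.
  move=> /andP[t0 t1]; rewrite /D -addrA lerDl addr_ge0// mulr_ge0 ?mulr_ge0//.
  by rewrite addr_ge0// mulr_ge0// subr_ge0 ltW.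
pose g t w := (`|t| * expR (- (a * X t w ^+ 2 + b * X 1 w ^+ 2) / 2))%R.
pose h (t : R) (w : T) := (`|t| * Num.sqrt (D t) ^- 3)%R.
have t1 t : (0 <= t < 1)%R -> (`|t| <= 1)%R.
  by move=> /andP[t0 /ltW]; rewrite ger0_norm.
apply: (@uniform_time_integral _ _ _ _ _ _ mX hV hVX g h 1%R).
- move=> t /andP[t0 _]; apply: measurable_funM => //; apply: measurableT_comp => //.
  apply: measurable_funM => //; apply: measurableT_comp => //.
  by apply: measurable_funD; apply: measurable_funM => //; apply: measurable_funX; exact: mXh.
- by move=> t _; exact: measurable_cst.
- by move=> t w; rewrite mulr_ge0// expR_ge0.
- by move=> t w; rewrite mulr_ge0// invr_ge0 exprn_ge0.
- move=> t w /t1 tt; rewrite ger0_norm ?mulr_ge0 ?expR_ge0// -[leRHS]mulr1.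
  apply: ler_pM => //.
  rewrite -[leRHS]expR0 ler_expR mulNr oppr_le0 divr_ge0//.
  by rewrite addr_ge0// mulr_ge0 ?sqr_ge0.
- move=> t w tt; rewrite ger0_norm ?mulr_ge0 ?invr_ge0 ?exprn_ge0// -[leRHS]mulr1.
  apply: ler_pM => //; first exact: t1.
  rewrite invf_le1 ?exprn_gt0 ?sqrtr_gt0 ?(lt_le_trans ltr01)//; do ?exact: D1.
  by rewrite exprn_ege1// -[leLHS]sqrtr1 ler_wsqrtr// D1.
- apply: filterS cX => w cw u u01 V01 uV; have := cw u u01 V01 uV => cu.
  apply: cvgM; first by apply: cvg_norm.
  apply: continuous_cvg; first exact: continuous_expR.
  apply: cvgM; last exact: cvg_cst.
  apply: cvgN; apply: cvgD; last exact: cvg_cst.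
  by apply: cvgM; [exact: cvg_cst|rewrite expr2; under eq_fun do rewrite expr2; exact: cvgM].
- apply: aeW => w u u01 V01 uV.
  have cD : D \o u @ \oo --> D (V w).
    apply: cvgD; first exact: cvg_cst.
    apply: cvgM; first by apply: cvgM; [exact: cvg_cst|exact: uV].
    apply: cvgD; first exact: cvg_cst.
    by apply: cvgM; [exact: cvg_cst|apply: cvgB; [exact: cvg_cst|exact: uV]].
  have cs : (fun n => Num.sqrt (D (u n))) @ \oo --> Num.sqrt (D (V w)).
    by apply: (@cvg_comp _ _ _ (D \o u) Num.sqrt _ _ _ cD); exact: sqrt_continuous.
  apply: cvgM; first by apply: cvg_norm.
  apply: cvgV; first by rewrite expf_neq0// gt_eqF// sqrtr_gt0 (lt_le_trans ltr01)// D1.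
  rewrite (_ : (fun n => _) = (fun n => Num.sqrt (D (u n)) * (Num.sqrt (D (u n)) * Num.sqrt (D (u n))))%R).
    by apply: (cvgM cs); exact: cvgM.
  by apply/funext => n; rewrite -!expr2 -exprS.
move=> t /andP[t0 tl1]; rewrite /g /h.
under eq_integral do rewrite EFinM; under [RHS]eq_integral do rewrite EFinM.
rewrite !ge0_integralZl//; last first.
  apply/measurable_EFinP; apply: measurableT_comp => //; apply: measurable_funM => //.
  apply: measurableT_comp => //.
  by apply: measurable_funD; apply: measurable_funM => //; apply: measurable_funX; exact: mX.
(* [bessel_laplace] asks for a positive time; at time 0 the factor [t] annihilates both sides. *)
have [->|tn] := eqVneq t 0%R; first by rewrite normr0 !mul0e.
congr (_ * _); rewrite integral_cst// [X in _ * X](_ : _ = 1) ?mule1; last exact: probability_setT.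
by apply: bessel_laplace => //; rewrite lt_neqAle eq_sym tn.
Qed.

Lemma ae_measurable_bessel_uniform : ae_measurable P (fun w => X (V w) w).
Proof.
apply: (ae_measurable_uniform_time mX hV (g := X)) => // t /andP[t0 _].
exact: mXh.
Qed.

(** Outside one null set the sign is right at all the times [j / n.+1], and path continuity carries
    it to the random time. *)
Lemma bessel_uniform_ge0 : {ae P, forall w, (0 <= X (V w) w)%R}.
Proof.
have Xge0 : {ae P, forall w, forall n (j : nat), (0 <= X (j%:R / n.+1%:R) w)%R}.
  by apply: ae_nat => n; apply: ae_nat => j; apply: (bessel_ge0 hX); rewrite divr_ge0.
case: hX => -[_ cX'] _; apply: filterS3 Xge0 cX' (ae_uniform01 hV) => w X0 cw /[dup] Vw /andP[V0 _].
have u0 (n : nat) : (0 <= (sample_index V n.+1 w)%:R / n.+1%:R :> R)%R by rewrite divr_ge0.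
have c := path_cvg cw u0 V0 (cvg_sample_time Vw).
rewrite -(cvg_lim _ c)//; apply: limr_ge; first exact: cvgP c.
by apply: nearW => n; exact: X0.
Qed.

End bessel_uniform_time.

(** * The integrals that lead to artanh *)

Section half_line_calculus.
Local Open Scope ereal_scope.
Context {R : realType}.
Local Notation mu := (@lebesgue_measure R).

Let is_derive_sqrt_quadratic (a k x : R) : (0 < a)%R -> (0 <= k)%R ->
  is_derive x 1%R (fun z => Num.sqrt (a + k * z ^+ 2)) (k * x / Num.sqrt (a + k * x ^+ 2))%R.
Proof.
move=> a0 k0.
have q0 : (0 < a + k * x ^+ 2)%R by rewrite ltr_pwDl// mulr_ge0// sqr_ge0.
have dq : is_derive x 1%R (fun z : R => a + k * z ^+ 2)%R (k * (2 * x))%R.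
  by apply: is_derive_eq; rewrite /GRing.scale/=; ring.
have d := @is_derive1_comp R Num.sqrt (fun z : R => a + k * z ^+ 2)%R x _ _ (is_derive1_sqrt q0) dq.
apply: (is_derive_congr d) => //.
by rewrite /GRing.scale/=; field; rewrite gt_eqF// sqrtr_gt0.
Qed.


Let sqrt_quadratic_gt0 (a k x : R) : (0 < a)%R -> (0 <= k)%R -> (0 < Num.sqrt (a + k * x ^+ 2))%R.
Proof. by move=> a0 k0; rewrite sqrtr_gt0 ltr_pwDl// mulr_ge0// sqr_ge0. Qed.

Let continuous_sqrt_quadratic (a k x : R) : (0 < a)%R -> (0 <= k)%R ->
  {for x, continuous (fun z : R => Num.sqrt (a + k * z ^+ 2))}.
Proof.
move=> a0 k0; apply: differentiable_continuous.
by apply/derivable1_diffP; have [] := is_derive_sqrt_quadratic x a0 k0.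
Qed.

Let sqrt_quadratic_ge (a k x : R) : (0 < a)%R -> (0 <= k)%R -> (0 <= x)%R ->
  (Num.sqrt k * x <= Num.sqrt (a + k * x ^+ 2))%R.
Proof.
move=> a0 k0 x0; rewrite -{1}(ger0_norm x0) -sqrtr_sqr -sqrtrM// ler_wsqrtr//.
by rewrite lerDr ltW.
Qed.

Lemma integral_inv_sqrt3 (a k : R) : (0 < a)%R -> (0 < k)%R ->
  \int[mu]_(x in `[0%R, +oo[) (Num.sqrt (a + k * x ^+ 2) ^- 3)%:E = ((a * Num.sqrt k)^-1)%:E.
Proof.
move=> a0 k0; have k0' := ltW k0.
have w0 x := sqrt_quadratic_gt0 x a0 k0'.
have w2 x : (Num.sqrt (a + k * x ^+ 2) ^+ 2 = a + k * x ^+ 2)%R.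
  by rewrite sqr_sqrtr// ltW// -sqrtr_gt0.
have sk0 : (0 < Num.sqrt k)%R by rewrite sqrtr_gt0.
have sk2 : (Num.sqrt k ^+ 2 = k)%R by rewrite sqr_sqrtr.
rewrite (@integral_antiderivative_0y _ (fun x => x / (a * Num.sqrt (a + k * x ^+ 2)))%R _ (a * Num.sqrt k)^-1%R
   ((Num.sqrt a * k)^-1)%R).
- by rewrite mul0r subr0.
- by move=> x _; rewrite invr_ge0 exprn_ge0// ltW.
- move=> x _; apply: cvgV; first by rewrite expf_neq0// gt_eqF.
  have c := continuous_sqrt_quadratic (x := x) a0 k0'.
  by apply: cvgM => //; apply: cvgM.
- move=> x _; apply: is_derive_val.
  have dV := @is_deriveV R (fun z : R => Num.sqrt (a + k * z ^+ 2)) x _ 1%R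
    (lt0r_neq0 (w0 x)) (is_derive_sqrt_quadratic x a0 k0').
  apply: (is_derive_congr (is_deriveZ a^-1%R (is_deriveM (is_derive_id x 1%R) dV))) => /=.
    by move=> z /=; rewrite invfM mulrCA.
  rewrite /GRing.scale/=; have := w2 x; have := w0 x; set w := Num.sqrt _ => wp e.
  apply: (@mulfI _ (a * w ^+ 3)%R); first by rewrite mulf_neq0// ?expf_neq0// gt_eqF.
  transitivity (w ^+ 2 - k * x ^+ 2)%R; first by field; rewrite !gt_eqF.
  by rewrite e addrK mulfK// expf_neq0// gt_eqF.
- move=> x x0.
  have wx := sqrt_quadratic_ge a0 k0' (ltW x0).
  have wa : (Num.sqrt a <= Num.sqrt (a + k * x ^+ 2))%R.
    by rewrite ler_wsqrtr// lerDl mulr_ge0 ?sqr_ge0.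
  have := w2 x; move: wx wa (w0 x); set w := Num.sqrt (_ + _); move: sk0 sk2; set r := Num.sqrt k.
  move=> r0 r2 rx wa wp e.
  have p0 : (0 < r * w * (w + r * x))%R by rewrite !mulr_gt0// addr_gt0// mulr_gt0.
  (* The factorisation [a = (w - r x) (w + r x)] removes the cancellation between the antiderivative
     and its limit. *)
  have -> : (x / (a * w) - (a * r)^-1 = - (r * w * (w + r * x))^-1)%R.
    have ae : (a = (w - r * x) * (w + r * x))%R by rewrite -subr_sqr e exprMn r2 addrK.
    have n1 : (w + r * x != 0)%R by rewrite gt_eqF// addr_gt0// mulr_gt0.
    have n2 : (w - r * x != 0)%R by apply: contraTneq a0 => z; rewrite ae z mul0r ltxx.
    by rewrite ae; field; rewrite n1 n2 !gt_eqF.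
  rewrite normrN gtr0_norm ?invr_gt0// -invfM lef_pV2 ?posrE ?mulr_gt0 ?sqrtr_gt0//.
  rewrite -r2 expr2 -!mulrA (mulrCA _ r) ler_pM2l//.
  rewrite mulrCA; apply: (@le_trans _ _ (w * (r * x))%R).
    by rewrite mulrCA mulrA -mulrA; rewrite ler_pM2r ?mulr_gt0.
  by rewrite ler_pM2l// lerDr ltW.
  - by rewrite -sqrtr_gt0.
  - by rewrite addr_gt0// mulr_gt0.
Qed.

Definition artanh (r : R) : R := (2^-1 * ln ((1 + r) / (1 - r)))%R.

(** Put [r = sqrt v] and [w = sqrt (1 + (1 - v) t^2)]. From [w^2 - r^2 = (1 - v) (1 + t^2)] the
    integrand is [r dw / (w^2 - r^2)], whence the logarithmic antiderivative. *)
Lemma integral_artanh (v : R) : (0 < v)%R -> (v < 1)%R ->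
  \int[mu]_(t in `[0%R, +oo[)
    (t * Num.sqrt v / ((1 + t ^+ 2) * Num.sqrt (1 + (1 - v) * t ^+ 2)))%:E = (artanh (Num.sqrt v))%:E.
Proof.
move=> v0 v1; set r := Num.sqrt v.
have r0 : (0 < r)%R by rewrite sqrtr_gt0.
have r2 : (r ^+ 2 = v)%R by rewrite sqr_sqrtr// ltW.
have r1 : (r < 1)%R by rewrite -[ltRHS]sqrtr1 ltr_sqrt.
have k0 : (0 < 1 - v)%R by rewrite subr_gt0.
have k0' := ltW k0.
have w0 x := sqrt_quadratic_gt0 x ltr01 k0'.
pose w (x : R) := Num.sqrt (1 + (1 - v) * x ^+ 2).
have w2 x : (w x ^+ 2 = 1 + (1 - v) * x ^+ 2)%R.
  by rewrite sqr_sqrtr// ltW// -sqrtr_gt0.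
have w1 x : (1 <= w x)%R.
  by rewrite -[leLHS]sqrtr1 ler_wsqrtr// lerDl mulr_ge0 ?sqr_ge0.
have wr x : (0 < w x - r)%R by rewrite subr_gt0 (lt_le_trans r1).
have wr' x : (0 < w x + r)%R by rewrite addr_gt0// (lt_le_trans ltr01).
have q0 (x : R) : (0 < 1 + x ^+ 2)%R by rewrite ltr_wpDr// sqr_ge0.
rewrite (@integral_antiderivative_0y _ (fun x => 2^-1 * ln ((w x - r) / (w x + r)))%R _ 0%R
   ((r / (1 - r) / Num.sqrt (1 - v)))%R).
- rewrite sub0r /artanh -mulrN -lnV ?posrE ?divr_gt0//.
  by rewrite /w expr0n/= mulr0 addr0 sqrtr1 invf_div.
- by move=> x x0; rewrite divr_ge0 ?mulr_ge0// ltW.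
- move=> x _; have c := continuous_sqrt_quadratic (x := x) ltr01 k0'.
  apply: cvgM; first by apply: cvgM; [exact: cvg_id|exact: cvg_cst].
  apply: cvgV; first by rewrite mulf_neq0// gt_eqF.
  apply: cvgM => //; apply: cvgD; [exact: cvg_cst|exact: exprn_continuous].
- move=> x _; apply: is_derive_val.
  have dw : is_derive x 1%R w _ := is_derive_sqrt_quadratic x ltr01 k0'.
  have dm : is_derive x 1%R (fun z => w z - r)%R ((1 - v) * x / w x)%R.
    by apply: is_derive_eq; rewrite subr0.
  have dp : is_derive x 1%R (fun z => w z + r)%R ((1 - v) * x / w x)%R.
    by apply: is_derive_eq; rewrite addr0.
  have dV := @is_deriveV R (fun z => w z + r)%R x _ 1%R (lt0r_neq0 (wr' x)) dp.
  have dl := @is_derive1_comp R (@ln R) (fun z => (w z - r) * (w z + r)^-1)%R x _ _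
    (is_derive1_ln (divr_gt0 (wr x) (wr' x))) (is_deriveM dm dV).
  apply: (is_derive_congr (is_deriveZ 2^-1%R dl)) => //=.
  rewrite /GRing.scale/= -/(w x).
  have n1 := lt0r_neq0 (wr x); have n2 := lt0r_neq0 (wr' x).
  have n3 := lt0r_neq0 (w0 x); have n4 := lt0r_neq0 (q0 x).
  have e : ((w x - r) * (w x + r) = (1 - v) * (1 + x ^+ 2))%R.
    by rewrite -subr_sqr w2 r2; ring.
  transitivity ((1 - v) * x / w x * r / ((w x - r) * (w x + r)))%R.
    by field; rewrite n1 n2 n3.
  by rewrite e; field; rewrite n3 n4 gt_eqF.
- move=> x x0.
  have wx : (Num.sqrt (1 - v) * x <= w x)%R := sqrt_quadratic_ge ltr01 k0' (ltW x0).
  have wp : (0 < w x)%R := w0 x.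
  have r1' : (0 < 1 - r)%R by rewrite subr_gt0.
  have s0 : (0 < Num.sqrt (1 - v))%R by rewrite sqrtr_gt0.
  rewrite subr0 ler0_norm; last first.
    rewrite pmulr_rle0// ln_le0// ler_pdivrMr// mul1r.
    by rewrite lerD2l; lra.
  rewrite -mulrN -lnV ?posrE ?divr_gt0// invf_div.
  have -> : ((w x + r) / (w x - r) = 1 + 2 * r / (w x - r))%R by field; rewrite gt_eqF.
  (* The rate comes from [ln (1 + x) <= x], then [w - r >= (1 - r) w] because [w >= 1], and finally
     [w >= sqrt (1 - v) x]. *)
  apply: (@le_trans _ _ (2^-1 * (2 * r / (w x - r)))%R).
    by rewrite ler_pM2l// le_ln1Dx// (@lt_trans _ _ 0%R)// divr_gt0// mulr_gt0.
  rewrite (_ : 2^-1 * _ = r / (w x - r))%R; last by field; rewrite gt_eqF.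
  rewrite -!mulrA ler_pM2l// -!invfM lef_pV2 ?posrE ?mulr_gt0//.
  apply: (@le_trans _ _ ((1 - r) * w x)%R); first by rewrite ler_pM2l.
  by rewrite mulrBl mul1r lerD2l lerN2 ler_pMr.
Qed.

(** [1 - 2 / (expR (2 * u) + 1)] is [tanh u], the inverse function of [artanh]. *)
Lemma artanh_gt (r u : R) : (0 <= r)%R -> (r < 1)%R ->
  (u < artanh r)%R = (1 - 2 / (expR (2 * u) + 1) < r)%R.
Proof.
move=> r0 r1; have r1' : (0 < 1 - r)%R by rewrite subr_gt0.
have q0 : (0 < (1 + r) / (1 - r))%R by rewrite divr_gt0// ltr_wpDr.
have e0 : (0 < expR (2 * u) + 1)%R by rewrite addr_gt0// expR_gt0.
rewrite /artanh mulrC ltr_pdivlMr// mulrC -ltr_expR lnK ?posrE// ltr_pdivlMr//.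
rewrite ltrBlDr -ltrBlDl ltr_pdivlMr//.
rewrite -subr_gt0 -[RHS]subr_gt0; congr (0 < _)%R; ring.
Qed.

(** The integrand is [1 - tanh^2], the derivative of [tanh]. *)
Lemma integral_tanh : \int[mu]_(u in `[0%R, +oo[)
  (1 - (1 - 2 / (expR (2 * u) + 1)) ^+ 2)%:E = 1.
Proof.
have e0 (u : R) : (0 < expR (2 * u) + 1)%R by rewrite addr_gt0// expR_gt0.
have d (x : R) : is_derive x 1%R (fun u => 1 - 2 / (expR (2 * u) + 1))%R
    (1 - (1 - 2 / (expR (2 * x) + 1)) ^+ 2)%R.
  have dl : is_derive x 1%R (fun u : R => 2 * u)%R 2%R.
    by apply: is_derive_eq; rewrite /GRing.scale/=; ring.
  have de : is_derive x 1%R (fun u : R => expR (2 * u) + 1)%R (expR (2 * x) * 2 + 0)%R.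
    exact: is_deriveD (is_derive_expR_comp dl) (is_derive_cst _ _ _).
  have dV := @is_deriveV R (fun u : R => expR (2 * u) + 1)%R x _ 1%R (lt0r_neq0 (e0 x)) de.
  by apply: is_derive_eq; rewrite /GRing.scale/=; field; rewrite gt_eqF.
rewrite (@integral_antiderivative_0y _ (fun u => 1 - 2 / (expR (2 * u) + 1))%R _ 1%R 1%R).
- rewrite mulr0 expR0 divff ?subrr ?subr0//.
- move=> x x0; rewrite subr_ge0 expr_le1//.
  rewrite subr_ge0 ler_pdivrMr// mul1r; have := expR_ge1Dx (2 * x); lra.
- move=> x _; apply: cvgB; first exact: cvg_cst.
  have c : {for x, continuous (fun u : R => 1 - 2 / (expR (2 * u) + 1))%R}.
    apply: differentiable_continuous; apply/derivable1_diffP.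
    by case: (d x).
  rewrite expr2; under eq_fun do rewrite expr2; exact: cvgM.
- by move=> x _; apply: is_derive_val.
- move=> x x0; rewrite addrAC subrr add0r normrN ger0_norm; last by rewrite divr_ge0// ltW.
  rewrite div1r ler_pdivrMr// mulrC ler_pdivlMr//.
  have := expR_ge1Dx (2 * x); lra.
Qed.


End half_line_calculus.

Section artanh_uniform.
Local Open Scope ereal_scope.
Context d (T : measurableType d) (R : realType) (P : probability T R).
Variable V : T -> R.
Hypothesis hV : uniform01 P V.

Lemma uniform_prob_gt (a : R) : (0 <= a)%R -> (a <= 1)%R ->
  P (V @^-1` `]a, 1%R]) = (1 - a)%:E.
Proof.
move=> a0 a1; case: hV => _ h.
transitivity (uniform_prob (@ltr01 R) `]a, 1%R]%classic); first exact: h.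
rewrite uniform_prob01//.
  by rewrite lebesgue_measure_itv/= lte_fin; case: ltgtP a1 => // -> _; rewrite subrr.
by move=> x; rewrite /= !in_itv/= => /andP[ax ->]; rewrite (le_trans a0)// ltW.
Qed.

Lemma ae_uniform01_gt0 : {ae P, forall w, (0 < V w < 1)%R}.
Proof.
have mV := hV.1.
have Vn : {ae P, forall w, V w != 0%R}.
  exists (V @^-1` [set 0%R]); split => //.
  - by rewrite -[X in measurable X]setTI; exact: mV.
  - transitivity (uniform_prob (@ltr01 R) [set 0%R]); first exact: (hV.2 _ (measurable_set1 _)).
    rewrite uniform_prob01//; first exact: lebesgue_measure_set1.
    by move=> x ->; rewrite /= in_itv/= lexx ler01.
  - by move=> w /= /negP; rewrite negbK => /eqP.
apply: filterS2 Vn (ae_uniform01 hV) => w n /andP[v0 v1].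
by rewrite v1 lt_neqAle eq_sym n v0.
Qed.

(** Integration of the tail: almost surely, [artanh (sqrt V) > u] means [V > tanh u ^+ 2], an event
    of probability [1 - tanh u ^+ 2]. *)
Lemma integral_artanh_uniform : \int[P]_w (artanh (Num.sqrt (V w)))%:E = 1.
Proof.
have mV := hV.1.
pose r w := Num.sqrt (V w).
have mr : measurable_fun setT r.
  by apply: measurableT_comp => //; apply: continuous_measurable_fun; exact: sqrt_continuous.
(* A measurable version that is nonnegative everywhere; it agrees with [artanh] as soon as
   [0 < V w < 1]. *)
pose z w := `|2^-1 * (ln (1 + r w) - ln (1 - r w))|%R.
have mz : measurable_fun setT z.
  apply: measurableT_comp => //; apply: measurable_funM => //; apply: measurable_funB.
    by apply: measurableT_comp => //; apply: measurable_funD.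
  by apply: measurableT_comp => //; apply: measurable_funB.
have r01 : {ae P, forall w, (0 <= r w < 1)%R /\ artanh (r w) = z w}.
  apply: filterS ae_uniform01_gt0 => w /andP[v0 v1].
  have r1 : (r w < 1)%R by rewrite -[ltRHS]sqrtr1 ltr_sqrt.
  have r0 : (0 <= r w)%R by exact: sqrtr_ge0.
  rewrite r0 r1; split => //.
  have q : (0 < 1 - r w)%R by rewrite subr_gt0.
  have e : artanh (r w) = (2^-1 * (ln (1 + r w) - ln (1 - r w)))%R.
    by rewrite /artanh ln_div// posrE// ltr_wpDr.
  rewrite /z -e ger0_norm// /artanh mulr_ge0// ln_ge0// ler_pdivlMr// mul1r.
  lra.
transitivity (\int[P]_w (z w)%:E).
  by apply: integral_ae_eq_any; apply: filterS r01 => w [_ ->].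
pose Z : {RV P >-> R} := HB.pack z (isMeasurableFun.Build _ _ _ _ _ mz).
have Z0 x : (0 <= Z x)%R by exact: normr_ge0.
have := @ge0_expectation_ccdf _ _ _ P Z Z0; rewrite unlock => ->.
rewrite -integral_tanh; apply: eq_integral => u; rewrite inE/= in_itv/= andbT => u0.
pose th := (1 - 2 / (expR (2 * u) + 1) : R)%R.
have e1 : (2 <= expR (2 * u) + 1)%R by have := expR_ge1Dx (2 * u); lra.
have e0 : (0 < expR (2 * u) + 1)%R by lra.
have th0 : (0 <= th)%R by rewrite subr_ge0 ler_pdivrMr// mul1r.
have th1 : (th <= 1)%R by rewrite lerBlDr lerDl divr_ge0// ltW.
rewrite -uniform_prob_gt ?sqr_ge0 ?expr_le1//.
rewrite /ccdf.
have m1 : measurable (z @^-1` `]u, +oo[) by rewrite -[X in measurable X]setTI; exact: (mz measurableT).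
have m2 : measurable (V @^-1` `](th ^+ 2)%R, 1%R]) by rewrite -[X in measurable X]setTI; exact: mV.
transitivity (\int[P]_w (\1_(z @^-1` `]u, +oo[) w)%:E); first by rewrite integral_indic// setIT.
transitivity (\int[P]_w (\1_(V @^-1` `](th ^+ 2)%R, 1%R]) w)%:E); last by rewrite integral_indic// setIT.
apply: integral_ae_eq_any; apply: filterS2 r01 ae_uniform01_gt0 => w [/andP[r0 r1] zE] /andP[v0 v1].
have thr : (u < artanh (r w))%R = (th ^+ 2 < V w)%R.
  by rewrite artanh_gt// -[V w]sqr_sqrtr ?(ltW v0)// ltr_pXn2r ?nnegrE.
rewrite !indicE; congr (nat_of_bool _)%:R%:E.
by apply/idP/idP; rewrite !inE/= !in_itv/= andbT -zE thr (ltW v1) andbT.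
Qed.

End artanh_uniform.

(** * The Bessel expectation through Gaussian integrals *)

Section bessel_expectation.
Local Open Scope ereal_scope.
Context d (T : measurableType d) (R : realType) (P : probability T R).
Local Notation mu := (@lebesgue_measure R).
Local Notation c := (Num.sqrt (2 / pi) : R).

Lemma tonelli_quadrant (f : R -> R * T -> \bar R) :
  measurable_fun setT (fun z : R * (R * T) => f z.1 z.2) -> (forall s z, 0 <= f s z) ->
  \int[P]_w \int[mu]_(t in `[0%R, +oo[) \int[mu]_(s in `[0%R, +oo[) f s (t, w) =
  \int[mu]_(t in `[0%R, +oo[) \int[mu]_(s in `[0%R, +oo[) \int[P]_w f s (t, w).
Proof.
move=> mf f0; have mF := measurable_half_line mf f0.
rewrite (@tonelli_half_line _ _ _ P (fun t w => \int[mu]_(s in `[0%R, +oo[) f s (t, w))); last 2 first.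
- by rewrite (_ : (fun z => _) = (fun z => \int[mu]_(s in `[0%R, +oo[) f s z))//; apply/funext; case.
- by move=> t w; exact: integral_ge0.
suff fT (t : R) : \int[P]_w \int[mu]_(s in `[0%R, +oo[) f s (t, w) =
    \int[mu]_(s in `[0%R, +oo[) \int[P]_w f s (t, w).
  by apply: eq_integral => t _; exact: fT.
apply: (@tonelli_half_line _ _ _ P (fun s w => f s (t, w))) => //.
have mh : measurable_fun setT (fun z : R * T => (z.1, (t, z.2))).
  apply: measurable_fun_pair; first exact: measurable_fst.
  by apply: measurable_fun_pair => //; exact: measurable_snd.
have mfh := measurableT_comp mf mh; exact: mfh.
Qed.

Lemma eq_tonelli_quadrant (f g : R -> R * T -> \bar R) :
  measurable_fun setT (fun z : R * (R * T) => f z.1 z.2) -> (forall s z, 0 <= f s z) ->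
  measurable_fun setT (fun z : R * (R * T) => g z.1 z.2) -> (forall s z, 0 <= g s z) ->
  (forall s t, \int[P]_w f s (t, w) = \int[P]_w g s (t, w)) ->
  \int[P]_w \int[mu]_(t in `[0%R, +oo[) \int[mu]_(s in `[0%R, +oo[) f s (t, w) =
  \int[P]_w \int[mu]_(t in `[0%R, +oo[) \int[mu]_(s in `[0%R, +oo[) g s (t, w).
Proof.
move=> mf f0 mg g0 fg; rewrite (tonelli_quadrant mf f0) (tonelli_quadrant mg g0).
by apply: eq_integral => t _; apply: eq_integral => s _.
Qed.

(** This is [1 / x] for [x > 0], and [xgauss_int] below is [1 / x^2] for [x != 0], but both are
    [+oo] at 0, where the real inverse is 0. Left unevaluated, they allow Tonelli before the process
    is known to avoid 0. *)
Definition gauss_int (x : R) : \bar R :=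
  c%:E * \int[mu]_(s in `[0%R, +oo[) (expR (- (x ^+ 2 * s ^+ 2 / 2)))%:E.

Definition xgauss_int (x : R) : \bar R :=
  \int[mu]_(t in `[0%R, +oo[) (t * expR (- (x ^+ 2 * t ^+ 2 / 2)))%:E.

Let c0 : (0 < c)%R.
Proof. by rewrite sqrtr_gt0 divr_gt0// pi_gt0. Qed.

Let mu_0y : mu `[0%R, +oo[%classic = +oo. Proof. by rewrite lebesgue_measure_itv/= ltry. Qed.

Lemma gauss_intE (x : R) : (0 < x)%R -> gauss_int x = (x^-1)%:E.
Proof.
by move=> x0; rewrite /gauss_int integral_gauss_half ?exprn_gt0// sqrtr_sqr gtr0_norm.
Qed.

Lemma gauss_int0 : gauss_int 0 = +oo.
Proof.
rewrite /gauss_int (eq_integral (cst 1)); last first.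
  by move=> s _; rewrite expr0n/= mul0r mul0r oppr0 expR0.
rewrite integral_cst//.
by rewrite mul1e [X in _ * X]mu_0y gt0_muley// lte_fin.
Qed.

Lemma xgauss_intE (x : R) : x != 0%R -> xgauss_int x = ((x ^+ 2)^-1)%:E.
Proof. by move=> x0; rewrite /xgauss_int integral_x_gauss// exprn_even_gt0. Qed.

Lemma xgauss_int0 : xgauss_int 0 = +oo.
Proof.
apply/eqP; rewrite eq_le leey/=.
have <- : mu `[1%R, +oo[%classic = +oo by rewrite lebesgue_measure_itv/= ltry.
rewrite -[leLHS]mul1e -(@integral_cst _ _ _ mu `[1%R, +oo[%classic)//.
have m1 : measurable (`[1%R, +oo[%classic : set R) by exact: measurable_itv.
have m0 : measurable (`[0%R, +oo[%classic : set R) by exact: measurable_itv.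
have mf : measurable_fun setT (fun t : R => (t * expR (- (0 ^+ 2 * t ^+ 2 / 2)))%:E).
  apply/measurable_EFinP; apply: measurable_funM => //; apply: measurableT_comp => //.
  apply: measurableT_comp => //; apply: measurable_funM => //.
  by apply: measurable_funM => //; exact: measurable_funX.
apply: (@le_trans _ _ (\int[mu]_(t in `[1%R, +oo[) (t * expR (- (0 ^+ 2 * t ^+ 2 / 2)))%:E)).
  apply: ge0_le_integral => //.
  - exact: measurable_funTS.
  - move=> t; rewrite /= in_itv/= andbT => t1.
    by rewrite expr0n/= mul0r mul0r oppr0 expR0 mulr1 lee_fin.
apply: ge0_subset_integral => //.
- exact: measurable_funTS.
- by move=> t; rewrite /= in_itv/= andbT => t0; rewrite lee_fin mulr_ge0// expR_ge0.
- by move=> t; rewrite /= !in_itv/= !andbT; exact: le_trans.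
Qed.

Lemma gauss_int_gt0 (x : R) : (0 <= x)%R -> 0 < gauss_int x.
Proof.
rewrite le_eqVlt => /predU1P[<-|x0]; first by rewrite gauss_int0.
by rewrite gauss_intE// lte_fin invr_gt0.
Qed.

Lemma xgauss_int_gt0 (x : R) : 0 < xgauss_int x.
Proof.
have [->|x0] := eqVneq x 0%R; first by rewrite xgauss_int0.
by rewrite xgauss_intE// lte_fin invr_gt0 exprn_even_gt0.
Qed.

End bessel_expectation.

Section bessel_ratio.
Local Open Scope ereal_scope.
Context d (T : measurableType d) (R : realType) (P : probability T R).
Variables (X : R -> T -> R) (V : T -> R).
Hypothesis hX : bessel3 P X.
Hypothesis hV : uniform01 P V.
Hypothesis hVX : independent_of_process P V X.
Local Notation mu := (@lebesgue_measure R).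
Local Notation c := (Num.sqrt (2 / pi) : R).

Let mV : measurable_fun setT V. Proof. by case: hV. Qed.
Let mX1 : measurable_fun setT (X 1%R). Proof. exact: (bessel_measurable hX). Qed.

Section gauss_side.
Variable Y : T -> R.
Hypothesis mY : measurable_fun setT Y.
Hypothesis YE : {ae P, forall w, X (V w) w = Y w}.

(** The variables [s] and [t = z.1] belong to the Gaussian representations of [1 / X_V] and
    [1 / X_1^2]; [g] below has the same expectation as [f] for all [s] and [t], by
    [bessel_uniform_laplace]. Absolute values keep both nonnegative off the half-line. *)
Let f (s : R) (z : R * T) :=
  (`|z.1| * (`|V z.2| * expR (- (s ^+ 2 * Y z.2 ^+ 2 + z.1 ^+ 2 * X 1 z.2 ^+ 2) / 2)))%:E.
Let g (s : R) (z : R * T) :=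
  (`|z.1| * (`|V z.2| * Num.sqrt (1 + z.1 ^+ 2 + s ^+ 2 * V z.2 * (1 + z.1 ^+ 2 * (1 - V z.2))) ^- 3))%:E.

Let f0 s z : 0 <= f s z.
Proof. by rewrite lee_fin !mulr_ge0 ?expR_ge0. Qed.

Let g0 s z : 0 <= g s z.
Proof. by rewrite lee_fin !mulr_ge0// invr_ge0 exprn_ge0. Qed.

Let m1 : measurable_fun setT (fun z : R * (R * T) => z.1).
Proof. exact: measurable_fst. Qed.

Let m2 : measurable_fun setT (fun z : R * (R * T) => z.2.1).
Proof. by apply: measurableT_comp; [exact: measurable_fst|exact: measurable_snd]. Qed.

Let m3 (h : T -> R) : measurable_fun setT h -> measurable_fun setT (fun z : R * (R * T) => h z.2.2).
Proof.
move=> mh; apply: (measurableT_comp mh).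
by apply: measurableT_comp; [exact: measurable_snd|exact: measurable_snd].
Qed.

Let mf : measurable_fun setT (fun z : R * (R * T) => f z.1 z.2).
Proof.
apply/measurable_EFinP; apply: measurable_funM; first exact: (measurableT_comp _ m2).
apply: measurable_funM; first exact: (measurableT_comp _ (m3 mV)).
apply: measurableT_comp => //; apply: measurable_funM => //; apply: measurableT_comp => //.
by apply: measurable_funD; apply: measurable_funM; apply: measurable_funX => //; exact: m3.
Qed.

Let mg : measurable_fun setT (fun z : R * (R * T) => g z.1 z.2).
Proof.
apply/measurable_EFinP; apply: measurable_funM; first exact: (measurableT_comp _ m2).
apply: measurable_funM; first exact: (measurableT_comp _ (m3 mV)).
under eq_fun do rewrite -exprVn; apply: measurable_funX.
apply: (measurableT_comp (@measurable_inv_sqrt R)).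
have mV3 := m3 mV; have mq : measurable_fun setT (fun z : R * (R * T) => z.2.1 ^+ 2)%R.
  exact: measurable_funX.
apply: measurable_funD; first exact: measurable_funD.
apply: measurable_funM; first by apply: measurable_funM => //; exact: measurable_funX.
apply: measurable_funD => //; apply: measurable_funM => //; exact: measurable_funB.
Qed.

Let fg s t : \int[P]_w f s (t, w) = \int[P]_w g s (t, w).
Proof.
rewrite /f /g/=; under eq_integral do rewrite EFinM; under [RHS]eq_integral do rewrite EFinM.
have mgt : measurable_fun setT (fun w => (`|V w| *
    Num.sqrt (1 + t ^+ 2 + s ^+ 2 * V w * (1 + t ^+ 2 * (1 - V w))) ^- 3)%:E).
  apply/measurable_EFinP; apply: measurable_funM; first exact: measurableT_comp.
  under eq_fun do rewrite -exprVn; apply: measurable_funX.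
  apply: (measurableT_comp (@measurable_inv_sqrt R)).
  apply: measurable_funD => //; apply: measurable_funM; first exact: measurable_funM.
  by apply: measurable_funD => //; apply: measurable_funM => //; exact: measurable_funB.
have mft : measurable_fun setT (fun w => (`|V w| *
    expR (- (s ^+ 2 * Y w ^+ 2 + t ^+ 2 * X 1 w ^+ 2) / 2))%:E).
  apply/measurable_EFinP; apply: measurable_funM; first exact: measurableT_comp.
  apply: measurableT_comp => //; apply: measurable_funM => //; apply: measurableT_comp => //.
  by apply: measurable_funD; apply: measurable_funM => //; exact: measurable_funX.
rewrite !ge0_integralZl//.
congr (_ * _); rewrite -(bessel_uniform_laplace hX hV hVX) ?sqr_ge0//.
by apply: integral_ae_eq_any; apply: filterS YE => w ->.
Qed.

Let intf w : c%:E * \int[mu]_(t in `[0%R, +oo[) \int[mu]_(s in `[0%R, +oo[) f s (t, w) =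
  `|V w|%:E * (gauss_int (Y w) * xgauss_int (X 1 w)).
Proof.
rewrite /gauss_int; set B := xgauss_int (X 1 w).
set A := \int[mu]_(s in `[0%R, +oo[) (expR (- (Y w ^+ 2 * s ^+ 2 / 2)))%:E.
have mexp (y : R) : measurable_fun setT (fun s : R => expR (- (y * s ^+ 2 / 2))).
  apply: measurableT_comp => //; apply: measurableT_comp => //; apply: measurable_funM => //.
  by apply: measurable_funM => //; exact: measurable_funX.
have A0 : 0 <= A by apply: integral_ge0 => s _; rewrite lee_fin expR_ge0.
transitivity (c%:E * \int[mu]_(t in `[0%R, +oo[)
    ((`|V w|%:E * A) * (t * expR (- (X 1 w ^+ 2 * t ^+ 2 / 2)))%:E)).
  congr (_ * _); apply: eq_integral => t; rewrite inE/= in_itv/= andbT => t0.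
  rewrite -muleA (muleC A) muleA -EFinM /A -ge0_integralZl//.
  - apply: eq_integral => s _; rewrite -EFinM /f/= ger0_norm//; congr (_%:E).
    rewrite -!mulrA mulrCA; congr (_ * (_ * _))%R.
    by rewrite -expRD; congr expR; field.
  - by apply/measurable_funTS/measurable_EFinP; exact: mexp.
  - by rewrite lee_fin !mulr_ge0// expR_ge0.
rewrite ge0_integralZl//.
- by rewrite -/(xgauss_int (X 1 w)) -/B -!muleA [LHS]muleCA.
- apply/measurable_funTS/measurable_EFinP; apply: measurable_funM => //; exact: mexp.
- by move=> t; rewrite /= in_itv/= andbT => t0; rewrite lee_fin mulr_ge0// expR_ge0.
- by rewrite mule_ge0.
Qed.

(** The integral over [s] is an instance of [integral_inv_sqrt3]; the one left over [t] is that of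
    [integral_artanh]. *)
Let intg w : (0 < V w < 1)%R ->
  \int[mu]_(t in `[0%R, +oo[) \int[mu]_(s in `[0%R, +oo[) g s (t, w) = (artanh (Num.sqrt (V w)))%:E.
Proof.
move=> /andP[v0 v1]; rewrite -integral_artanh//.
apply: eq_integral => t; rewrite inE/= in_itv/= andbT => t0.
pose a := (1 + t ^+ 2)%R; pose k := (V w * (1 + t ^+ 2 * (1 - V w)))%R.
have a0 : (0 < a)%R by rewrite /a ltr_wpDr// sqr_ge0.
have b0 : (0 < 1 + t ^+ 2 * (1 - V w))%R by rewrite ltr_wpDr// mulr_ge0 ?sqr_ge0// subr_ge0 ltW.
have k0 : (0 < k)%R by rewrite mulr_gt0.
transitivity ((t * V w)%:E * \int[mu]_(s in `[0%R, +oo[) (Num.sqrt (a + k * s ^+ 2) ^- 3)%:E).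
  rewrite -ge0_integralZl//.
  - apply: eq_integral => s _; rewrite -EFinM /g/= !ger0_norm ?(ltW v0)//.
    by rewrite -[in RHS]mulrA -(mulrA (s ^+ 2)%R) -/a -/k (mulrC k).
  - apply/measurable_funTS/measurable_EFinP.
    under eq_fun do rewrite -exprVn; apply: measurable_funX.
    apply: (measurableT_comp (@measurable_inv_sqrt R)).
    by apply: measurable_funD => //; apply: measurable_funM => //; exact: measurable_funX.
  - by rewrite lee_fin mulr_ge0// ltW.
rewrite integral_inv_sqrt3// -EFinM; congr EFin.
rewrite /k /a sqrtrM ?(ltW v0)// (mulrC (t ^+ 2)%R (1 - _)%R).
have s0 : (0 < Num.sqrt (V w))%R by rewrite sqrtr_gt0.
have s1 : (0 < Num.sqrt (1 + (1 - V w) * t ^+ 2))%R by rewrite sqrtr_gt0 mulrC.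
have := sqr_sqrtr (ltW v0); move: s0 s1 a0; rewrite /a; set q := Num.sqrt (1 + _); set r := Num.sqrt _.
by move=> r0 q0 a0 <-; field; rewrite !gt_eqF.
Qed.

(** Measurability is returned together with the value: the two give integrability, hence finiteness
    almost everywhere. *)
Lemma integral_gauss_bessel :
  \int[P]_w (`|V w|%:E * (gauss_int (Y w) * xgauss_int (X 1 w))) = c%:E /\
  measurable_fun setT (fun w => `|V w|%:E * (gauss_int (Y w) * xgauss_int (X 1 w))).
Proof.
have mF := measurable_half_line mf f0.
have mFF : measurable_fun setT (fun w =>
    \int[mu]_(t in `[0%R, +oo[) \int[mu]_(s in `[0%R, +oo[) f s (t, w)).
  apply: (@measurable_half_line _ _ _ (fun t w => \int[mu]_(s in `[0%R, +oo[) f s (t, w))).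
  - by rewrite (_ : (fun z => _) = (fun z => \int[mu]_(s in `[0%R, +oo[) f s z))//; apply/funext; case.
  - by move=> t w; exact: integral_ge0.
have -> : (fun w => `|V w|%:E * (gauss_int (Y w) * xgauss_int (X 1 w))) =
    (fun w => c%:E * \int[mu]_(t in `[0%R, +oo[) \int[mu]_(s in `[0%R, +oo[) f s (t, w)).
  by apply/funext => w; rewrite intf.
split; last exact: emeasurable_funM.
rewrite ge0_integralZl//; last first.
  by move=> w _; do 2!apply: integral_ge0 => ? _.
rewrite (eq_tonelli_quadrant mf f0 mg g0 fg).
rewrite (@integral_ae_eq_any _ _ _ _ _ (fun w => (artanh (Num.sqrt (V w)))%:E)).
  by rewrite integral_artanh_uniform// mule1.
by apply: filterS (ae_uniform01_gt0 hV) => w; exact: intg.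
Qed.

End gauss_side.

Lemma expectation_bessel :
  'E_P[fun w => (V w / (X (V w) w * X 1 w ^+ 2))%R] = c%:E.
Proof.
have [Y mY YE] := ae_measurable_bessel_uniform hX hV.
have [IY mI] := integral_gauss_bessel mY YE.
rewrite unlock -IY; apply: integral_ae_eq_any.
set h := fun w => _ in mI.
have h0 w : (0 <= X (V w) w)%R -> X (V w) w = Y w -> 0 <= h w.
  move=> x0 e; rewrite /h mule_ge0// mule_ge0// ltW//; last exact: xgauss_int_gt0.
  by apply: gauss_int_gt0; rewrite -e.
have hint : P.-integrable setT h.
  apply/integrableP; split => //.
  rewrite (@integral_ae_eq_any _ _ _ _ _ h) ?IY ?ltry//.
  by apply: filterS2 (bessel_uniform_ge0 hX hV) YE => w x0 e; rewrite gee0_abs// h0.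
have hfin := integrable_ae measurableT hint.
(* The integral being finite, [X (V w) w] and [X 1 w] cannot vanish on a set of positive measure. *)
apply: filterS3 (filterI hfin (bessel_uniform_ge0 hX hV)) (ae_uniform01_gt0 hV) YE.
move=> w /= [/(_ I) + x0] /andP[v0 v1] e.
rewrite /h e gtr0_norm//; rewrite e in x0.
have [->|y0] := eqVneq (Y w) 0%R.
  by rewrite gauss_int0 gt0_mulye ?xgauss_int_gt0// gt0_muley ?lte_fin.
have yp : (0 < Y w)%R by rewrite lt_neqAle eq_sym y0.
have [->|z0] := eqVneq (X 1 w) 0%R.
  by rewrite xgauss_int0 gt0_muley ?gauss_int_gt0// gt0_muley ?lte_fin.
by rewrite gauss_intE// xgauss_intE// -!EFinM -invfM.
Qed.

End bessel_ratio.

Theorem mainTheorem7 (R : realType)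
    (d : measure_display) (T : measurableType d) (P : probability T R)
    (B : R -> T -> R) (U : T -> R)
    (hB : standard_brownian P B) (hU : uniform01 P U)
    (hUB : independent_of_process P U B)
    (d' : measure_display) (T' : measurableType d') (P' : probability T' R)
    (X : R -> T' -> R) (V : T' -> R)
    (hX : bessel3 P' X) (hV : uniform01 P' V)
    (hVX : independent_of_process P' V X) :
  [/\ ('E_P[fun w => `|alpha B U w|%R] < +oo)%E,
      (2%:E * 'E_P[alpha B U] =
         (Num.sqrt (2 / pi))%:E
         - 'E_P'[fun w => (V w / (X (V w) w * X 1 w ^+ 2))%R])%E
    & ('E_P[alpha B U] = 0 <->
         'E_P'[fun w => (V w / (X (V w) w * X 1 w ^+ 2))%R]
         = (Num.sqrt (2 / pi))%:E)%E].
Proof.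
have [fin E0] := expectation_alpha hB hU hUB.
have E1 := expectation_bessel hX hV hVX.
(* Both expectations being known, each side of the identity is 0 and each side of the equivalence is
   true. *)
by split => //; rewrite E0 E1 mule0 subee.
Qed.
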